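(* There is a threshold $\beta_0>0$ such that, if $\beta>\beta_0$, the HDG method is well-posed: for all $f\in[L^2(\Omega^s)]^{\mathrm{dim}}$ and $g\in L^2(\Omega^d)$ there is a unique $(\boldsymbol{u}_h,\boldsymbol{p}_h)\in\boldsymbol{Z}_h\times\boldsymbol{P}_h$ with $$a_h(\boldsymbol{u}_h,\boldsymbol{v}_h)+b_h(\boldsymbol{p}_h,\boldsymbol{v}_h)=(f,v_h)_{\Omega^s}\quad\forall\boldsymbol{v}_h=(v_h,\bar v_h,v_h^m)\in\boldsymbol{Z}_h,$$ $$b_h(\boldsymbol{q}_h,\boldsymbol{u}_h)-c_h(\boldsymbol{p}_h,\boldsymbol{q}_h)=-(g,q_h)_{\Omega^d}\quad\forall\boldsymbol{q}_h=(q_h,\bar q_h^s,\bar q_h^d,q_h^m,\bar q_h^m)\in\boldsymbol{P}_h.$$ The threshold $\beta_0$ is independent of $h,\mu,\kappa_f,\kappa_m,\sigma$.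
   Context: Geometry and parameters: $\mathrm{dim}\in\{2,3\}$; $\Omega\subset\mathbb{R}^{\mathrm{dim}}$ is a bounded Lipschitz domain; $\Omega^s,\Omega^d$ are disjoint Lipschitz domains with $\overline\Omega=\overline\Omega^s\cup\overline\Omega^d$; $\Gamma^I=\overline\Omega^s\cap\overline\Omega^d$, $\Gamma^j=\partial\Omega^j\cap\partial\Omega$; $n^j$ is the outward unit normal of $\Omega^j$ and $n=n^s=-n^d$ on $\Gamma^I$. $w^t=w-(w\cdot n)n$ for vectors; $\epsilon(u)=(\nabla u+(\nabla u)^T)/2$. $\mu,\kappa_f,\kappa_m,\alpha>0$ are constants, $0<\sigma\le\sigma^*$, and $\beta>0$ is the penalty parameter. Mesh: $\mathcal{T}^j$ is a member of a shape-regular family of simplicial triangulations of $\Omega^j$, $j=s,d$, matching at $\Gamma^I$, $\mathcal{T}=\mathcal{T}^s\cup\mathcal{T}^d$; $h_K$ is the diameter of $K$, $h=\max_K h_K$. $\mathcal{F}^j$ is the set of all facets in $\overline\Omega^j$ (interior facets, facets on $\Gamma^j$ and facets on $\Gamma^I$), and $\Gamma_0^j$ is their union. $k\ge1$; $P_k$ denotes polynomials of total degree at most $k$. Spaces: $V_h=\{v\in[L^2(\Omega)]^{\mathrm{dim}}:v|_K\in[P_k(K)]^{\mathrm{dim}}\ \forall K\in\mathcal{T}\}$; $V_h^d$ the same on $\Omega^d$ with $\mathcal{T}^d$; $Q_h=\{q\in L^2_0(\Omega):q|_K\in P_{k-1}(K)\ \forall K\in\mathcal{T}\}$; $Q_h^m=\{r\in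 L^2_0(\Omega^d):r|_K\in P_{k-1}(K)\ \forall K\in\mathcal{T}^d\}$ ($L_0^2$: mean zero); $\bar V_h=\{\bar v\in[L^2(\Gamma_0^s)]^{\mathrm{dim}}:\bar v|_F\in[P_k(F)]^{\mathrm{dim}}\ \forall F\in\mathcal{F}^s,\ \bar v=0\text{ on }\Gamma^s\}$; $\bar Q_h^j=\{\bar q\in L^2(\Gamma_0^j):\bar q|_F\in P_k(F)\ \forall F\in\mathcal{F}^j\}$, $j=s,d$. $\boldsymbol{Z}_h=V_h\times\bar V_h\times V_h^d$ with elements $\boldsymbol{v}_h=(v_h,\bar v_h,v_h^m)$; $\boldsymbol{P}_h=Q_h\times\bar Q_h^s\times\bar Q_h^d\times Q_h^m\times\bar Q_h^d$ with elements $\boldsymbol{q}_h=(q_h,\bar q_h^s,\bar q_h^d,q_h^m,\bar q_h^m)$. Forms: differential operators and $(\cdot,\cdot)_{\Omega^j}=\sum_{K\in\mathcal{T}^j}(\cdot,\cdot)_K$ act elementwise; $\langle\cdot,\cdot\rangle_{\partial\mathcal{T}^j}=\sum_{K\in\mathcal{T}^j}\langle\cdot,\cdot\rangle_{\partial K}$, where in such integrals $n,n^s$ denote the outward unit normal of $K$. $a_h(\boldsymbol{u},\boldsymbol{v})=a_h^s(\boldsymbol{u},\boldsymbol{v})+(\kappa_f^{-1}u,v)_{\Omega^d}+(\kappa_m^{-1}u^m,v^m)_{\Omega^d}+\langle\alpha\mu\kappa_f^{-1/2}\bar u^t,\bar v^t\rangle_{\Gamma^I}$, with $a_h^s(\boldsymbol{u},\boldsymbol{v})=(2\mu\epsilon(u),\epsilon(v))_{\Omega^s}-\langle2\mu\epsilon(u)n^s,v-\bar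 v\rangle_{\partial\mathcal{T}^s}-\langle2\mu\epsilon(v)n^s,u-\bar u\rangle_{\partial\mathcal{T}^s}+\sum_{K\in\mathcal{T}^s}2\beta\mu h_K^{-1}\langle u-\bar u,v-\bar v\rangle_{\partial K}$; $b_h(\boldsymbol{p},\boldsymbol{v})=\sum_{j=s,d}\big[-(p,\nabla\cdot v)_{\Omega^j}+\langle\bar p^j,v\cdot n\rangle_{\partial\mathcal{T}^j}-\langle\bar p^j,\bar v\cdot n^j\rangle_{\Gamma^I}\big]-(p^m,\nabla\cdot v^m)_{\Omega^d}+\langle\bar p^m,v^m\cdot n\rangle_{\partial\mathcal{T}^d}$; $c_h(\boldsymbol{p},\boldsymbol{q})=\sigma\kappa_m(p^m-p,q^m-q)_{\Omega^d}$. *)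

(* Defs.v *)
From HB Require Import structures.
From mathcomp Require Import all_boot all_order all_algebra finmap.
From mathcomp Require Import all_classical all_reals all_analysis.
Set Implicit Arguments.
Unset Strict Implicit.
Unset Printing Implicit Defensive.
Import Order.TTheory GRing.Theory Num.Theory.
Import numFieldNormedType.Exports.
Local Open Scope classical_set_scope.
Local Open Scope ring_scope.

(* Lebesgue measure on R^n, built on n.-tuple R as the n-fold product of the
   Lebesgue measure of R; tuple_measureS is m \x mu transported along cons. *)
Section product_tuple_measure.
Context d (T : measurableType d) (R : realType).
Variables (m : {sigma_finite_measure set T -> \bar R}) (n : nat).
Variable mu : {sigma_finite_measure set (n.-tuple T) -> \bar R}.

Let tcons (p : T * n.-tuple T) : n.+1.-tuple T := [the n.+1.-tuple T of p.1 :: p.2].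
Let tuncons (t : n.+1.-tuple T) : T * n.-tuple T :=
  (tnth t ord0, [tuple of behead t]).

Let measurable_tcons : measurable_fun setT tcons.
Proof. exact: measurable_cons measurable_fst measurable_snd. Qed.

Let measurable_tuncons : measurable_fun setT tuncons.
Proof.
apply: measurable_fun_pair; first exact: measurable_tnth.
exact: measurable_behead.
Qed.

Definition tuple_measureS : set (n.+1.-tuple T) -> \bar R :=
  pushforward (m \x mu)%E tcons.

Let tmS0 : tuple_measureS set0 = 0%E.
Proof. by rewrite /tuple_measureS /pushforward preimage_set0 measure0. Qed.

Let tmS_ge0 A : (0 <= tuple_measureS A)%E.
Proof. by rewrite /tuple_measureS /pushforward measure_ge0. Qed.

Let tmS_sigma_additive : semi_sigma_additive tuple_measureS.
Proof.
have mf := measurable_tcons.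
move=> F mF tF mUF; rewrite /tuple_measureS /pushforward preimage_bigcup.
apply: measure_semi_sigma_additive.
- by move=> k; rewrite -[X in measurable X]setTI; exact: mf.
- apply/trivIsetP => /= i j _ _ ij; rewrite -preimage_setI.
  by move/trivIsetP : tF => /(_ _ _ _ _ ij) ->//; rewrite preimage_set0.
- by rewrite -preimage_bigcup -[X in measurable X]setTI; exact: mf.
Qed.

HB.instance Definition _ := isMeasure.Build _ _ _ tuple_measureS
  tmS0 tmS_ge0 tmS_sigma_additive.

Let tmS_sigma_finite : sigma_finite setT tuple_measureS.
Proof.
have /sigma_finiteP[F [TF ndF Foo]] := sigma_finiteT m.
have /sigma_finiteP[G [TG ndG Goo]] := sigma_finiteT mu.
exists (fun k => tuncons @^-1` (F k `*` G k)).
  rewrite -preimage_bigcup (_ : \bigcup_k _ = setT) ?preimage_setT//.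
  rewrite -setXTT TF TG predeqE => -[x y]; split.
    by move=> [k _ []/= ? ?]; split; exists k.
  move=> [/= [k _ Fkx] [l _ Gly]]; exists (maxn k l) => //; split.
  - by move: x Fkx; exact/subsetPset/ndF/leq_maxl.
  - by move: y Gly; exact/subsetPset/ndG/leq_maxr.
move=> k; have [mFk Fk] := Foo k; have [mGk Gk] := Goo k; split.
  rewrite -[X in measurable X]setTI; apply: measurable_tuncons => //.
  exact: measurableX.
rewrite /tuple_measureS /pushforward -comp_preimage.
rewrite (_ : tuncons \o tcons = id) ?preimage_id.
  by rewrite product_measure1E// lte_mul_pinfty// ge0_fin_numE.
apply/funext => -[x t]; rewrite /tuncons /tcons /=; congr pair.
by apply: val_inj.
Qed.

HB.instance Definition _ := Measure_isSigmaFinite.Build _ _ _ tuple_measureS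
  tmS_sigma_finite.

End product_tuple_measure.

Fixpoint lebesgue_tuple (R : realType) (n : nat) :
    {sigma_finite_measure set (n.-tuple (measurableTypeR R)) -> \bar R} :=
  match n with
  | 0 => \d_ [tuple]
  | m.+1 => tuple_measureS (@lebesgue_measure R) (lebesgue_tuple R m)
  end.

Section calculus.
Context {R : realType} {d : nat}.
Local Notation pt := 'rV[R]_d.

Definition rv_of_tuple (t : d.-tuple (measurableTypeR R)) : pt :=
  \row_i tnth t i.

(* \int_A f dx over A in R^d; R^d carries the Lebesgue measure of d.-tuple R. *)
Definition vol_int (A : set pt) (f : pt -> R) : R :=
  \int[lebesgue_tuple R d]_(t in rv_of_tuple @^-1` A) f (rv_of_tuple t).

Definition L2 (A : set pt) (f : pt -> R) : Prop :=
  measurable_fun (rv_of_tuple @^-1` A) (f \o rv_of_tuple) /\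
  (\int[lebesgue_tuple R d]_(t in rv_of_tuple @^-1` A)
     ((f (rv_of_tuple t)) ^+ 2)%:E < +oo)%E.

Definition dot (x y : pt) : R := \sum_i x 0 i * y 0 i.

(* The norm `|x| of 'rV[R]_d is the sup norm; lengths here are Euclidean. *)
Definition enorm (x : pt) : R := Num.sqrt (dot x x).

Definition ddot (A B : 'M[R]_d) : R := \sum_i \sum_j A i j * B i j.

Definition tangential (n w : pt) : pt := w - dot w n *: n.

Definition gradv (v : pt -> pt) (x : pt) : 'M[R]_d :=
  \matrix_(i, j) 'D_(delta_mx 0 j) (fun y => v y 0 i) x.

Definition symgrad (v : pt -> pt) (x : pt) : 'M[R]_d :=
  2^-1 *: (gradv v x + (gradv v x)^T).

Definition divv (v : pt -> pt) (x : pt) : R := \tr (gradv v x).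

(* Polynomial functions on R^d of total degree at most k. *)
Definition Pk (k : nat) (p : pt -> R) : Prop :=
  exists c : {ffun 'I_d -> 'I_k.+1} -> R, forall x,
    p x = \sum_(a : {ffun 'I_d -> 'I_k.+1} | (\sum_i a i <= k)%N)
            c a * \prod_i x 0 i ^+ a i.

End calculus.

Section domains.
Context {R : realType} {d : nat}.
Local Notation pt := 'rV[R]_d.

Definition bdry (A : set pt) : set pt := closure A `\` A°.

(* Near each boundary point, Om is the strict epigraph, in a unit direction e,
   of a Lipschitz function of the component orthogonal to e. *)
Definition lipschitz_domain (Om : set pt) : Prop :=
  [/\ open Om, connected Om, Om !=set0 &
    forall x, bdry Om x ->
      exists (e : pt) (gam : pt -> R) (r L : R),
        [/\ enorm e = 1, 0 < r,
            forall y z, `|gam y - gam z| <= L * enorm (y - z) &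
            forall y, enorm (y - x) < r ->
              (Om y <-> gam (y - dot y e *: e) < dot y e)]].

Definition coupled_domain (Om Os Od : set pt) : Prop :=
  [/\ bounded_set Om,
      [/\ lipschitz_domain Om, lipschitz_domain Os & lipschitz_domain Od],
      Os `&` Od = set0 &
      closure Om = closure Os `|` closure Od].

Definition interface (Os Od : set pt) : set pt := closure Os `&` closure Od.

Definition outer_boundary (Oj Om : set pt) : set pt := bdry Oj `&` bdry Om.

End domains.

Section meshes.
Context {R : realType} {d : nat}.
Local Notation pt := 'rV[R]_d.

(* A simplex of any dimension is represented by its set of vertices. *)
Definition simplex := {fset pt}.
Definition mesh := {fset simplex}.

Definition hull (K : simplex) : set pt :=
  [set x | exists lam : pt -> R,
    [/\ forall a, a \in K -> 0 <= lam a,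
        \sum_(a <- K) lam a = 1 &
        x = \sum_(a <- K) lam a *: a]].

Definition affinely_independent (K : simplex) : Prop :=
  forall lam : pt -> R,
    \sum_(a <- K) lam a = 0 -> \sum_(a <- K) lam a *: a = 0 ->
    forall a, a \in K -> lam a = 0.

Definition conforming (T1 T2 : mesh) : Prop :=
  forall K L, K \in T1 -> L \in T2 -> hull K `&` hull L = hull (K `&` L)%fset.

Definition triangulation (Om : set pt) (T : mesh) : Prop :=
  [/\ forall K, K \in T -> #|` K| = d.+1 /\ affinely_independent K,
      conforming T T &
      closure Om = \bigcup_(K in [set` T]) hull K].

Definition diameter (K : simplex) : R :=
  sup [set l | exists x y, [/\ hull K x, hull K y & l = enorm (x - y)]].

(* Largest diameter of a ball contained in K. *)
Definition indiameter (K : simplex) : R :=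
  sup [set l | exists c r, [/\ 0 <= r,
                 [set y | enorm (y - c) <= r] `<=` hull K & l = 2 * r]].

(* A shape-regular family of pairs of triangulations of Os and Od matching at
   the interface, i.e. whose union is again a conforming simplicial mesh. *)
Definition shape_regular_family (Os Od : set pt) (M : set (mesh * mesh)) :
    Prop :=
  (forall Ts Td, M (Ts, Td) ->
     [/\ triangulation Os Ts, triangulation Od Td & conforming Ts Td]) /\
  exists2 theta : R, 0 < theta &
    forall Ts Td, M (Ts, Td) ->
    forall K, K \in (Ts `|` Td)%fset -> diameter K <= theta * indiameter K.

Definition is_facet (T : mesh) (F : simplex) : Prop :=
  exists K a, [/\ K \in T, a \in K & F = (K `\ a)%fset].

(* Outward unit normal of the simplex K on its facet opposite to the vertex a. *)
Definition normal (K : simplex) (a : pt) : pt :=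
  get [set n | [/\ dot n n = 1,
    forall x y, x \in (K `\ a)%fset -> y \in (K `\ a)%fset ->
      dot n (x - y) = 0 &
    forall x, x \in (K `\ a)%fset -> dot n (a - x) < 0]].

Definition ref_simplex (m : nat) : set 'rV[R]_m :=
  [set t | (forall i, 0 <= t 0 i) /\ \sum_i t 0 i <= 1].

(* Surface integral over hull F by the affine chart t |-> x_0 + t *m E of the
   reference simplex, where x_0, .., x_m are the vertices of F and the rows of
   E are x_i - x_0; the surface element is the square root of the Gram
   determinant. The value does not depend on the enumeration of F. *)
Definition surf_int (F : simplex) (g : pt -> R) : R :=
  let s := enum_fset F in
  let m := (size s).-1 in
  let E : 'M[R]_(m, d) := \matrix_(i < m) (s`_i.+1 - s`_0) in
  Num.sqrt (\det (E *m E^T)) *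
  vol_int (@ref_simplex m) (fun t => g (s`_0 + t *m E)).

Definition elem_int (T : mesh) (g : simplex -> pt -> R) : R :=
  \sum_(K <- T) vol_int (hull K) (g K).

(* <1, g>_{dT}: the integrand is g K F n x, with n the outward unit normal of K
   on its facet F and x in F. *)
Definition bdry_int (T : mesh) (g : simplex -> simplex -> pt -> pt -> R) : R :=
  \sum_(K <- T) \sum_(a <- K)
    surf_int (K `\ a)%fset (g K (K `\ a)%fset (normal K a)).

(* <1, g>_Gam for a subset Gam of the boundary of the domain meshed by T that is
   a union of facets. Such a facet belongs to a single element, whose outward
   normal n is that of the domain; the integrand is g F n x. *)
Definition part_int (Gam : set pt) (T : mesh) (g : simplex -> pt -> pt -> R) :
    R :=
  \sum_(K <- T) \sum_(a <- K | `[< hull (K `\ a)%fset `<=` Gam >])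
    surf_int (K `\ a)%fset (g (K `\ a)%fset (normal K a)).

End meshes.

Section spaces.
Context {R : realType} {d : nat}.
Local Notation pt := 'rV[R]_d.
Local Notation simplex := (@simplex R d).
Local Notation mesh := (@mesh R d).

(* A piecewise polynomial in L^2 is the family of its restrictions: w K is a
   polynomial on R^d whose restriction to hull K is w|_K, for K an element or a
   facet. Only these restrictions matter, see eq_on below. *)
Definition vfield := simplex -> pt -> pt.
Definition sfield := simplex -> pt -> R.

Definition poly_vec (k : nat) (v : pt -> pt) : Prop :=
  forall i, Pk k (fun x => v x 0 i).

Definition Vh (k : nat) (T : mesh) : set vfield :=
  [set v | forall K, K \in T -> poly_vec k (v K)].

Definition Qh (k : nat) (T : mesh) : set sfield :=
  [set q | (forall K, K \in T -> Pk k.-1 (q K)) /\ elem_int T q = 0].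

Definition Vbarh (k : nat) (T : mesh) (Gam : set pt) : set vfield :=
  [set vb | (forall F, is_facet T F -> poly_vec k (vb F)) /\
            (forall F, is_facet T F -> hull F `<=` Gam ->
               forall x, hull F x -> vb F x = 0)].

Definition Qbarh (k : nat) (T : mesh) : set sfield :=
  [set qb | forall F, is_facet T F -> Pk k (qb F)].

(* (v_h, \bar v_h, v_h^m) *)
Record velocity := Velocity {
  vel : vfield; vel_bar : vfield; vel_m : vfield }.

(* (q_h, \bar q_h^s, \bar q_h^d, q_h^m, \bar q_h^m) *)
Record pressure := Pressure {
  prs : sfield; prs_bars : sfield; prs_bard : sfield;
  prs_m : sfield; prs_barm : sfield }.

Definition Zh (k : nat) (Ts Td : mesh) (GamS : set pt) : set velocity :=
  [set v | [/\ Vh k (Ts `|` Td)%fset (vel v), Vbarh k Ts GamS (vel_bar v) &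
               Vh k Td (vel_m v)]].

Definition Ph (k : nat) (Ts Td : mesh) : set pressure :=
  [set q | [/\ Qh k (Ts `|` Td)%fset (prs q), Qbarh k Ts (prs_bars q),
               Qbarh k Td (prs_bard q), Qh k Td (prs_m q) &
               Qbarh k Td (prs_barm q)]].

Definition eq_on {V : Type} (S : simplex -> Prop) (w w' : simplex -> pt -> V) :
    Prop :=
  forall K, S K -> forall x, hull K x -> w K x = w' K x.

Definition same_velocity (Ts Td : mesh) (v w : velocity) : Prop :=
  [/\ eq_on [set` (Ts `|` Td)%fset] (vel v) (vel w),
      eq_on (is_facet Ts) (vel_bar v) (vel_bar w) &
      eq_on [set` Td] (vel_m v) (vel_m w)].

Definition same_pressure (Ts Td : mesh) (p q : pressure) : Prop :=
  [/\ eq_on [set` (Ts `|` Td)%fset] (prs p) (prs q),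
      eq_on (is_facet Ts) (prs_bars p) (prs_bars q),
      eq_on (is_facet Td) (prs_bard p) (prs_bard q),
      eq_on [set` Td] (prs_m p) (prs_m q) &
      eq_on (is_facet Td) (prs_barm p) (prs_barm q)].

End spaces.
Arguments velocity : clear implicits.
Arguments pressure : clear implicits.

Section forms.
Context {R : realType} {d : nat}.
Local Notation pt := 'rV[R]_d.
Variables (Ts Td : @mesh R d) (GamI : set pt).
Variables (mu kappa_f kappa_m alpha sigma beta : R).

Definition ah_s (u v : velocity R d) : R :=
  elem_int Ts (fun K x =>
    2 * mu * ddot (symgrad (vel u K) x) (symgrad (vel v K) x))
  - bdry_int Ts (fun K F n x =>
      2 * mu * dot (n *m (symgrad (vel u K) x)^T) (vel v K x - vel_bar v F x))
  - bdry_int Ts (fun K F n x =>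
      2 * mu * dot (n *m (symgrad (vel v K) x)^T) (vel u K x - vel_bar u F x))
  + bdry_int Ts (fun K F n x =>
      2 * beta * mu * (diameter K)^-1 *
      dot (vel u K x - vel_bar u F x) (vel v K x - vel_bar v F x)).

Definition ah (u v : velocity R d) : R :=
  ah_s u v
  + elem_int Td (fun K x => kappa_f^-1 * dot (vel u K x) (vel v K x))
  + elem_int Td (fun K x => kappa_m^-1 * dot (vel_m u K x) (vel_m v K x))
  + part_int GamI Ts (fun F n x =>
      alpha * mu * (Num.sqrt kappa_f)^-1 *
      dot (tangential n (vel_bar u F x)) (tangential n (vel_bar v F x))).

(* Contribution of the subdomain meshed by T; in the term on GamI, n is the
   outward normal n^j of that subdomain. *)
Definition bh_sub (T : @mesh R d) (p pb : @sfield R d) (v vb : @vfield R d) : R :=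
  - elem_int T (fun K x => p K x * divv (v K) x)
  + bdry_int T (fun K F n x => pb F x * dot (v K x) n)
  - part_int GamI T (fun F n x => pb F x * dot (vb F x) n).

Definition bh (p : pressure R d) (v : velocity R d) : R :=
  bh_sub Ts (prs p) (prs_bars p) (vel v) (vel_bar v)
  + bh_sub Td (prs p) (prs_bard p) (vel v) (vel_bar v)
  - elem_int Td (fun K x => prs_m p K x * divv (vel_m v K) x)
  + bdry_int Td (fun K F n x => prs_barm p F x * dot (vel_m v K x) n).

Definition ch (p q : pressure R d) : R :=
  elem_int Td (fun K x =>
    sigma * kappa_m * ((prs_m p K x - prs p K x) * (prs_m q K x - prs q K x))).

End forms.

Section method.
Context {R : realType} {d : nat}.
Local Notation pt := 'rV[R]_d.

(* The data are only given on Os and Od, hence the restriction of each element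
   (which is closed) to the subdomain; this removes a null set. *)
Definition hdg_solution (k : nat) (Om Os Od : set pt) (Ts Td : @mesh R d)
    (mu kappa_f kappa_m alpha sigma beta : R) (f : pt -> pt) (g : pt -> R)
    (u : velocity R d) (p : pressure R d) : Prop :=
  let GamI := interface Os Od in
  let Z := Zh k Ts Td (outer_boundary Os Om) in
  let P := Ph k Ts Td in
  let a := ah Ts Td GamI mu kappa_f kappa_m alpha beta in
  let b := bh Ts Td GamI in
  let c := ch Td kappa_m sigma in
  [/\ Z u, P p,
      forall v, Z v -> a u v + b p v =
        \sum_(K <- Ts) vol_int (Os `&` hull K) (fun x => dot (f x) (vel v K x)) &
      forall q, P q -> b q u - c p q =
        - \sum_(K <- Td) vol_int (Od `&` hull K) (fun x => g x * prs q K x)].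

End method.

(* Main.v *)
(* The system is square and symmetric once each equation is tested with the
   fields of the other unknown: with B(w, z) = a(u, v) + b(p, v) + b(q, u) -
   c(p, q), existence follows from uniqueness by linear algebra on the finite
   dimensional space Z_h x P_h modulo fields vanishing on the mesh.

   For uniqueness, the homogeneous solution satisfies a(u, u) + c(p, p) = 0.
   A discrete trace inequality on each simplex, obtained on the reference
   simplex from the comparison of two semi-definite forms in finite dimension,
   absorbs the consistency terms of a_h^s when beta is large, whence
   eps(u) = 0 and u = \bar u on the facets of T^s, u = u^m = 0 on T^d,
   p = p^m on T^d, and \bar u^t = 0 on the interface. The mesh of Omega^s has a
   boundary facet, where \bar u = 0: by definition on Gamma^s, and on Gamma^I
   because \bar p^d tests the normal component. A rigid motion vanishing on a
   facet is zero, and a segment avoiding all faces of codimension 2 joins any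
   two elements through facets, so u = 0.

   For the pressures, if t = b - a is an edge of a simplex K, only the facets
   opposite to a and b see the field w = g t in the divergence theorem; taking g
   = lam_a lam_b (D_t p) gives D_t p = 0, and taking g = lam_b r then identifies
   \bar p with p on the facets. Hence each pressure is a constant on each
   subdomain, and the mean value conditions together with p = p^m make it 0. *)
Require Import Defs.
From HB Require Import structures.
From mathcomp Require Import all_boot all_order all_algebra finmap.
From mathcomp Require Import all_classical all_reals all_analysis.
From mathcomp Require Import measurable_realfun.
From mathcomp Require Import ring lra.
Set Implicit Arguments.
Unset Strict Implicit.
Unset Printing Implicit Defensive.
Import Order.TTheory GRing.Theory Num.Theory.
Import numFieldNormedType.Exports.
Local Open Scope classical_set_scope.
Local Open Scope ring_scope.

(** * Lebesgue measure and affine maps *)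

Section tuple_integral.
Context {R : realType}.
Local Notation leb := (@lebesgue_measure R).

(** Integrals must be compared on arbitrary simplices, whereas the measure is an iterated product on
    tuples. The linear substitution rule is therefore proved by block factorisation, and integrals
    are pulled back to the reference simplex, where Fubini and the one-dimensional fundamental
    theorem give the divergence theorem.

    The threshold is uniform in the mesh because the trace inequality is scaled by the height of the
    simplex over the facet: the Jacobian of an element is this height times the surface element of
    the facet, so one constant C serves all simplices. Shape regularity enters through diameter <=
    theta * indiameter <= theta * height, and mu is a common factor of all terms of a_h^s; the
    result is 2 (n + 2) theta C in dimension n + 1.

    A field is a family of functions on the whole space of which only the values on the mesh matter,
    so Z_h x P_h is represented inside an infinite-dimensional module with many null vectors. Finite
    dimension is expressed by finitely many linear functionals that detect the null fields. *)

Definition mrv n d (T : measurableType d) (f : 'rV[R]_n -> T) :=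
  measurable_fun [set: n.-tuple (measurableTypeR R)] (f \o rv_of_tuple).

(** Taken in the extended reals, so that Tonelli and the substitution rule apply to nonnegative
    functions without integrability conditions. *)
Definition eint n (f : 'rV[R]_n -> \bar R) : \bar R :=
  (\int[lebesgue_tuple R n]_t f (rv_of_tuple t))%E.

Definition rvcons n (h : R) (y : 'rV[R]_n) : 'rV[R]_n.+1 :=
  row_mx (h%:M : 'rV_1) y.

Lemma rvcons0 n h (y : 'rV[R]_n) : rvcons h y 0 ord0 = h.
Proof.
rewrite /rvcons (_ : ord0 = lshift n (0 : 'I_1)); last exact: val_inj.
by apply: etrans (row_mxEl _ _ _ _) _; rewrite !mxE.
Qed.

Lemma rvconsS n h (y : 'rV[R]_n) i : rvcons h y 0 (lift ord0 i) = y 0 i.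
Proof.
rewrite /rvcons (_ : lift ord0 i = rshift 1 i); last exact: val_inj.
exact: row_mxEr.
Qed.

Lemma rv_of_tuple_cons n (h : R) (t : n.-tuple (measurableTypeR R)) :
  rv_of_tuple [the n.+1.-tuple (measurableTypeR R) of h :: t]
  = rvcons h (rv_of_tuple t).
Proof.
apply/rowP => i; rewrite mxE; case: (unliftP ord0 i) => [j|] ->.
  by rewrite rvconsS tnthS mxE.
by rewrite rvcons0.
Qed.

Lemma mrv_coord n (i : 'I_n) :
  mrv (fun x : 'rV[R]_n => x 0 i : measurableTypeR R).
Proof.
rewrite /mrv (_ : _ \o _ = (@tnth _ _ ^~ i)); first exact: measurable_tnth.
by apply/funext => t /=; rewrite mxE.
Qed.

(** A map into row vectors factors through [rv_of_tuple] by the tuple of its coordinates, so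
    coordinatewise measurability is enough. *)
Lemma measurable_comp_rv d (T : measurableType d) n d' (T' : measurableType d')
    (g : T' -> 'rV[R]_n) (f : 'rV[R]_n -> T) :
  (forall i, measurable_fun setT (fun x => g x 0 i : measurableTypeR R)) ->
  mrv f -> measurable_fun setT (f \o g).
Proof.
move=> mg mf.
pose G x : n.-tuple (measurableTypeR R) := [tuple g x 0 i | i < n].
have -> : f \o g = (f \o rv_of_tuple) \o G.
  apply/funext => x /=; congr f; apply/rowP => i.
  by rewrite !mxE tnth_mktuple.
apply: (@measurableT_comp _ _ _ _ _ _ (f \o rv_of_tuple)) => //.
apply/measurable_fun_tnthP => i.
rewrite (_ : _ \o _ = fun x => g x 0 i); first exact: mg.
by apply/funext => x /=; rewrite tnth_mktuple.
Qed.

Lemma mrv_comp d (T : measurableType d) m n (g : 'rV[R]_m -> 'rV[R]_n)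
    (f : 'rV[R]_n -> T) :
  (forall i, mrv (fun x => g x 0 i : measurableTypeR R)) ->
  mrv f -> mrv (f \o g).
Proof. by move=> mg mf; exact: (measurable_comp_rv (g := g \o rv_of_tuple)). Qed.

Lemma mrv_affine n m (A : 'M[R]_(n, m)) (b : 'rV[R]_m) i :
  mrv (fun x => (x *m A + b) 0 i : measurableTypeR R).
Proof.
rewrite /mrv (_ : _ \o _ = fun t => \sum_j rv_of_tuple t 0 j * A j i + b 0 i);
  last by apply/funext => t /=; rewrite !mxE.
apply: measurable_funD => //; apply: measurable_sum => j.
by apply: measurable_funM => //; exact: mrv_coord.
Qed.

Lemma mrv_comp_affine d (T : measurableType d) m n (A : 'M[R]_(m, n)) b
    (f : 'rV[R]_n -> T) : mrv f -> mrv (fun x => f (x *m A + b)).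
Proof.
by move=> mf; apply: (mrv_comp (g := fun x => x *m A + b)) => // i;
  exact: mrv_affine.
Qed.

Section step.
Variables (n : nat) (f : 'rV[R]_n.+1 -> \bar R).
Hypotheses (mf : mrv f) (f0 : forall x, (0 <= f x)%E).

Let measurable_rvcons :
  measurable_fun [set: R * n.-tuple (measurableTypeR R)]
    (fun p => f (rvcons p.1 (rv_of_tuple p.2))).
Proof.
apply: (measurable_comp_rv
  (g := fun p : measurableTypeR R * n.-tuple _ => rvcons p.1 (rv_of_tuple p.2)))
  => // i.
case: (unliftP ord0 i) => [j|] ->.
  rewrite (_ : (fun _ => _) = (@tnth _ _ ^~ j) \o snd); last first.
    by apply/funext => p /=; rewrite rvconsS mxE.
  by apply: measurableT_comp => //; exact: measurable_tnth.
by rewrite (_ : (fun _ => _) = fst)//; apply/funext => p /=; rewrite rvcons0.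
Qed.

Let eint_prod : eint f =
  (\int[leb \x lebesgue_tuple R n]_p f (rvcons p.1 (rv_of_tuple p.2)))%E.
Proof.
rewrite /eint /= ge0_integral_pushforward//=.
- by rewrite preimage_setT; apply: eq_integral => p _ /=; rewrite rv_of_tuple_cons.
- exact: measurable_cons measurable_fst measurable_snd.
Qed.

(** Tonelli with the first coordinate as outer variable; [eintS2] has it as inner variable. The
    substitution rule uses both orders. *)
Lemma eintS1 : eint f = (\int[leb]_h eint (fun y => f (rvcons h y)))%E.
Proof. by rewrite eint_prod fubini_tonelli1. Qed.

Lemma eintS2 : eint f = eint (fun y => \int[leb]_h f (rvcons h y))%E.
Proof. by rewrite eint_prod fubini_tonelli2. Qed.

Lemma mrv_slice h : mrv (fun y => f (rvcons h y)).
Proof.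
apply: (mrv_comp (g := fun y => rvcons h y)) => // i.
case: (unliftP ord0 i) => [j|] ->.
  under eq_fun do rewrite rvconsS; exact: mrv_coord.
by under eq_fun do rewrite rvcons0; exact: measurable_cst.
Qed.

Lemma mrv_slice_int : mrv (fun y => \int[leb]_h f (rvcons h y))%E.
Proof.
have := @measurable_fun_fubini_tonelli_G _ _ _ _ _ leb
  (fun p : measurableTypeR R * n.-tuple (measurableTypeR R) =>
    f (rvcons p.1 (rv_of_tuple p.2))) measurable_rvcons.
by apply => p.
Qed.

Lemma measurable_slice y : measurable_fun setT (fun h : measurableTypeR R =>
  f (rvcons h y)).
Proof.
apply: (measurable_comp_rv (g := fun h : measurableTypeR R => rvcons h y)) => // i.
case: (unliftP ord0 i) => [j|] ->.
  by under eq_fun do rewrite rvconsS; exact: measurable_cst.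
by under eq_fun do rewrite rvcons0; exact: measurable_id.
Qed.

End step.

(** By uniqueness of Lebesgue measure, it is [|c|] times its image under x -> c x + b, since the two
    agree on half-open intervals. *)
Lemma lebesgue_affine (c b : R) (f : R -> \bar R) : c != 0 ->
  measurable_fun [set: measurableTypeR R] f -> (forall x, 0 <= f x)%E ->
  (\int[leb]_x f x = `|c|%:E * \int[leb]_x f (c * x + b)%R)%E.
Proof.
move=> c0 mf f0.
pose phi x : measurableTypeR R := c * x + b.
have mphi : measurable_fun [set: measurableTypeR R] phi.
  by apply: measurable_funD => //; apply: measurable_funM.
pose nu : {measure set (measurableTypeR R) -> \bar R} :=
  measure_function_pushforward__canonical__measure_function_Measure leb mphi.
pose nc : {nonneg R} := NngNum (normr_ge0 c).
transitivity (\int[mscale nc nu]_x f x)%E; last first.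
  rewrite ge0_integral_mscale//; congr (_ * _)%E.
  by rewrite ge0_integral_pushforward// preimage_setT.
apply: eq_measure_integral => A mA _; apply: lebesgue_measure_unique => //.
move=> _ [[x y] _ <-] /=.
rewrite /mscale /nu /= /pushforward lebesgue_measure_itv /=.
have [cp|cn] := ltP 0 c.
  rewrite (_ : phi @^-1` `]x, y]%classic = `](x - b) / c, (y - b) / c]%classic); last first.
    apply/seteqP; split => z /=; rewrite !in_itv /=
      ltr_pdivrMr// ler_pdivlMr// ltrBlDr lerBrDr (mulrC z) => //.
  rewrite lebesgue_measure_itv /= !lte_fin ltr_pM2r ?invr_gt0// ltrD2r.
  case: ifP => _; last by rewrite mule0.
  rewrite gtr0_norm// -!EFinB -EFinM; congr EFin; field; exact: c0.
have {}cn : c < 0 by rewrite lt_neqAle c0.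
(* A negative [c] reverses the order, so the preimage is closed on the left and open on the right,
   which does not affect its length. *)
rewrite (_ : phi @^-1` `]x, y]%classic = `[(y - b) / c, (x - b) / c[%classic); last first.
  apply/seteqP; split => z /=; rewrite !in_itv /=
    ltr_ndivlMr// ler_ndivrMr// ltrBlDr lerBrDr (mulrC z) andbC => //.
rewrite lebesgue_measure_itv /= !lte_fin ltr_nM2r ?invr_lt0// ltrD2r.
case: ifP => _; last by rewrite mule0.
rewrite ltr0_norm// -!EFinB -EFinM; congr EFin; field; exact: c0.
Qed.

End tuple_integral.

(** * Linear substitution in R^n *)

Section linear_change_of_variables.
Context {R : realType}.
Local Notation leb := (@lebesgue_measure R).

Definition change_of_variables n (B : 'M[R]_n) (b : 'rV[R]_n) :=
  forall f : 'rV[R]_n -> \bar R, mrv f -> (forall x, 0 <= f x)%E ->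
    (eint f = `|\det B|%:E * eint (fun x => f (x *m B + b)%R))%E.

Lemma change_of_variables_comp n (B C : 'M[R]_n) (b c : 'rV[R]_n) :
  change_of_variables B b -> change_of_variables C c ->
  change_of_variables (B *m C) (b *m C + c).
Proof.
move=> hB hC f mf f0; rewrite hC// hB//; last exact: mrv_comp_affine.
rewrite muleA -EFinM -normrM mulrC -det_mulmx; congr (_ * eint _)%E.
by apply/funext => x; rewrite mulmxDl mulmxA addrA.
Qed.

Lemma change_of_variables_comp0 n (B C : 'M[R]_n) :
  change_of_variables B 0 -> change_of_variables C 0 ->
  change_of_variables (B *m C) 0.
Proof.
move=> hB hC; have := change_of_variables_comp hB hC.
by rewrite mul0mx addr0.
Qed.

Lemma eint_scale n (c : R) (f : 'rV[R]_n -> \bar R) : 0 <= c -> mrv f ->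
  (forall x, 0 <= f x)%E -> (eint (fun x => c%:E * f x) = c%:E * eint f)%E.
Proof. by move=> c0 mf f0; rewrite /eint ge0_integralZl. Qed.

Lemma rvcons_block n (c : R) (r : 'cV[R]_n) (u : 'rV[R]_n) (D : 'M[R]_n)
    (h : R) (y : 'rV[R]_n) :
  rvcons h y *m (block_mx c%:M u r D : 'M[R]_n.+1) =
  rvcons (c * h + (y *m r) 0 0) (h *: u + y *m D).
Proof.
rewrite /rvcons; rewrite -[LHS]/(row_mx (h%:M : 'M[R]_1) y *m block_mx c%:M u r D) mul_row_block.
rewrite !mul_scalar_mx; apply: (f_equal2 (@row_mx R 1 1 n)) => //.
by apply/rowP => i; rewrite !ord1 !mxE /= !mulr1n mulrC.
Qed.

Lemma rvconsD n (h k : R) (x y : 'rV[R]_n) :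
  rvcons h x + rvcons k y = rvcons (h + k) (x + y).
Proof.
apply: etrans (@add_row_mx R 1 1 n _ _ _ _) _.
by apply: (f_equal2 (@row_mx R 1 1 n)) => //; rewrite -raddfD.
Qed.

Lemma rvcons_eta n (x : 'rV[R]_n.+1) : exists h y, x = rvcons h y.
Proof.
exists (x 0 ord0), (rsubmx (x : 'rV[R]_(1 + n))); apply/rowP => i.
case: (unliftP ord0 i) => [j|] ->; last by rewrite rvcons0.
by rewrite rvconsS mxE; congr (x _ _); exact: val_inj.
Qed.

Lemma det_block_lower n (c : R) (r : 'cV[R]_n) (D : 'M[R]_n) :
  \det (block_mx c%:M 0 r D : 'M[R]_n.+1) = c * \det D.
Proof. by apply: etrans (@det_lblock _ 1 n _ _ _) _; rewrite det_scalar1. Qed.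

Lemma det_block_upper n (c : R) (u : 'rV[R]_n) (D : 'M[R]_n) :
  \det (block_mx c%:M u 0 D : 'M[R]_n.+1) = c * \det D.
Proof. by apply: etrans (@det_ublock _ 1 n _ _ _) _; rewrite det_scalar1. Qed.

Section step.
Variable n : nat.
Hypothesis IH : forall (B : 'M[R]_n) b, B \in unitmx -> change_of_variables B b.

(** With row vectors, the tail of the image does not involve the head h. So integrate over h first,
    where the map is affine of slope [c], and apply the induction hypothesis to the tail. *)
Let lower (c : R) (r : 'cV[R]_n) (D : 'M[R]_n) (b : 'rV[R]_n.+1) :
  c != 0 -> D \in unitmx ->
  change_of_variables (block_mx c%:M 0 r D : 'M[R]_n.+1) b.
Proof.
move=> c0 Du f mf f0; have [b0 [b' ->]] := rvcons_eta b.
rewrite (@eintS2 _ _ f)// (IH b' Du); [|exact: mrv_slice_int|]; last first.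
  by move=> y; exact: integral_ge0.
rewrite det_block_lower normrM mulrC EFinM -muleA; congr (_ * _)%E.
rewrite [in RHS]eintS2//; last exact: mrv_comp_affine.
rewrite -eint_scale//; last 2 first.
- apply: (@mrv_slice_int _ _ (fun x =>
    f (x *m (block_mx c%:M 0 r D : 'M[R]_n.+1) + rvcons b0 b'))) => //.
  exact: mrv_comp_affine.
- by move=> y; exact: integral_ge0.
congr eint; apply/funext => y.
rewrite (lebesgue_affine ((y *m r) 0 0 + b0) c0)//; last exact: measurable_slice.
congr (_ * _)%E; apply: eq_integral => h _.
by rewrite rvcons_block rvconsD scaler0 add0r addrA.
Qed.

(** For a fixed head h this is the translation of the tail by h u, which the induction hypothesis
    covers. *)
Let upper (u : 'rV[R]_n) :
  change_of_variables (block_mx 1%:M u 0 1%:M : 'M[R]_n.+1) 0.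
Proof.
move=> f mf f0.
rewrite det_block_upper det1 mul1r normr1 mul1e eintS1//.
rewrite [in RHS]eintS1//; last exact: mrv_comp_affine.
apply: eq_integral => h _.
rewrite (IH (h *: u) (unitmx1 _ _))//; last exact: mrv_slice.
rewrite det1 normr1 mul1e; congr eint; apply/funext => y.
by rewrite addr0 rvcons_block mulmx0 mxE addr0 mul1r !mulmx1 addrC.
Qed.

(** A nonzero pivot [B 0 0] gives a block LU factorisation of [B]; a zero pivot is repaired by
    adding another column to the first one. *)
Lemma change_of_variablesS (B : 'M[R]_n.+1) b :
  B \in unitmx -> change_of_variables B b.
Proof.
have trans b' : change_of_variables (1%:M : 'M[R]_n.+1) b'.
  by rewrite (scalar_mx_block 1 n); apply: lower; rewrite ?oner_eq0 ?unitmx1.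
have shift (C : 'M[R]_n.+1) : change_of_variables C 0 -> change_of_variables C b.
  move=> hC; rewrite -[C]mulmx1 -[b]add0r -(mul0mx 1 1%:M).
  exact: change_of_variables_comp.
move=> Bu; apply: shift.
have unit00 (C : 'M[R]_n.+1) : C \in unitmx -> C 0 0 != 0 ->
    change_of_variables C 0.
  move=> Cu C00; set c := C 0 0 in C00.
  pose C' : 'M[R]_(1 + n) := C.
  have ulE : ulsubmx C' = c%:M.
    apply/matrixP => i j; rewrite !ord1 !mxE /= mulr1n /c /C'.
    by congr (C _ _); apply: val_inj.
  (* Schur complement of the pivot. *)
  pose E := drsubmx C' - dlsubmx C' *m (c^-1 *: ursubmx C').
  have CE : C' = block_mx c%:M 0 (dlsubmx C') E *m
                 block_mx 1%:M (c^-1 *: ursubmx C') 0 1%:M.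
    rewrite mulmx_block !mulmx1 !mulmx0 !addr0 mul_scalar_mx scalerA.
    by rewrite divff// scale1r /E addrC subrK -ulE submxK.
  have Eu : E \in unitmx.
    move: Cu; rewrite -[C]/C' CE unitmx_mul => /andP[+ _].
    rewrite !unitmxE det_block_lower unitrM => /andP[_].
    by [].
  rewrite -[C]/C' CE.
  by apply: change_of_variables_comp0; [exact: lower|exact: upper].
have [B00|B00] := eqVneq (B 0 0) 0; last exact: unit00.
pose B' : 'M[R]_(1 + n) := B.
have ulE : ulsubmx B' = 0.
  apply/matrixP => i j; rewrite !ord1 !mxE /= -[RHS]B00 /B'.
  by congr (B _ _); apply: val_inj.
pose u := ursubmx B'.
have u0 : u != 0.
  apply/eqP => u0; move: Bu; rewrite unitmxE -[B]/B' -[B']submxK ulE -/u u0.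
  have -> : (0 : 'M[R]_1) = 0%:M by rewrite raddf0.
  by rewrite det_block_lower mul0r unitr0.
have [j uj] : exists j, u 0 j != 0.
  apply/existsP; apply: contraNT u0; rewrite negb_exists => /forallP u0.
  apply/eqP/matrixP => i j; rewrite ord1 [in RHS]mxE; apply/eqP.
  by have := u0 j; rewrite negbK.
(* Right multiplication by [S r] adds column j + 1 to column 0, which makes the pivot equal to
   [u 0 j]; [S (- r)] undoes it. *)
pose r : 'cV[R]_n := delta_mx j 0.
pose S (s : 'cV[R]_n) : 'M[R]_n.+1 := block_mx 1%:M 0 s 1%:M.
have Su s : S s \in unitmx by rewrite unitmxE /S det_block_lower det1 mulr1 unitr1.
have -> : B = B *m S r *m S (- r).
  rewrite -mulmxA [X in B *m X](_ : _ = 1%:M) ?mulmx1//.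
  apply: etrans (@mulmx_block R 1 n 1 n 1 n _ _ _ _ _ _ _ _) _.
  rewrite !mulmx1 !mulmx0 ?mul1mx ?mul0mx ?addr0 ?add0r subrr.
  by rewrite -(scalar_mx_block 1 n).
apply: change_of_variables_comp0; last first.
  by apply: lower; rewrite ?oner_eq0 ?unitmx1.
apply: unit00; first by rewrite unitmx_mul Bu Su.
suff -> : (B *m S r) 0 0 = u 0 j by [].
transitivity ((B' *m (S r : 'M[R]_(1 + n)))
    (lshift n (0 : 'I_1)) (lshift n (0 : 'I_1))).
  by congr (fun_of_matrix _ _ _); exact: val_inj.
rewrite -[B']submxK ulE -/u /S mulmx_block ?mul0mx ?mulmx0 ?mulmx1 ?add0r.
by rewrite block_mxEul /r -colE mxE.
Qed.

End step.

Theorem linear_change_of_variables n (B : 'M[R]_n) b :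
  B \in unitmx -> change_of_variables B b.
Proof.
elim: n B b => [|n IH] B b Bu; last exact: change_of_variablesS.
move=> f mf f0; rewrite det_mx00 normr1 mul1e; congr eint; apply/funext => x.
by congr f; rewrite [LHS]thinmx0 [RHS]thinmx0.
Qed.

End linear_change_of_variables.

(** * Volume integrals under affine maps *)

Section volume.
Context {R : realType}.

Definition rv_measurable n (A : set 'rV[R]_n) :=
  measurable (rv_of_tuple @^-1` A : set (n.-tuple (measurableTypeR R))).

Lemma mrv_preimage n d (T : measurableType d) (f : 'rV[R]_n -> T) (Y : set T) :
  mrv f -> measurable Y -> rv_measurable (f @^-1` Y).
Proof. by move=> mf mY; rewrite /rv_measurable -[X in measurable X]setTI; exact: mf. Qed.

Lemma patch_rv n T (f : 'rV[R]_n -> T) (A : set 'rV[R]_n) (d : T) :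
  patch (fun=> d) (rv_of_tuple @^-1` A) (f \o rv_of_tuple) =
  patch (fun=> d) A f \o rv_of_tuple.
Proof.
apply/funext => t; rewrite /patch /=.
by congr (if _ then _ else _); apply/idP/idP; rewrite !in_setE.
Qed.

Lemma vol_int_eint n (A : set 'rV[R]_n) f :
  let g := ((EFin \o f) \_ A)%E in
  vol_int A f = fine (eint g^\+ - eint g^\-)%E.
Proof.
move=> g; rewrite /vol_int /Rintegral integral_mkcond.
rewrite (patch_rv (EFin \o f)) -/g integralE /eint.
by congr (fine (_ - _)%E); apply: eq_integral => t _; rewrite ?funeposE ?funenegE.
Qed.

(** True also for infinite x or y, so [vol_int_affine] can treat positive and negative parts without
    assuming integrability. *)
Lemma gt0_muleB (c : R) (x y : \bar R) :
  0 < c -> (c%:E * x - c%:E * y = c%:E * (x - y))%E.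
Proof.
move=> c0; case: x y => [x||] [y||];
  rewrite ?gt0_muley ?gt0_muleNy ?lte_fin//= -?EFinM ?gt0_muley ?gt0_muleNy ?lte_fin//.
by rewrite -EFinB -mulrBr.
Qed.

Lemma measurable_patch n (f : 'rV[R]_n -> R) (A : set 'rV[R]_n) :
  rv_measurable A -> mrv (f : 'rV[R]_n -> measurableTypeR R) ->
  mrv ((EFin \o f) \_ A)%E.
Proof.
move=> mA mf; rewrite /mrv -patch_rv; apply/(measurable_restrictT _ _).1 => //.
exact/measurable_funTS/measurable_EFinP.
Qed.

Lemma vol_int_affine n (B : 'M[R]_n) b (A : set 'rV[R]_n) (f : 'rV[R]_n -> R) :
  B \in unitmx -> rv_measurable A -> mrv (f : 'rV[R]_n -> measurableTypeR R) ->
  vol_int A f = `|\det B| *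
    vol_int [set x | A (x *m B + b)] (fun x => f (x *m B + b)).
Proof.
move=> Bu mA mf; rewrite !vol_int_eint.
set g := ((EFin \o f) \_ A)%E.
set g' := ((EFin \o (fun x => f (x *m B + b)%R)) \_ [set x | A (x *m B + b)%R])%E.
have gE : g' = (fun x => g (x *m B + b)).
  apply/funext => x; rewrite /g /g' /patch /=.
  by congr (if _ then _ else _); apply/idP/idP; rewrite !in_setE.
have mg : mrv g by exact: measurable_patch.
have dB : 0 < `|\det B| by rewrite normr_gt0 -unitfE -unitmxE.
rewrite (linear_change_of_variables b Bu (f := g^\+%E)); last 2 first.
- rewrite /mrv (_ : _ \o _ = (g \o rv_of_tuple)^\+%E); first exact: measurable_funepos.
  by apply/funext => t; rewrite /= !funeposE.
- by move=> x; exact: funepos_ge0.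
rewrite (linear_change_of_variables b Bu (f := g^\-%E)); last 2 first.
- rewrite /mrv (_ : _ \o _ = (g \o rv_of_tuple)^\-%E); first exact: measurable_funeneg.
  by apply/funext => t; rewrite /= !funenegE.
- by move=> x; exact: funeneg_ge0.
rewrite gt0_muleB//.
have -> : (fun x => g^\+%E (x *m B + b)) = g'^\+%E.
  by rewrite gE; apply/funext => x; rewrite !funeposE.
have -> : (fun x => g^\-%E (x *m B + b)) = g'^\-%E.
  by rewrite gE; apply/funext => x; rewrite !funenegE.
(* In the two infinite cases [fine] returns 0 on both sides. *)
case: (_ - _)%E => [r||]; first by rewrite -EFinM.
- by rewrite gt0_muley//= mulr0.
- by rewrite gt0_muleNy//= mulr0.
Qed.

Definition box n (c : 'rV[R]_n) (r : R) : set 'rV[R]_n :=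
  [set x | forall i, `|x 0 i - c 0 i| <= r].

Lemma box_rvcons n h (c : 'rV[R]_n) r (k : R) y :
  box (rvcons h c) r (rvcons k y) <-> `|k - h| <= r /\ box c r y.
Proof.
split=> [H|[H1 H2] i].
  split; first by have := H ord0; rewrite !rvcons0.
  by move=> i; have := H (lift ord0 i); rewrite !rvconsS.
by case: (unliftP ord0 i) => [j|] ->; rewrite ?rvcons0 ?rvconsS.
Qed.

Lemma rv_measurable_coord_itv n (i : 'I_n) (I : interval R) :
  rv_measurable [set x : 'rV[R]_n | x 0 i \in I].
Proof. exact: (mrv_preimage (mrv_coord i) (measurable_itv I)). Qed.

Lemma rv_measurable_bigcap n (I : finType) (F : I -> set 'rV[R]_n) :
  (forall i, rv_measurable (F i)) -> rv_measurable [set x | forall i, F i x].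
Proof.
move=> mF; rewrite /rv_measurable (_ : _ @^-1` _ =
  \bigcap_(i in [set: I]) (rv_of_tuple @^-1` F i)); last first.
  by apply/seteqP; split => [t H i _|t H i]; exact: H.
by apply: fin_bigcap_measurable => // i _; exact: mF.
Qed.

Lemma rv_measurable_box n (c : 'rV[R]_n) r : rv_measurable (box c r).
Proof.
apply: (@rv_measurable_bigcap _ _ (fun i => [set x | `|x 0 i - c 0 i| <= r])) => i.
rewrite (_ : [set _ | _] = [set x | x 0 i \in `[c 0 i - r, c 0 i + r]]).
  exact: rv_measurable_coord_itv.
by apply/seteqP; split => x /=; rewrite ler_distl in_itv.
Qed.

Lemma measure_box n (c : 'rV[R]_n) r : 0 <= r ->
  lebesgue_tuple R n (rv_of_tuple @^-1` box c r) = ((r *+ 2) ^+ n)%:E.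
Proof.
move=> r0; elim: n c => [|n IH] c.
  rewrite expr0 /= diracE mem_set//= => -[].
  by [].
have [h [c' ->]] := rvcons_eta c.
rewrite /= /tuple_measureS /pushforward.
set X := (X in (_ \x _)%E X).
have -> : X = [set x | `|x - h| <= r] `*` (rv_of_tuple @^-1` box c' r).
  apply/seteqP; split => -[k t] /=.
    by rewrite /X /= rv_of_tuple_cons => /box_rvcons.
  by rewrite /X /= rv_of_tuple_cons => ?; apply/box_rvcons.
have -> : [set x | `|x - h| <= r] = `[h - r, h + r]%classic.
  by apply/seteqP; split => x /=; rewrite ler_distl in_itv.
rewrite product_measure1E//; last exact: rv_measurable_box.
rewrite IH [X in (X * _)%E](lebesgue_measure_itv `[h - r, h + r]) /= lte_fin.
case: ifPn => hr.
  by rewrite -EFinB -EFinM exprS; congr (_ * _)%:E; rewrite mulr2n; ring.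
have -> : r = 0 by apply/eqP; rewrite eq_le r0 andbT; move: hr; rewrite -leNgt; lra.
by rewrite mul0e mul0rn exprS mul0r.
Qed.

End volume.

(** * Polynomial functions *)

Section polynomials.
Context {R : realType}.

Definition monom d (a : 'I_d -> nat) (x : 'rV[R]_d) : R :=
  \prod_i x 0 i ^+ a i.

Lemma PkD d k (p q : 'rV[R]_d -> R) :
  Pk k p -> Pk k q -> Pk k (fun x => p x + q x).
Proof.
move=> [c hc] [c' hc']; exists (fun a => c a + c' a) => x.
by rewrite hc hc' -big_split /=; apply: eq_bigr => a _; rewrite mulrDl.
Qed.

Lemma PkZ d k r (p : 'rV[R]_d -> R) : Pk k p -> Pk k (fun x => r * p x).
Proof.
move=> [c hc]; exists (fun a => r * c a) => x; rewrite hc mulr_sumr.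
by apply: eq_bigr => a _; rewrite mulrA.
Qed.

Lemma Pk0 d k : Pk k (fun _ : 'rV[R]_d => 0).
Proof. by exists (fun=> 0) => x; rewrite big1// => a _; rewrite mul0r. Qed.

Lemma Pk_sum d k I (r : seq I) (P : pred I) (F : I -> 'rV[R]_d -> R) :
  (forall i, P i -> Pk k (F i)) -> Pk k (fun x => \sum_(i <- r | P i) F i x).
Proof.
move=> PF; elim: r => [|i r IH].
  by under eq_fun do rewrite big_nil; exact: Pk0.
under eq_fun do rewrite big_cons.
by case Pi: (P i) => //; apply: PkD => //; exact: PF.
Qed.

Lemma Pk_monom d k (a : 'I_d -> nat) : (\sum_i a i <= k)%N -> Pk k (monom a).
Proof.
move=> ak.
have lea i : (a i <= k)%N by rewrite (leq_trans _ ak)// (bigD1 i)//= leq_addr.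
pose b := [ffun i => inord (a i) : 'I_k.+1].
have bE i : b i = a i :> nat by rewrite ffunE inordK ?ltnS.
exists (fun e => (e == b)%:R) => x.
rewrite (bigD1 b) /=; last by under eq_bigr do rewrite bE.
rewrite eqxx mul1r [X in _ + X]big1 ?addr0; last first.
  by move=> e /andP[_ /negPf ->]; rewrite mul0r.
by apply: eq_bigr => i _; rewrite bE.
Qed.

Lemma Pk_monom_ind d k (P : ('rV[R]_d -> R) -> Prop) :
  P (fun=> 0) -> (forall p q, P p -> P q -> P (fun x => p x + q x)) ->
  (forall c p, P p -> P (fun x => c * p x)) ->
  (forall a, (\sum_i a i <= k)%N -> P (monom a)) ->
  forall p, Pk k p -> P p.
Proof.
move=> P0 PD PZ Pm p [c hc].
have -> : p = fun x => \sum_(a : {ffun 'I_d -> 'I_k.+1} | (\sum_i a i <= k)%N)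
    c a * monom (fun i => a i : nat) x by apply/funext => x; rewrite hc.
elim: (index_enum _) => [|a r IH].
  by under eq_fun do rewrite big_nil.
under eq_fun do rewrite big_cons.
by case Pi: (_ <= _)%N => //; apply: PD => //; apply: PZ; exact: Pm.
Qed.

Lemma monomS d (a : 'I_d -> nat) i x :
  monom (fun j => a j + (j == i))%N x = x 0 i * monom a x.
Proof.
rewrite /monom (bigD1 i)//= [in RHS](bigD1 i)//= eqxx addn1 exprS mulrA.
congr (_ * _); apply: eq_bigr => j /negPf ->; by rewrite addn0.
Qed.

Lemma sum_monomS d (a : 'I_d -> nat) i :
  (\sum_j (a j + (j == i)) = (\sum_j a j).+1)%N.
Proof.
rewrite big_split /= -addn1; congr (_ + _)%N.
by rewrite (bigD1 i)//= eqxx big1// => j /negPf ->.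
Qed.

Lemma PkX d k i (p : 'rV[R]_d -> R) : Pk k p -> Pk k.+1 (fun x => x 0 i * p x).
Proof.
apply: (Pk_monom_ind (P := fun p => Pk k.+1 (fun x => x 0 i * p x))).
- by under eq_fun do rewrite mulr0; exact: Pk0.
- by move=> q r Pq Pr; under eq_fun do rewrite mulrDr; exact: PkD.
- by move=> c q Pq; under eq_fun do rewrite mulrCA; exact: PkZ.
- move=> a ak; under eq_fun do rewrite -monomS.
  by apply: Pk_monom; rewrite sum_monomS.
Qed.

Lemma Pk_cst d k (c : R) : Pk k (fun _ : 'rV[R]_d => c).
Proof.
have -> : (fun _ : 'rV[R]_d => c) = fun x => c * monom (fun=> 0%N) x.
  by apply/funext => x; rewrite /monom big1 ?mulr1.
by apply/PkZ/Pk_monom; rewrite big1.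
Qed.

Lemma Pk0_cst d (p : 'rV[R]_d -> R) : Pk 0 p -> exists c, p = fun=> c.
Proof.
apply: (Pk_monom_ind (P := fun p => exists c, p = fun=> c)).
- by exists 0.
- by move=> q r [c ->] [c' ->]; exists (c + c').
- by move=> e q [c ->]; exists (e * c).
- move=> a; rewrite leqn0 sum_nat_eq0 => /forallP a0; exists 1.
  apply/funext => x; rewrite /monom big1// => i _.
  by rewrite (eqP (implyP (a0 i) isT)) expr0.
Qed.

(** Each nonconstant monomial contains some coordinate, which is factored out. *)
Lemma Pk_dec d k (p : 'rV[R]_d -> R) : Pk k.+1 p ->
  exists c (q : 'I_d -> 'rV[R]_d -> R), (forall i, Pk k (q i)) /\
    p = fun x => c + \sum_i x 0 i * q i x.
Proof.
apply: (Pk_monom_ind (P := fun p => exists c q, (forall i, Pk k (q i)) /\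
    p = fun x => c + \sum_i x 0 i * q i x)).
- exists 0, (fun _ _ => 0); split=> [i|]; first exact: Pk0.
  by apply/funext => x; rewrite big1 ?addr0// => i _; rewrite mulr0.
- move=> f g [c [q [Pq ->]]] [c' [q' [Pq' ->]]].
  exists (c + c'), (fun i x => q i x + q' i x); split=> [i|].
    exact: PkD.
  apply/funext => x; rewrite addrACA -big_split /=; congr (_ + _).
  by apply: eq_bigr => i _; rewrite mulrDr.
- move=> e f [c [q [Pq ->]]]; exists (e * c), (fun i x => e * q i x).
  split=> [i|]; first exact: PkZ.
  apply/funext => x; rewrite mulrDr mulr_sumr; congr (_ + _).
  by apply: eq_bigr => i _; rewrite mulrCA.
- move=> a ak; have [a0|] := eqVneq (\sum_i a i)%N 0%N.
    exists 1, (fun _ _ => 0); split=> [i|]; first exact: Pk0.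
    apply/funext => x; rewrite /monom big1 ?[X in _ + X]big1 ?addr0//.
      by move=> i _; rewrite mulr0.
    move=> i _; move/eqP: a0; rewrite sum_nat_eq0 => /forallP a0.
    by rewrite (eqP (implyP (a0 i) isT)) expr0.
  rewrite sum_nat_eq0 negb_forall => /existsP[i]; rewrite implyTb => ai.
  pose b j := (a j - (j == i))%N.
  have bE : a = fun j => (b j + (j == i))%N.
    apply/funext => j; rewrite /b subnK//; case: eqP => // ->.
    by rewrite lt0n.
  exists 0, (fun j x => (j == i)%:R * monom b x); split=> [j|].
    apply/PkZ/Pk_monom; rewrite -ltnS -(sum_monomS _ i) (leq_trans _ ak)//.
    by apply: leq_sum => l _; rewrite [in leqRHS]bE.
  apply/funext => x; rewrite add0r {1}bE monomS (bigD1 i)//= eqxx mul1r.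
  rewrite [X in _ + X]big1 ?addr0// => j /negPf ->.
  by rewrite mul0r mulr0.
Qed.

(** Induction along multiplication by a coordinate, which raises the degree bound by one. Most facts
    on polynomials below follow from these three cases, without touching coefficients. *)
Lemma Pk_ind d (P : nat -> ('rV[R]_d -> R) -> Prop) :
  (forall k c, P k (fun=> c)) ->
  (forall k p q, Pk k p -> Pk k q -> P k p -> P k q ->
    P k (fun x => p x + q x)) ->
  (forall k i q, Pk k q -> P k q -> P k.+1 (fun x => x 0 i * q x)) ->
  forall k p, Pk k p -> P k p.
Proof.
move=> Pc PD PX; elim=> [|k IH] p Pp.
  by have [c ->] := Pk0_cst Pp.
have [c [q [Pq ->]]] := Pk_dec Pp.
apply: (PD) => //; first exact: Pk_cst.
  by apply: Pk_sum => i _; exact: PkX.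
suff [] : Pk k.+1 (fun x => \sum_i x 0 i * q i x) /\
  P k.+1 (fun x => \sum_i x 0 i * q i x) by [].
elim: (index_enum _) => [|i r [IH1 IH2]].
  by under eq_fun do rewrite big_nil; split => //; exact: Pk0.
have Px : Pk k.+1 (fun x => x 0 i * q i x) by exact: PkX.
under eq_fun do rewrite big_cons; split; first exact: PkD.
by apply: (PD) => //; apply: (PX) => //; exact: IH.
Qed.

Lemma Pk_leq d k l (p : 'rV[R]_d -> R) : (k <= l)%N -> Pk k p -> Pk l p.
Proof.
move=> kl Pp; move: l kl; move: k p Pp.
apply: Pk_ind => [k c l _|k p q _ _ Hp Hq l kl|k i q _ Hq [//|l] kl].
- exact: Pk_cst.
- by apply: PkD; [exact: Hp|exact: Hq].
- by apply: PkX; exact: Hq.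
Qed.

Lemma PkM d k l (p q : 'rV[R]_d -> R) :
  Pk k p -> Pk l q -> Pk (k + l) (fun x => p x * q x).
Proof.
move=> Pp Pq; move: k p Pp.
apply: Pk_ind => [k c|k p r _ _ Hp Hr|k i r _ Hr].
- by apply: PkZ; apply: Pk_leq Pq; exact: leq_addl.
- by under eq_fun do rewrite mulrDl; exact: PkD.
- by under eq_fun do rewrite -mulrA; exact: PkX.
Qed.

Lemma Pk_coord d (i : 'I_d) : Pk 1 (fun x : 'rV[R]_d => x 0 i).
Proof.
rewrite (_ : (fun _ => _) = fun x : 'rV[R]_d => x 0 i * 1).
  by apply: PkX; exact: Pk_cst.
by apply/funext => x; rewrite mulr1.
Qed.

Lemma Pk_affine_coord m n (A : 'M[R]_(m, n)) (b : 'rV[R]_n) i :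
  Pk 1 (fun t => (t *m A + b) 0 i).
Proof.
under eq_fun do rewrite !mxE.
apply: PkD; last exact: Pk_cst.
apply: Pk_sum => j _; under eq_fun do rewrite mulrC.
by apply: PkZ; exact: Pk_coord.
Qed.

Lemma Pk_comp_affine k m n (A : 'M[R]_(m, n)) b (p : 'rV[R]_n -> R) :
  Pk k p -> Pk k (fun t => p (t *m A + b)).
Proof.
move: k p; apply: Pk_ind => [k c|k p q _ _ Hp Hq|k i q _ Hq].
- exact: Pk_cst.
- exact: PkD.
- by rewrite -add1n; apply: PkM => //; exact: Pk_affine_coord.
Qed.

Lemma Pk_dot d (v : 'rV[R]_d) : Pk 1 (fun x => dot v x).
Proof. by apply: Pk_sum => i _; apply: PkZ; exact: Pk_coord. Qed.

Lemma Pk_mrv d k (p : 'rV[R]_d -> R) : Pk k p ->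
  mrv (p : 'rV[R]_d -> measurableTypeR R).
Proof.
move: k p; apply: Pk_ind => [k c|k p q _ _ Hp Hq|k i q _ Hq].
- exact: measurable_cst.
- exact: measurable_funD.
- by apply: measurable_funM => //; exact: mrv_coord.
Qed.

Lemma Pk_bounded d k (p : 'rV[R]_d -> R) c r : Pk k p ->
  exists M, forall x, box c r x -> `|p x| <= M.
Proof.
move: k p; apply: Pk_ind => [k e|k p q _ _ [M Hp] [N Hq]|k i q _ [M Hq]].
- by exists `|e|.
- exists (M + N) => x bx; rewrite (le_trans (ler_normD _ _))// lerD//.
    exact: Hp.
  exact: Hq.
- exists ((`|c 0 i| + r) * M) => x bx; rewrite normrM ler_pM//.
    rewrite -[x 0 i](subrK (c 0 i)) (le_trans (ler_normD _ _))// addrC lerD2l.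
    exact: bx.
  exact: Hq.
Qed.

(** Restriction to a line turns questions on derivatives and zeros into statements on univariate
    polynomials. *)
Lemma Pk_line d k (p : 'rV[R]_d -> R) y z : Pk k p ->
  exists q : {poly R}, forall t, p (y + t *: z) = q.[t].
Proof.
move: k p; apply: Pk_ind => [k c|k p q _ _ [P Hp] [Q Hq]|k i q _ [Q Hq]].
- by exists c%:P => t; rewrite hornerC.
- by exists (P + Q) => t; rewrite hornerD Hp Hq.
- exists (((y 0 i)%:P + (z 0 i)%:P * 'X) * Q) => t.
  by rewrite !mxE !hornerE Hq mulrC [t * _]mulrC mulrC.
Qed.

End polynomials.

(** * Directional derivatives and the identity theorem *)

Section derivatives.
Context {R : realType} {d : nat}.
Implicit Types (p q : 'rV[R]_d -> R) (x y z v : 'rV[R]_d).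

Lemma Pk_differentiable k p x : Pk k p -> differentiable p x.
Proof.
move: k p; apply: Pk_ind => [k c|k p q _ _ Hp Hq|k i q _ Hq].
- exact: differentiable_cst.
- exact: differentiableD.
- by apply: differentiableM => //; exact: differentiable_coord.
Qed.

Lemma Pk_derivable k p x v : Pk k p -> derivable p x v.
Proof. by move=> Pp; apply: diff_derivable; exact: Pk_differentiable Pp. Qed.

Lemma Pk_continuous k p : Pk k p -> continuous p.
Proof.
by move=> Pp x; apply: differentiable_continuous; exact: Pk_differentiable Pp.
Qed.

Lemma derivative_line k p y z t (q : {poly R}) : Pk k p ->
  (forall s, p (y + s *: z) = q.[s]) -> 'D_z p (y + t *: z) = q^`().[t].
Proof.
move=> Pp pq; rewrite derivE derive1E /derive /=.
apply: (congr1 (fun F : R -> R => lim (F @ 0^'))); apply/funext => h /=.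
congr (_ *: (_ - _)); last exact: pq.
rewrite (_ : h%:A = h); last exact: mulr1.
by rewrite -pq scalerDl addrCA.
Qed.

Lemma derive_lincomb k p x I (r : seq I) (c : I -> R) (v : I -> 'rV[R]_d) :
  Pk k p -> 'D_(\sum_(i <- r) c i *: v i) p x = \sum_(i <- r) c i * 'D_(v i) p x.
Proof.
move=> Pp; have dp := Pk_differentiable x Pp.
rewrite deriveE// linear_sum; apply: eq_bigr => i _.
by rewrite linearZ deriveE.
Qed.

Lemma derive_coord v i x : 'D_v (fun y => y 0 i) x = v 0 i.
Proof.
have pq s : (x + s *: v) 0 i = ((x 0 i)%:P + (v 0 i)%:P * 'X).[s].
  by rewrite !hornerE !mxE mulrC.
have := derivative_line 0 (Pk_coord i) pq.
rewrite scale0r addr0 => ->.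
rewrite derivD derivC derivM derivC derivX !hornerE; ring.
Qed.

Lemma derive_cst0 v (c : R) x : 'D_v (fun _ => c) x = 0.
Proof. exact: derive_cst. Qed.

Lemma Pk_deriveM k l p q v x : Pk k p -> Pk l q ->
  'D_v (fun y => p y * q y) x = 'D_v p x * q x + p x * 'D_v q x.
Proof.
move=> Pp Pq; rewrite (deriveM (Pk_derivable Pp) (Pk_derivable Pq)).
by rewrite addrC /GRing.scale /= [q x * _]mulrC.
Qed.

Lemma Pk_deriveD k l p q v x : Pk k p -> Pk l q ->
  'D_v (fun y => p y + q y) x = 'D_v p x + 'D_v q x.
Proof.
by move=> Pp Pq; rewrite (deriveD (Pk_derivable Pp) (Pk_derivable Pq)).
Qed.

Lemma Pk_deriveZ k p v c x : Pk k p ->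
  'D_v (fun y => c * p y) x = c * 'D_v p x.
Proof.
move=> Pp; rewrite (Pk_deriveM _ _ (Pk_cst d 0%N c) Pp).
by rewrite derive_cst0 mul0r add0r.
Qed.

Lemma Pk_derive k p v : Pk k p -> Pk k.-1 (fun x => 'D_v p x).
Proof.
(* The vanishing of derivatives for l = 0 is carried along because [l.-1] does not distinguish l = 0
   from l = 1: in the product rule for a coordinate times a constant q, the term x_i D_v q must have
   degree 0. *)
suff H l r : Pk l r -> (l = 0%N -> forall x, 'D_v r x = 0) /\
    Pk l.-1 (fun x => 'D_v r x) by move=> /H[].
move: l r; apply: Pk_ind => [l c|l r q Pr Pq [Hr1 Hr2] [Hq1 Hq2]|l i q Pq [Hq1 Hq2]].
- split=> [_ x|]; first exact: derive_cst0.
  by under eq_fun do rewrite derive_cst0; exact: Pk_cst.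
- split=> [l0 x|]; first by rewrite (Pk_deriveD _ _ Pr Pq) Hr1// Hq1// addr0.
  by under eq_fun do rewrite (Pk_deriveD _ _ Pr Pq); exact: PkD.
- split=> //=.
  under eq_fun do rewrite (Pk_deriveM _ _ (Pk_coord i) Pq) derive_coord.
  apply: PkD; first exact: PkZ.
  case: l => [|l] in Pq Hq1 Hq2 *; last exact: PkX.
  by under eq_fun do rewrite Hq1// mulr0; exact: Pk_cst.
Qed.

Lemma poly_zero_seg k p y z e : Pk k p -> 0 < e ->
  (forall t, 0 <= t <= e -> p (y + t *: z) = 0) -> forall t, p (y + t *: z) = 0.
Proof.
move=> Pp e0 H t; have [q pq] := Pk_line y z Pp.
suff q0 : q = 0 by rewrite pq q0 horner0.
apply/eqP; apply: contraT => q0.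
(* The points e / (i + 1) with i < size q are [size q] distinct roots in ]0, e], more than a nonzero
   [q] can have. *)
pose s := [seq e / i.+1%:R | i <- iota 0 (size q)].
have rs : all (root q) s.
  apply/allP => _ /mapP[i _ ->]; rewrite /root -pq H//.
  rewrite divr_ge0 ?(ltW e0)//= ler_pdivrMr ?ltr0n// ler_peMr ?(ltW e0)//.
  by rewrite ler1n.
have us : uniq s.
  rewrite map_inj_in_uniq ?iota_uniq// => i j _ _.
  move=> /(mulfI (lt0r_neq0 e0))/invr_inj/eqP.
  by rewrite eqr_nat => /eqP[].
by have := max_poly_roots q0 rs us; rewrite size_map size_iota ltnn.
Qed.

(** Every x lies on a line through a point of [U], and p vanishes on a short piece of this line. *)
Lemma poly_zero_open k p (U : set 'rV[R]_d) : Pk k p -> open U -> U !=set0 ->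
  (forall x, U x -> p x = 0) -> forall x, p x = 0.
Proof.
move=> Pp oU [y Uy] H x.
have cl : continuous (fun t : R => y + t *: (x - y)).
  by move=> t; apply: cvgD; [exact: cvg_cst|apply: cvgZl; exact: cvg_id].
have : \forall t \near (0 : R), U (y + t *: (x - y)).
  by apply: (cl 0); apply: open_nbhs_nbhs; split => //; rewrite scale0r addr0.
move=> /nbhs_ballP[e /= e0 eU].
have := @poly_zero_seg k p y (x - y) (e / 2) Pp _ _ 1.
rewrite scale1r subrKC; apply; first by rewrite divr_gt0.
move=> t /andP[t0 te]; apply/H/eU; rewrite /ball /= sub0r normrN ger0_norm//.
by rewrite (le_lt_trans te)// ltr_pdivrMr// ltr_pMr// ltr1n.
Qed.

End derivatives.

(** * Integrals of polynomials over bounded sets *)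

Section polynomial_integrals.
Context {R : realType} {d : nat}.
Implicit Types (A : set 'rV[R]_d) (p q : 'rV[R]_d -> R).

Definition mbounded A := rv_measurable A /\ exists c r, A `<=` box c r.

Lemma mbounded_finite A : mbounded A ->
  (lebesgue_tuple R d (rv_of_tuple @^-1` A) < +oo)%E.
Proof.
move=> [mA [c [r Ar]]]; have [r0|r0] := leP 0 r.
  apply: (@le_lt_trans _ _ (lebesgue_tuple R d (rv_of_tuple @^-1` box c r))).
    by apply: le_measure; rewrite ?inE//; [exact: rv_measurable_box|move=> t /= /Ar].
  by rewrite measure_box// ltry.
(* For r < 0, [A] is still inside the box of radius 0, to which [measure_box] applies. *)
apply: (@le_lt_trans _ _ (lebesgue_tuple R d (rv_of_tuple @^-1` box c 0))).
  apply: le_measure; rewrite ?inE//; first exact: rv_measurable_box.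
  by move=> t /= /Ar H i; rewrite (le_trans (H i))// ltW.
by rewrite measure_box// ltry.
Qed.

Lemma bounded_integrable A p M : mbounded A ->
  mrv (p : 'rV[R]_d -> measurableTypeR R) -> (forall x, A x -> `|p x| <= M) ->
  (lebesgue_tuple R d).-integrable (rv_of_tuple @^-1` A)
    (EFin \o (p \o rv_of_tuple)).
Proof.
move=> bA mp pM; apply: measurable_bounded_integrable.
- exact: bA.1.
- exact: mbounded_finite.
- exact: measurable_funTS.
- exists M; split; rewrite ?num_real// => N MN x /= Ax.
  by rewrite (le_trans (pM _ Ax))// ltW.
Qed.

Lemma Pk_integrable A k p : mbounded A -> Pk k p ->
  (lebesgue_tuple R d).-integrable (rv_of_tuple @^-1` A)
    (EFin \o (p \o rv_of_tuple)).
Proof.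
move=> bA Pp; have [_ [c [r Ar]]] := bA; have [M HM] := Pk_bounded c r Pp.
apply: (bounded_integrable bA (Pk_mrv Pp) (M := M)) => x /Ar; exact: HM.
Qed.

Lemma eq_vol_int A p q : (forall x, A x -> p x = q x) ->
  vol_int A p = vol_int A q.
Proof. by move=> pq; apply: eq_Rintegral => t; rewrite inE /= => /pq. Qed.

Lemma vol_int_ge0 A p : (forall x, A x -> 0 <= p x) -> 0 <= vol_int A p.
Proof. by move=> p0; apply: Rintegral_ge0 => t; exact: p0. Qed.

Lemma vol_intD A k l p q : mbounded A -> Pk k p -> Pk l q ->
  vol_int A (fun x => p x + q x) = vol_int A p + vol_int A q.
Proof.
move=> bA Pp Pq; apply: RintegralD; first exact: bA.1.
  exact: Pk_integrable Pp.
exact: Pk_integrable Pq.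
Qed.

Lemma vol_intZ A k c p : mbounded A -> Pk k p ->
  vol_int A (fun x => c * p x) = c * vol_int A p.
Proof.
by move=> bA Pp; apply: RintegralZl; [exact: bA.1|exact: Pk_integrable Pp].
Qed.

Lemma vol_int_le A k l p q : mbounded A -> Pk k p -> Pk l q ->
  (forall x, A x -> p x <= q x) -> vol_int A p <= vol_int A q.
Proof.
move=> bA Pp Pq pq; apply: le_Rintegral; first exact: bA.1.
- exact: Pk_integrable Pp.
- exact: Pk_integrable Pq.
- by move=> t; exact: pq.
Qed.

Lemma vol_int_eq0 A k p c r : mbounded A -> Pk k p ->
  (forall x, A x -> 0 <= p x) -> 0 < r -> box c r `<=` A ->
  vol_int A p = 0 -> p c = 0.
Proof.
move=> bA Pp p0 r0 cA int0.
have Ac : A c by apply: cA => i; rewrite subrr normr0 ltW.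
apply/eqP; rewrite eq_le p0// andbT leNgt; apply/negP => pc.
(* By continuity [p] is at least half its value at c on a small box, whose measure (2 e)^d is
   positive. *)
have [e [e0 er He]] : exists e, [/\ 0 < e, e <= r &
    forall x, box c e x -> p c / 2 <= p x].
  have pc2 : 0 < p c / 2 by rewrite divr_gt0.
  have /(_ c)/cvgrPdist_le/(_ _ pc2) := Pk_continuous Pp.
  move=> /nbhs_ballP[e /= e0 He]; exists (Num.min (e / 2) r); split.
  - by rewrite lt_min r0 divr_gt0.
  - by rewrite ge_min lexx orbT.
  - move=> x bx; have : ball c e x.
      split=> [//|i j]; rewrite ord1 -ball_normE /= distrC (le_lt_trans (bx j))//.
      by rewrite gt_min ltr_pdivrMr// ltr_pMr// ltr1n.
    by move=> /He; rewrite /= ler_distlC => /andP[]; lra.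
have bB : mbounded (box c e) by split; [exact: rv_measurable_box|exists c, e].
have eA : box c e `<=` A by move=> x bx; apply: cA => i; rewrite (le_trans (bx i)).
suff : p c / 2 * (e *+ 2) ^+ d <= 0.
  by rewrite leNgt mulr_gt0// ?divr_gt0// exprn_gt0// mulr2n addr_gt0.
have <- : vol_int (box c e) (fun=> p c / 2) = p c / 2 * (e *+ 2) ^+ d.
  rewrite /vol_int Rintegral_cst; last exact: rv_measurable_box.
  congr (_ * _); rewrite -[RHS]/(fine ((e *+ 2) ^+ d)%:E); congr fine.
  exact/measure_box/ltW.
rewrite -int0 (le_trans (vol_int_le bB (Pk_cst d 0%N _) Pp He))//.
rewrite /vol_int /Rintegral fine_le//.
- by apply: integrable_fin_num; [exact: rv_measurable_box|exact: Pk_integrable Pp].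
- by apply: integrable_fin_num; [exact: bA.1|exact: Pk_integrable Pp].
- apply: ge0_subset_integral => /=.
  + exact: rv_measurable_box.
  + exact: bA.1.
  + by apply/measurable_EFinP/measurable_funTS; exact: Pk_mrv Pp.
  + by move=> t At; rewrite lee_fin p0.
  + by move=> t /= /eA.
Qed.

End polynomial_integrals.

(** * Integration over the reference simplex *)

Section reference_simplex.
Context {R : realType}.
Local Notation leb := (@lebesgue_measure R).

(** Any point close to c is itself the center of a box inside [A], so [p] vanishes on an open set,
    hence identically. *)
Lemma vol_int_eq0_everywhere d (A : set 'rV[R]_d) k p c r :
  mbounded A -> Pk k p -> (forall x, A x -> 0 <= p x) -> 0 < r ->
  box c r `<=` A -> vol_int A p = 0 -> forall x, p x = 0.
Proof.
move=> bA Pp p0 r0 cA int0.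
have r2 : 0 < r / 2 by rewrite divr_gt0.
apply: (@poly_zero_open _ _ k p (interior (ball c (r / 2)))) => //.
- exact: open_interior.
- by exists c; apply: nbhsx_ballx.
- move=> x /interior_subset[_ cx].
  apply: (vol_int_eq0 bA Pp p0 r2 _ int0) => y xy; apply: cA => i.
  rewrite [r]splitr -[y 0 i](subrK (x 0 i)) -addrA (le_trans (ler_normD _ _))//.
  rewrite lerD// ltW//.
  by have := cx 0 i; rewrite -ball_normE /= distrC.
Qed.

Lemma ref_simplex_mbounded m : mbounded (@ref_simplex R m).
Proof.
split.
  have -> : @ref_simplex R m = [set t : 'rV[R]_m | forall i, t 0 i \in `[0, +oo[]
      `&` ((fun t => \sum_i t 0 i) @^-1` `]-oo, 1]%classic).
    apply/seteqP; split=> t /= [H1 H2]; split.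
    - by move=> i; rewrite in_itv/= H1.
    - by rewrite in_itv.
    - by move=> i; have := H1 i; rewrite in_itv/= andbT.
    - by move: H2; rewrite in_itv.
  apply: measurableI.
    by apply: rv_measurable_bigcap => i; exact: rv_measurable_coord_itv.
  have Ps : Pk 1 (fun t : 'rV[R]_m => \sum_i t 0 i).
    by apply: Pk_sum => i _; exact: Pk_coord.
  exact: (mrv_preimage (Pk_mrv Ps) (measurable_itv _)).
exists 0, 1 => t [t0 t1] i; rewrite mxE subr0 ger0_norm//.
by rewrite (le_trans _ t1)// (bigD1 i)//= lerDl sumr_ge0.
Qed.

Lemma ref_simplex_box m :
  exists c r, 0 < r /\ box c r `<=` @ref_simplex R m.
Proof.
(* The box of radius r around (r, ..., r) has coordinates in [0, 1 / (m + 1)], and m of them sum to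
   at most 1. *)
pose r : R := m.+1%:R^-1 / 2.
have r0 : 0 < r by rewrite divr_gt0 ?invr_gt0.
exists (const_mx r), r; split=> // t tr.
have ti i : 0 <= t 0 i <= m.+1%:R^-1.
  have := tr i; rewrite mxE ler_distl subrr => /andP[-> h] /=.
  by rewrite (le_trans h)// /r -splitr.
split=> [i|]; first by case/andP: (ti i).
apply: (@le_trans _ _ (\sum_(i < m) m.+1%:R^-1)).
  by apply: ler_sum => i _; case/andP: (ti i).
rewrite sumr_const card_ord -[_ *+ m]mulr_natl ler_pdivrMr// mul1r ler_nat.
exact: leqnSn.
Qed.

Lemma ref_int_eq0 m k (p : 'rV[R]_m -> R) : Pk k p ->
  (forall x, ref_simplex x -> 0 <= p x) ->
  vol_int (@ref_simplex R m) p = 0 -> forall x, p x = 0.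
Proof.
move=> Pp p0 int0; have [c [r [r0 cr]]] := ref_simplex_box m.
exact: vol_int_eq0_everywhere (@ref_simplex_mbounded m) Pp p0 r0 cr int0.
Qed.

Lemma ref_volume_gt0 m : 0 < vol_int (@ref_simplex R m) (fun=> 1).
Proof.
rewrite lt_neqAle eq_sym vol_int_ge0 ?andbT//; apply/eqP => int0.
have := ref_int_eq0 (Pk_cst m 0%N 1) _ int0.
by move=> /(_ (fun _ _ => ler01) 0)/eqP; rewrite oner_eq0.
Qed.

Lemma ref_simplex_rvcons m h (s : 'rV[R]_m) :
  ref_simplex (rvcons h s) <->
  ref_simplex s /\ 0 <= h <= 1 - \sum_i s 0 i.
Proof.
rewrite /ref_simplex /= big_ord_recl rvcons0.
have -> : \sum_(i < m) rvcons h s 0 (lift ord0 i) = \sum_i s 0 i.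
  by apply: eq_bigr => i _; rewrite rvconsS.
split=> [[H1 H2]|[[H1 H2] /andP[h0 h1]]].
  have s0 i : 0 <= s 0 i by have := H1 (lift ord0 i); rewrite rvconsS.
  have h0 : 0 <= h by have := H1 ord0; rewrite rvcons0.
  split; last by rewrite h0; lra.
  by split=> //; rewrite (le_trans _ H2)// lerDr.
split=> [i|]; last by lra.
by case: (unliftP ord0 i) => [j|] ->; rewrite ?rvcons0 ?rvconsS.
Qed.

Definition rve0 m : 'rV[R]_m.+1 := rvcons 1 0.

Lemma rvcons_line m h (s : 'rV[R]_m) : rvcons h s = rvcons 0 s + h *: rve0 m.
Proof.
apply/rowP => i; rewrite [RHS]mxE [X in _ + X]mxE /rve0.
by case: (unliftP ord0 i) => [j|] ->; rewrite ?rvcons0 ?rvconsS ?[(0 : 'rV_m) _ _]mxE; ring.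
Qed.

Lemma FTC_poly (q : {poly R}) a : 0 <= a ->
  (\int[leb]_(h in `[0%R, a]) (q^`().[h])%:E = (q.[a] - q.[0])%:E)%E.
Proof.
rewrite le_eqVlt => /predU1P[<-|a0].
  by rewrite set_itv1 integral_set1 subrr.
rewrite (continuous_FTC2 (F := horner q))//.
- by apply: continuous_subspaceT; exact: continuous_horner.
- split=> [x _||]; first exact: derivable_horner.
    by apply: cvg_at_right_filter; exact: continuous_horner.
  by apply: cvg_at_left_filter; exact: continuous_horner.
- by move=> x _; rewrite derivE.
Qed.

(** Signed counterpart of the Tonelli step, through the image measure; Fubini can then be applied to
    the right-hand side. *)
Lemma integral_tupleS m (g : 'rV[R]_m.+1 -> \bar R) : mrv g ->
  (lebesgue_tuple R m.+1).-integrable setT (g \o rv_of_tuple) ->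
  let G := fun p : measurableTypeR R * m.-tuple (measurableTypeR R) =>
    g (rvcons p.1 (rv_of_tuple p.2)) in
  (leb \x lebesgue_tuple R m)%E.-integrable setT G /\
  (\int[lebesgue_tuple R m.+1]_t (g \o rv_of_tuple) t =
   \int[leb \x lebesgue_tuple R m]_p G p)%E.
Proof.
move=> mg ig G.
pose tc (p : measurableTypeR R * m.-tuple (measurableTypeR R)) :=
  [the m.+1.-tuple (measurableTypeR R) of p.1 :: p.2].
have mtc : measurable_fun setT tc.
  exact: measurable_cons measurable_fst measurable_snd.
have GE : G = (g \o rv_of_tuple) \o tc.
  by apply/funext => p; rewrite /G /= rv_of_tuple_cons.
have iG : (leb \x lebesgue_tuple R m)%E.-integrable setT G.
  apply/integrableP; split; first by rewrite GE; exact: measurableT_comp.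
  case/integrableP: ig => _; apply: le_lt_trans.
  rewrite [leRHS]ge0_integral_pushforward//=.
    rewrite preimage_setT le_eqVlt; apply/orP; left; apply/eqP.
    by apply: eq_integral => p _; rewrite GE.
  by apply: measurableT_comp.
split => //; rewrite [LHS](integral_pushforward mtc mg) ?preimage_setT -?GE//.
Qed.

(** Fubini along the first axis and the fundamental theorem on each fibre 0 <= h <= 1 - sum s. The
    two end points run through the slanted facet and the facet h = 0. *)
Lemma ref_int_derive m k (p : 'rV[R]_m.+1 -> R) : Pk k p ->
  vol_int (@ref_simplex R m.+1) (fun x => 'D_(rve0 m) p x) =
  vol_int (@ref_simplex R m)
    (fun s => p (rvcons (1 - \sum_i s 0 i) s) - p (rvcons 0 s)).
Proof.
move=> Pp; set D := fun x => 'D_(rve0 m) p x.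
have PD : Pk k.-1 D := Pk_derive _ Pp.
set g := ((EFin \o D) \_ (@ref_simplex R m.+1))%E.
have mA := (@ref_simplex_mbounded m.+1).1.
have mg : mrv g by exact: (measurable_patch mA (Pk_mrv PD)).
have ig : (lebesgue_tuple R m.+1).-integrable setT (g \o rv_of_tuple).
  rewrite /g -patch_rv.
  exact: (integrable_mkcond _ mA).1 (Pk_integrable (@ref_simplex_mbounded _) PD).
rewrite /vol_int /Rintegral; congr fine.
rewrite integral_mkcond (patch_rv (EFin \o D)) -/g.
have [iG ->] := integral_tupleS mg ig.
rewrite -(integral21_prod_meas1 iG).
rewrite [RHS]integral_mkcond; apply: eq_integral => t _.
rewrite /fubini_G /= /patch.
set s := rv_of_tuple t.
have [q hq] := Pk_line (rvcons 0 s) (rve0 m) Pp.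
case: ifPn => [|].
  rewrite inE /= => ts; rewrite (rvcons_line (1 - _)) hq.
  rewrite [rvcons 0 s](_ : _ = rvcons 0 s + 0 *: rve0 m) ?hq; last first.
    by rewrite scale0r addr0.
  rewrite -FTC_poly; last by rewrite subr_ge0; case: ts.
  rewrite [RHS]integral_mkcond; apply: eq_integral => h _.
  rewrite /g /patch /= -/s.
  have -> : (rvcons h s \in @ref_simplex R m.+1) =
      (h \in `[0, 1 - \sum_i s 0 i]%classic).
    apply/idP/idP; rewrite !inE /= in_itv/= => H.
      by have [] := (ref_simplex_rvcons h s).1 H.
    exact/ref_simplex_rvcons.
  case: ifP => // _; rewrite /= /D (rvcons_line h).
  by rewrite (derivative_line h Pp hq).
move=> ts; apply: integral0_eq => h _; rewrite /g /patch memNset//.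
move=> /ref_simplex_rvcons[Hs _]; move/negP: ts; apply.
by rewrite inE.
Qed.

End reference_simplex.

Section dot_product.
Context {R : realType} {d : nat}.
Implicit Types x y z : 'rV[R]_d.

Lemma dotE x y : dot x y = (x *m y^T) 0 0.
Proof. by rewrite mxE; apply: eq_bigr => i _; rewrite mxE. Qed.

Lemma dotC x y : dot x y = dot y x.
Proof. by apply: eq_bigr => i _; rewrite mulrC. Qed.

Lemma dotDr x y z : dot x (y + z) = dot x y + dot x z.
Proof. by rewrite -big_split; apply: eq_bigr => i _ /=; rewrite mxE mulrDr. Qed.

Lemma dotZr c x y : dot x (c *: y) = c * dot x y.
Proof. by rewrite mulr_sumr; apply: eq_bigr => i _ /=; rewrite mxE mulrCA. Qed.

Lemma dotNr x y : dot x (- y) = - dot x y.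
Proof. by rewrite -scaleN1r dotZr mulN1r. Qed.

Lemma dotBr x y z : dot x (y - z) = dot x y - dot x z.
Proof. by rewrite dotDr dotNr. Qed.

Lemma dot0r x : dot x 0 = 0.
Proof. by rewrite -(scale0r 0) dotZr mul0r. Qed.

Lemma dotDl x y z : dot (y + z) x = dot y x + dot z x.
Proof. by rewrite dotC dotDr !(dotC x). Qed.

Lemma dotZl c x y : dot (c *: y) x = c * dot y x.
Proof. by rewrite dotC dotZr (dotC x). Qed.

Lemma dotNl x y : dot (- y) x = - dot y x.
Proof. by rewrite dotC dotNr (dotC x). Qed.

Lemma dotBl x y z : dot (y - z) x = dot y x - dot z x.
Proof. by rewrite dotDl dotNl. Qed.

Lemma dot0l x : dot 0 x = 0.
Proof. by rewrite dotC dot0r. Qed.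

Lemma dot_sumr x I (r : seq I) (F : I -> 'rV[R]_d) :
  dot x (\sum_(i <- r) F i) = \sum_(i <- r) dot x (F i).
Proof.
elim: r => [|i r IH]; first by rewrite !big_nil dot0r.
by rewrite !big_cons dotDr IH.
Qed.

Lemma dot_ge0 x : 0 <= dot x x.
Proof. by apply: sumr_ge0 => i _; rewrite -expr2 sqr_ge0. Qed.

Lemma dot_eq0 x : dot x x = 0 -> x = 0.
Proof.
move=> /eqP; rewrite psumr_eq0 => [/allP h|i _]; last by rewrite -expr2 sqr_ge0.
apply/rowP => i; rewrite mxE; have := h i (mem_index_enum i).
by rewrite mulf_eq0 orbb => /eqP.
Qed.

Lemma enormZ c x : enorm (c *: x) = `|c| * enorm x.
Proof.
rewrite /enorm dotZl dotZr mulrA -expr2 sqrtrM ?sqr_ge0//.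
by rewrite sqrtr_sqr.
Qed.

End dot_product.

(** * Simplices and the divergence theorem *)

Section simplices.
Context {R : realType} {d : nat}.
Local Notation pt := 'rV[R]_d.
Local Notation simplex := (@simplex R d).
Implicit Types (K F : simplex) (s : seq pt).

Definition edges m s : 'M[R]_(m, d) := \matrix_(i < m) (s`_i.+1 - s`_0).

(** [s] is any enumeration of the vertices, so that a chart can be adapted to a chosen facet or
    edge. *)
Definition spans s K m := [/\ uniq s, size s = m.+1 & s =i K].

Lemma spans_perm s K m : spans s K m -> perm_eq (enum_fset K) s.
Proof.
by move=> [us _ sK]; apply: uniq_perm => //.
Qed.

Lemma spans_enum K m : #|` K| = m.+1 -> spans (enum_fset K) K m.
Proof. by move=> Km; split; [exact: fset_uniq|rewrite -Km|]. Qed.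

Lemma big_spans (V : zmodType) s K m (F : pt -> V) : spans s K m ->
  \sum_(a <- K) F a = F s`_0 + \sum_(i < m) F s`_i.+1.
Proof.
move=> sp; rewrite (perm_big s) /=; last exact: spans_perm sp.
by case: sp => _ sz _; rewrite (big_nth 0) sz big_mkord big_ord_recl.
Qed.

Lemma spans_in s K m i : spans s K m -> (i <= m)%N -> s`_i \in K.
Proof. by case=> us sz <- im; rewrite mem_nth// sz. Qed.

(** Converts chart coordinates, indexed by position, into weights on points, the form used by [hull]
    and [affinely_independent]. *)
Lemma spans_weights s K m (w0 : R) (w : 'rV[R]_m) : spans s K m ->
  exists lam : pt -> R, lam s`_0 = w0 /\ forall i : 'I_m, lam s`_i.+1 = w 0 i.
Proof.
move=> [us sz _]; pose W := rvcons w0 w.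
exists (fun a => W 0 (inord (index a s))); split.
  by rewrite index_uniq ?sz// -[RHS](rvcons0 _ w); congr (W _ _); apply: val_inj; rewrite /= inordK.
move=> i; rewrite index_uniq ?sz ?ltnS// -[RHS](rvconsS w0).
by congr (W _ _); apply: val_inj; rewrite /= inordK ?ltnS.
Qed.

Lemma row_mul_edges m s (t : 'rV[R]_m) :
  t *m edges m s = \sum_(i < m) t 0 i *: (s`_i.+1 - s`_0).
Proof.
by rewrite mulmx_sum_row; apply: eq_bigr => i _; rewrite rowK.
Qed.

Lemma chart_sum m s (t : 'rV[R]_m) :
  s`_0 + t *m edges m s =
  (1 - \sum_i t 0 i) *: s`_0 + \sum_(i < m) t 0 i *: s`_i.+1.
Proof.
rewrite row_mul_edges; under eq_bigr do rewrite scalerBr.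
by rewrite sumrB -scaler_suml scalerBl scale1r addrA addrAC.
Qed.

(** The chart coordinates are the convex weights of all vertices but the first. *)
Lemma hull_chart s K m : spans s K m ->
  hull K = [set s`_0 + t *m edges m s | t in @ref_simplex R m].
Proof.
move=> sp; apply/seteqP; split=> x.
  move=> [lam [lam0 lam1 ->]].
  have -> : \sum_(a <- K) lam a *: a =
      s`_0 + (\row_i lam s`_i.+1) *m edges m s.
    rewrite chart_sum (big_spans _ sp); move: lam1; rewrite (big_spans _ sp) => lam1.
    congr (_ *: _ + _); last by apply: eq_bigr => i _; rewrite mxE.
    have -> : \sum_i (\row_(i < m) lam s`_i.+1) 0 i = \sum_(i < m) lam s`_i.+1.
      by apply: eq_bigr => i _; rewrite mxE.
    by rewrite -lam1 addrK.
  exists (\row_i lam s`_i.+1) => //; split=> [i|].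
    by rewrite mxE lam0// (spans_in sp).
  under eq_bigr do rewrite mxE.
  rewrite -lam1 (big_spans _ sp) lerDr lam0// (spans_in sp)//.
move=> [t [t0 t1] <-].
have [lam [l0 lS]] := spans_weights (1 - \sum_i t 0 i) t sp.
exists lam; split.
- move=> a; case: (sp) => us sz <- /(nthP 0)[[|i] + <-]; rewrite sz.
    by rewrite l0 subr_ge0.
  by rewrite ltnS => im; rewrite (lS (Ordinal im)).
- rewrite (big_spans _ sp) l0 -[RHS](subrK (\sum_i t 0 i)); congr (_ + _).
  by apply: eq_bigr => i _; rewrite lS.
- rewrite (big_spans _ sp) l0 chart_sum; congr (_ + _).
  by apply: eq_bigr => i _; rewrite lS.
Qed.

(** A row [t] in the kernel is an affine dependence with weight - sum t at the first vertex. *)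
Lemma edges_row_free s K m : spans s K m -> affinely_independent K ->
  row_free (edges m s).
Proof.
move=> sp aK; apply/row_freeP; apply/row_freeP; rewrite -kermx_eq0.
apply/eqP/row_matrixP => i; rewrite row0.
set t := row i _.
have tE : t *m edges m s = 0 by rewrite -row_mul mulmx_ker row0.
have [lam [l0 lS]] := spans_weights (- \sum_i t 0 i) t sp.
have /(_ lam) h := aK.
apply/rowP => j; rewrite -lS mxE; apply: h; last exact: (spans_in sp).
  rewrite (big_spans _ sp) l0 -[RHS](addNr (\sum_i t 0 i)); congr (_ + _).
  by apply: eq_bigr => l _; rewrite lS.
rewrite (big_spans _ sp) l0 (eq_bigr (fun i => t 0 i *: s`_i.+1)); last first.
  by move=> l _; rewrite lS.
have := chart_sum s t; rewrite tE addr0 => e.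
by apply: (addrI s`_0); rewrite addr0 [RHS]e addrA -{1}[s`_0]scale1r -scalerDl.
Qed.

Lemma chart_inj s K m : spans s K m -> affinely_independent K ->
  injective (fun t : 'rV[R]_m => s`_0 + t *m edges m s).
Proof.
move=> sp aK t t' /addrI; exact: (row_free_inj (edges_row_free sp aK)).
Qed.

Lemma hull_bounded K : exists r, hull K `<=` box 0 r.
Proof.
exists (\sum_(a <- K) \sum_i `|a 0 i|) => x [lam [l0 l1 ->]] i.
have lam1 a : a \in K -> lam a <= 1.
  move=> aK; rewrite -l1 (big_fsetD1 a)//= lerDl big_seq sumr_ge0// => b.
  by rewrite !inE => /andP[_ /l0].
rewrite mxE subr0 summxE big_seq [leRHS]big_seq (le_trans (ler_norm_sum _ _ _))//.
apply: ler_sum => a aK; rewrite mxE normrM ger0_norm ?l0//.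
rewrite (le_trans (ler_piMl _ (lam1 _ aK)))// (bigD1 i)//= lerDl sumr_ge0//.
Qed.

End simplices.

Section simplex_integrals.
Context {R : realType}.

Lemma rv_measurable_preimage_affine m n (A : set 'rV[R]_n) (B : 'M[R]_(m, n)) b :
  rv_measurable A -> rv_measurable [set x | A (x *m B + b)].
Proof.
move=> mA; pose f x : bool := `[< A x >].
have mf : mrv f.
  apply: (measurable_fun_bool true).
  rewrite setTI (_ : _ @^-1` _ = rv_of_tuple @^-1` A)//.
  by apply/seteqP; split=> t /=; rewrite /f => /asboolP.
have := mrv_preimage (mrv_comp_affine B b mf) (Y := [set true]) I.
by rewrite (_ : _ @^-1` _ = [set x | A (x *m B + b)])//;
  apply/seteqP; split=> x /=; rewrite /f => /asboolP.
Qed.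

Definition simplex_full d (K : @simplex R d) :=
  #|` K| = d.+1 /\ affinely_independent K.

Lemma full_spans d (K : @simplex R d) : simplex_full K ->
  exists s, spans s K d.
Proof. by move=> [cK _]; exists (enum_fset K); exact: spans_enum. Qed.

Lemma edges_unit d (K : @simplex R d) s : simplex_full K -> spans s K d ->
  edges d s \in unitmx.
Proof. by move=> [_ aK] sp; rewrite -row_free_unit (edges_row_free sp aK). Qed.

Lemma hull_mbounded d (K : @simplex R d) : simplex_full K -> mbounded (hull K).
Proof.
move=> fK; have [s sp] := full_spans fK; have Eu := edges_unit fK sp.
split; last by have [r Kr] := hull_bounded K; exists 0, r.
rewrite (_ : hull K = [set x | ref_simplex (x *m invmx (edges d s) +
    - (s`_0 *m invmx (edges d s)))]).
  exact: rv_measurable_preimage_affine (ref_simplex_mbounded d).1.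
rewrite (hull_chart sp); apply/seteqP; split=> x /=.
  by move=> [t rt <-]; rewrite mulmxDl mulmxK// addrAC subrr add0r.
move=> rt; exists (x *m invmx (edges d s) - s`_0 *m invmx (edges d s)) => //.
by rewrite -mulmxBl mulmxKV// subrKC.
Qed.

Lemma vol_int_simplex d (K : @simplex R d) s k (f : 'rV[R]_d -> R) :
  simplex_full K -> spans s K d -> Pk k f ->
  vol_int (hull K) f = `|\det (edges d s)| *
    vol_int (@ref_simplex R d) (fun t => f (s`_0 + t *m edges d s)).
Proof.
move=> fK sp Pf; have Eu := edges_unit fK sp.
rewrite (vol_int_affine (s`_0) Eu (hull_mbounded fK).1 (Pk_mrv Pf)).
congr (_ * _).
have -> : [set x | hull K (x *m edges d s + s`_0)] = @ref_simplex R d.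
  apply/seteqP; split=> x /=; rewrite addrC (hull_chart sp).
    by move=> [t rt /(chart_inj sp fK.2) <-].
  by move=> rx; exists x.
by apply: eq_vol_int => x _; rewrite addrC.
Qed.

Definition gram d m (s : seq 'rV[R]_d) :=
  Num.sqrt (\det (edges m s *m (edges m s)^T)).

(** Two enumerations give charts that differ by an affine map t -> t T + b of the reference simplex
    onto itself. Such a map preserves volume, so neither the Gram factor nor the integral
    changes. *)
Lemma surf_int_spans d (F : @simplex R d) s m k (g : 'rV[R]_d -> R) :
  affinely_independent F -> spans s F m -> Pk k g ->
  surf_int F g = gram m s *
    vol_int (@ref_simplex R m) (fun t => g (s`_0 + t *m edges m s)).
Proof.
move=> aF sp Pg; rewrite /surf_int /gram.
have spF : spans (enum_fset F) F m.
  by apply: spans_enum; rewrite (perm_size (spans_perm sp)); case: sp.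
have -> : (size (enum_fset F)).-1 = m by case: spF => _ ->.
rewrite -/(edges m (enum_fset F)); set s0 := enum_fset F in spF *.
have chart x : x \in F -> exists t : 'rV[R]_m, x = s0`_0 + t *m edges m s0.
  move=> xF; suff : hull F x by rewrite (hull_chart spF) => -[t _ <-]; exists t.
  exists (fun y => (y == x)%:R); split.
  - by move=> y _; rewrite ler0n.
  - rewrite (big_fsetD1 x)//= eqxx big_seq big1 ?addr0// => y.
    by rewrite !inE => /andP[/negPf ->].
  - rewrite (big_fsetD1 x)//= eqxx scale1r big_seq big1 ?addr0// => y.
    by rewrite !inE => /andP[/negPf ->]; rewrite scale0r.
have [b sb] := chart _ (spans_in sp (leq0n m)).
have [T sT] : exists T : 'M[R]_m, edges m s = T *m edges m s0.
  have /choice[f hf] : forall i : 'I_m, exists t : 'rV[R]_m,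
      s`_i.+1 - s`_0 = t *m edges m s0.
    move=> i; have [t ->] := chart _ (spans_in sp (ltn_ord i)).
    exists (t - b); rewrite sb opprD addrACA subrr add0r.
    by rewrite mulmxBl.
  exists (\matrix_i f i); apply/row_matrixP => i.
  by rewrite row_mul !rowK.
have Tu : T \in unitmx.
  have := edges_row_free sp aF; rewrite sT -row_free_unit /row_free => /eqP h.
  by have := mxrankM_maxl T (edges m s0); rewrite h eqn_leq rank_leq_row.
have chartE t : s`_0 + t *m edges m s = s0`_0 + (t *m T + b) *m edges m s0.
  by rewrite sb sT mulmxDl mulmxA addrAC addrA.
have refT : [set t | ref_simplex (t *m T + b)] = @ref_simplex R m.
  apply/seteqP; split=> t /= rt.
    have : hull F (s`_0 + t *m edges m s).
      by rewrite chartE (hull_chart spF); exists (t *m T + b).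
    by rewrite (hull_chart sp) => -[t' rt' /(chart_inj sp aF) <-].
  have : hull F (s`_0 + t *m edges m s) by rewrite (hull_chart sp); exists t.
  by rewrite chartE (hull_chart spF) => -[t' rt' /(chart_inj spF aF) <-].
have mref := (@ref_simplex_mbounded R m).1.
(* The substitution rule for the constant 1 on a set of positive volume forces |det T| = 1. *)
have detT : `|\det T| = 1.
  have := vol_int_affine b Tu mref (Pk_mrv (Pk_cst m 0%N 1)).
  rewrite refT => /esym/eqP; rewrite -subr_eq0 -{2}[vol_int _ _]mul1r -mulrBl.
  by rewrite mulf_eq0 (gt_eqF (ref_volume_gt0 m)) orbF subr_eq0 => /eqP.
congr (_ * _).
  rewrite sT trmx_mul mulmxA -[T *m _ *m _]mulmxA !det_mulmx det_tr.
  by rewrite mulrAC -expr2 -real_normK ?num_real// detT expr1n mul1r.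
have Pg' : Pk k (fun t => g (s0`_0 + t *m edges m s0)).
  by under eq_fun do rewrite addrC; exact: Pk_comp_affine.
rewrite (vol_int_affine b Tu mref (Pk_mrv Pg')) refT detT mul1r.
by apply: eq_vol_int => t _; rewrite chartE.
Qed.

End simplex_integrals.

Section facets.
Context {R : realType} {n : nat}.
Local Notation pt := 'rV[R]_n.+1.
Local Notation simplex := (@simplex R n.+1).

(** Volume is height times base. Replacing the row [v] by the unit normal [u] gives a matrix [N]
    with det N ^ 2 = det (E E^T), and det N = c det M where c (v . u) = 1. *)
Lemma det_gram_height (E : 'M[R]_(n, 1 + n)) (u v : 'rV[R]_(1 + n)) :
  (col_mx v E : 'M[R]_(1 + n)) \in unitmx -> dot u u = 1 ->
  E *m u^T = 0 ->
  `|\det (col_mx v E : 'M[R]_(1 + n))| =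
    `|dot v u| * Num.sqrt (\det (E *m E^T)).
Proof.
set M : 'M[R]_(1 + n) := col_mx v E => Mu u1 Eu.
pose w : 'rV[R]_(1 + n) := u *m invmx M.
have uw : u = w *m M by rewrite /w mulmxKV.
pose c := (lsubmx w) 0 0.
have wc : lsubmx w = c%:M by exact: mx11_scalar.
have wE : u = c *: v + rsubmx w *m E.
  by rewrite {1}uw -{1}[w]hsubmxK /M mul_row_col wc mul_scalar_mx.
pose N : 'M[R]_(1 + n) := col_mx u E.
have NM : N = block_mx c%:M (rsubmx w) 0 1%:M *m M.
  by rewrite /M mul_block_col mul0mx add0r mul1mx mul_scalar_mx -wE.
have uu1 : u *m u^T = 1%:M.
  by apply/matrixP => i j; rewrite !ord1 -dotE u1 !mxE.
have uE : u *m E^T = 0 by rewrite -[u]trmxK -trmx_mul Eu trmx0.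
have NN : \det N ^+ 2 = \det (E *m E^T).
  rewrite expr2 -{2}det_tr -det_mulmx /N tr_col_mx mul_col_row uu1 uE Eu.
  by rewrite det_ublock det1 mul1r.
have detN : \det N = c * \det M.
  by rewrite NM det_mulmx det_ublock det1 mulr1 det_scalar1.
have c1 : c * dot v u = 1.
  by rewrite -u1 [in RHS]dotE {2}wE mulmxDl -mulmxA Eu mulmx0 addr0 -scalemxAl mxE dotE.
have -> : \det M = dot v u * \det N.
  by rewrite detN mulrA [dot v u * _]mulrC c1 mul1r.
by rewrite normrM -NN sqrtr_sqr.
Qed.

Lemma edges_cons m (a b : pt) r :
  edges m.+1 [:: b, a & r] = col_mx (a - b) (edges m (b :: r)) :> 'M[R]_(1 + m, _).
Proof.
apply/row_matrixP => i; rewrite rowK.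
case: (split_ordP (i : 'I_(1 + m))) => j ->.
  by rewrite rowKu (ord1 j) row_id.
by rewrite rowKd rowK.
Qed.

Lemma chart_cons m (a b : pt) r h (y : 'rV[R]_m) :
  rvcons h y *m edges m.+1 [:: b, a & r] = h *: (a - b) + y *m edges m (b :: r).
Proof.
rewrite edges_cons.
rewrite -[LHS]/(row_mx (h%:M : 'M[R]_1) y *m col_mx (a - b) (edges m (b :: r))).
by rewrite mul_row_col mul_scalar_mx.
Qed.

Lemma simplex_full_D1 (K : simplex) a : simplex_full K -> a \in K ->
  #|` (K `\ a)%fset| = n.+1 /\ affinely_independent (K `\ a)%fset.
Proof.
move=> [cK aK] Ka; split; first by have := cardfsD1 a K; rewrite Ka cK => -[].
move=> lam l0 l1 b; rewrite !inE => /andP[ba Kb].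
pose lam' c := if c == a then 0 else lam c.
have <- : lam' b = lam b by rewrite /lam' (negPf ba).
apply: aK => //.
  rewrite (big_fsetD1 a)//= {1}/lam' eqxx add0r -[RHS]l0.
  rewrite big_seq [RHS]big_seq; apply: eq_bigr => c; rewrite !inE => /andP[ca _].
  by rewrite /lam' (negPf ca).
rewrite (big_fsetD1 a)//= {1}/lam' eqxx scale0r add0r -[RHS]l1.
rewrite big_seq [RHS]big_seq; apply: eq_bigr => c; rewrite !inE => /andP[ca _].
by rewrite /lam' (negPf ca).
Qed.

(** In the order [[:: b, a & r]] the first chart coordinate runs along a - b and the others are the
    chart [b :: r] of the facet opposite to a. *)
Lemma facet_spans (K : simplex) a : simplex_full K -> a \in K ->
  exists b r, spans (b :: r) (K `\ a)%fset n /\ spans [:: b, a & r] K n.+1.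
Proof.
move=> fK Ka; have [cF _] := simplex_full_D1 fK Ka.
have [ue sz eK] := spans_enum cF; case: (enum_fset _) => [//|b r] in ue sz eK *.
exists b, r; split; first by split.
have ab : a \notin b :: r by rewrite eK !inE eqxx.
split.
- case/andP: ue => br ur; move: ab; rewrite inE negb_or => /andP[ab ar].
  by rewrite /= inE negb_or eq_sym ab br ar.
- by move: sz => /= [->].
- move=> x; have := eK x; rewrite !inE.
  case: (eqVneq x a) => [->|_] /= h; first by rewrite Ka orbT.
  by rewrite -h; case: (x == b).
Qed.

Definition is_normal (K : simplex) a (u : pt) :=
  [/\ dot u u = 1,
    forall x y, x \in (K `\ a)%fset -> y \in (K `\ a)%fset -> dot u (x - y) = 0 &
    forall x, x \in (K `\ a)%fset -> dot u (a - x) < 0].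

(** The [get] in [normal] is meaningful only once such a vector is known to exist. *)
Lemma is_normal_normal (K : simplex) a : simplex_full K -> a \in K ->
  is_normal K a (normal K a).
Proof.
move=> fK Ka; suff [u Hu] : exists u, is_normal K a u by exact: getI Hu.
have [b [r [spF spK]]] := facet_spans fK Ka.
set E := edges n (b :: r).
have Mu : (col_mx (a - b) E : 'M[R]_(1 + n)) \in unitmx.
  by rewrite -edges_cons; exact: edges_unit fK spK.
have [u u0 Eu] : exists2 u : 'rV[R]_(1 + n), u != 0 & E *m u^T = 0.
  (* The n edge vectors of the facet have a common nonzero orthogonal vector in dimension n + 1. *)
  have /rowV0Pn[u /sub_kermxP uE u0] : kermx E^T != 0.
    rewrite kermx_eq0 /row_free mxrank_tr; apply/eqP => h.
    by have := rank_leq_row E; rewrite h ltnn.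
  by exists u => //; rewrite -[E]trmxK -trmx_mul uE trmx0.
have inF x : x \in (K `\ a)%fset -> exists t, x = b + t *m E.
  move=> xF; case: (spF) => us sz eF; move: xF; rewrite -eF inE.
  case/predU1P => [->|xr]; first by exists 0; rewrite mul0mx addr0.
  have ixn : (index x r < n)%N by have := xr; rewrite -index_mem; case: sz => ->.
  exists (delta_mx 0 (Ordinal ixn)); rewrite -rowE rowK /= nth_index//.
  by rewrite addrC subrK.
have uE t : dot u (t *m E) = 0.
  by rewrite dotC dotE -mulmxA Eu mulmx0 mxE.
have u_ab : dot u (a - b) != 0.
  apply: contra u0 => /eqP uab.
  have : (col_mx (a - b) E : 'M[R]_(1 + n)) *m u^T = 0.
    rewrite mul_col_mx Eu (_ : (a - b) *m u^T = 0) ?col_mx0//.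
    by apply/matrixP => i j; rewrite !ord1 -dotE dotC uab mxE.
  by move/(congr1 (mulmx (invmx (col_mx (a - b) E : 'M[R]_(1 + n)))));
    rewrite mulKmx// mulmx0 => /(congr1 trmx); rewrite trmxK trmx0 => ->.
have uu : 0 < dot u u.
  by rewrite lt_neqAle dot_ge0 andbT eq_sym; apply: contra u0 => /eqP/dot_eq0 ->.
(* Normalises the length and turns the vector away from [a]. *)
pose c := - Num.sg (dot u (a - b)) / Num.sqrt (dot u u).
exists (c *: u); split.
- rewrite dotZl dotZr mulrA -expr2 /c exprMn sqrrN exprVn sqr_sqrtr ?ltW//.
  by rewrite sqr_sg u_ab mul1r mulVf// gt_eqF.
- move=> x y /inF[t ->] /inF[t' ->].
  by rewrite dotZl opprD addrACA subrr add0r dotBr !uE subrr mulr0.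
- move=> x /inF[t ->]; rewrite opprD addrA dotZl dotBr uE subr0 /c.
  rewrite mulrAC mulNr -normrEsg mulNr oppr_lt0 divr_gt0// ?sqrtr_gt0//.
  by rewrite normr_gt0.
Qed.

End facets.

Section divergence.
Context {R : realType} {n : nat}.
Local Notation pt := 'rV[R]_n.+1.
Local Notation simplex := (@simplex R n.+1).
Implicit Types (K F : simplex) (a b : pt).

(** One common tail [r] serves the charts of the simplex and of both facets that see the edge, so
    that their integrals can be compared coordinate by coordinate. *)
Lemma edge_spans K a b : simplex_full K -> a \in K -> b \in K -> a != b ->
  exists r, [/\ spans (b :: r) (K `\ a)%fset n, spans (a :: r) (K `\ b)%fset n,
    spans [:: b, a & r] K n.+1 & spans [:: a, b & r] K n.+1].
Proof.
move=> fK Ka Kb ab; have [cF _] := simplex_full_D1 fK Ka.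
pose F := (K `\ a `\ b)%fset; pose r := enum_fset F.
have rE x : (x \in r) = [&& x != b, x != a & x \in K].
  by rewrite /r -[x \in _]/(x \in F) !inE.
have ur : uniq r by exact: fset_uniq.
have sr : size r = n.
  have := cardfsD1 b (K `\ a)%fset; rewrite cF !inE eq_sym ab Kb /=.
  by rewrite add1n => -[<-].
have ar : a \notin r by rewrite rE eqxx andbF.
have br : b \notin r by rewrite rE eqxx.
exists r; split; split.
- by rewrite /= br.
- by rewrite /= sr.
- by move=> x; rewrite !in_cons rE ?inE; case: (eqVneq x b) => // ->; rewrite Kb eq_sym ab.
- by rewrite /= ar.
- by rewrite /= sr.
- by move=> x; rewrite !in_cons rE ?inE; case: (eqVneq x a) => // ->; rewrite Ka ab.
- by rewrite /= in_cons negb_or eq_sym ab br ar.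
- by rewrite /= sr.
- by move=> x; rewrite !in_cons rE ?inE; case: (eqVneq x b) => [->|_] //=;
    case: (eqVneq x a) => // ->.
- by rewrite /= in_cons negb_or ab br ar.
- by rewrite /= sr.
- by move=> x; rewrite !in_cons rE ?inE; case: (eqVneq x a) => [->|_] //=;
    rewrite ?andbT; case: (eqVneq x b) => // ->.
Qed.

Lemma det_height K a b r : simplex_full K -> a \in K ->
  spans (b :: r) (K `\ a)%fset n -> spans [:: b, a & r] K n.+1 ->
  `|\det (edges n.+1 [:: b, a & r])| =
    dot (b - a) (normal K a) * gram n (b :: r).
Proof.
move=> fK Ka spF spK; have [u1 uF ua] := is_normal_normal fK Ka; set u := normal K a in u1 uF ua *.
have := edges_unit fK spK; rewrite edges_cons => Mu.
rewrite (det_gram_height Mu u1); last first.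
  apply/row_matrixP => i; rewrite row0 row_mul rowK.
  apply/matrixP => j l; rewrite !ord1 -dotE dotC uF ?mxE//.
    exact: (spans_in spF (ltn_ord i)).
  exact: (spans_in spF (leq0n _)).
congr (_ * _); rewrite -normrN -dotNl opprB ger0_norm//.
rewrite -oppr_le0 -dotNl opprB dotC ltW// ua//.
exact: (spans_in spF (leq0n _)).
Qed.

Lemma Pk_chart d m k (p : 'rV[R]_d -> R) (s0 : 'rV[R]_d) (E : 'M[R]_(m, d)) :
  Pk k p -> Pk k (fun t => p (s0 + t *m E)).
Proof. by move=> Pp; under eq_fun do rewrite addrC; exact: Pk_comp_affine. Qed.

(** The slanted facet of the reference simplex is carried onto the facet opposite to b. *)
Lemma chart_opposite a b r (y : 'rV[R]_n) : size r = n ->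
  b + ((1 - \sum_i y 0 i) *: (a - b) + y *m edges n (b :: r)) =
  a + y *m edges n (a :: r).
Proof.
move=> sr; rewrite !row_mul_edges.
have E c : \sum_(i < n) y 0 i *: ((c :: r)`_i.+1 - (c :: r)`_0) =
    \sum_(i < n) y 0 i *: r`_i - (\sum_i y 0 i) *: c.
  by rewrite scaler_suml -sumrB; apply: eq_bigr => i _; rewrite /= scalerBr.
rewrite !E scalerBl scale1r scalerBr.
by rewrite !opprB !addrA; apply/rowP => i; rewrite !mxE; ring.
Qed.

Lemma surf_intZ F k c (p : pt -> R) : #|` F| = n.+1 ->
  affinely_independent F -> Pk k p ->
  surf_int F (fun x => c * p x) = c * surf_int F p.
Proof.
move=> cF aF Pp; have sp := spans_enum cF.
rewrite (surf_int_spans aF sp (PkZ c Pp)) (surf_int_spans aF sp Pp).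
rewrite (vol_intZ _ (@ref_simplex_mbounded _ _) (Pk_chart _ _ Pp)).
by rewrite mulrCA.
Qed.

(** In the chart [[:: b, a & r]] the direction b - a is minus the first axis, so [ref_int_derive]
    yields the two boundary integrals. [det_height] rewrites the Jacobian as height times surface
    element, once for each facet. *)
Lemma edge_divergence K a b k (p : pt -> R) : simplex_full K ->
  a \in K -> b \in K -> a != b -> Pk k p ->
  vol_int (hull K) (fun x => 'D_(b - a) p x) =
  dot (b - a) (normal K a) * surf_int (K `\ a)%fset p +
  dot (b - a) (normal K b) * surf_int (K `\ b)%fset p.
Proof.
move=> fK Ka Kb ab Pp; have [r [spa spb spK spK']] := edge_spans fK Ka Kb ab.
have [_ aFa] := simplex_full_D1 fK Ka; have [_ aFb] := simplex_full_D1 fK Kb.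
have db := det_height fK Kb spb spK'.
have da := det_height fK Ka spa spK.
(* Both enumerations compute the same volume of [K]. *)
have detE : `|\det (edges n.+1 [:: a, b & r])| = `|\det (edges n.+1 [:: b, a & r])|.
  have := vol_int_simplex fK spK (Pk_cst _ 0%N 1).
  rewrite (vol_int_simplex fK spK' (Pk_cst _ 0%N 1)).
  by apply: mulIf; rewrite gt_eqF// ref_volume_gt0.
have key (c g D V : R) : D = c * g -> c * (g * V) = D * V.
  by move=> ->; rewrite mulrA.
rewrite (surf_int_spans aFa spa Pp) (surf_int_spans aFb spb Pp).
move: (normal K a) (normal K b) da db => na nb da db.
rewrite (key _ _ _ _ da).
have -> : b - a = - (a - b) by rewrite opprB.
rewrite dotNl mulNr (key _ _ _ _ db) detE.
rewrite (vol_int_simplex fK spK (Pk_derive _ Pp)) -mulrBr; congr (_ * _).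
rewrite /=; pose P x := p (b + x *m edges n.+1 [:: b, a & r]).
have PP : Pk k P by exact: Pk_chart.
transitivity (- vol_int (@ref_simplex R n.+1) (fun x => 'D_(rve0 n) P x)).
  rewrite -mulN1r -(vol_intZ _ (@ref_simplex_mbounded _ _) (Pk_derive _ PP)).
  apply: eq_vol_int => x _.
  set y := b + _.
  have [q hq] := Pk_line y (a - b) Pp.
  have := derivative_line 0 Pp hq; rewrite scale0r addr0.
  have hq' t : P (x + t *: rve0 n) = q.[t].
    rewrite /P mulmxDl -scalemxAl chart_cons scale1r mul0mx addr0 addrA.
    exact: hq.
  have := derivative_line 0 PP hq'; rewrite scale0r addr0 => -> <-.
  have := derive_lincomb y [:: tt] (fun=> -1) (fun=> a - b) Pp.
  by rewrite !big_seq1 scaleN1r.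
rewrite (ref_int_derive PP).
have sr : size r = n by case: spa => _ [].
have mref := @ref_simplex_mbounded R n.
have Pa : Pk k (fun y => p (a + y *m edges n (a :: r))) by exact: Pk_chart.
have Pb : Pk k (fun y => p (b + y *m edges n (b :: r))) by exact: Pk_chart.
rewrite -mulN1r -(vol_intZ _ mref Pa) -(vol_intD mref Pb (PkZ _ Pa)).
have -> : (fun s : 'rV[R]_n => P (rvcons (1 - \sum_i s 0 i) s) - P (rvcons 0 s)) =
    (fun s : 'rV[R]_n => p (a + s *m edges n (a :: r)) + (-1) * p (b + s *m edges n (b :: r))).
  apply/funext => s; rewrite /P !chart_cons scale0r add0r mulN1r.
  by rewrite chart_opposite.
have e := vol_intZ (-1) mref (PkD Pa (PkZ (-1) Pb)).
apply: etrans (esym (etrans e (mulN1r _))) _.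
by apply: eq_vol_int => y _; ring.
Qed.

End divergence.

Local Opaque normal.

(** * Barycentric coordinates *)

Section barycentric.
Context {R : realType} {n : nat}.
Local Notation pt := 'rV[R]_n.+1.
Local Notation simplex := (@simplex R n.+1).
Implicit Types (K F G : simplex) (a b x y v : pt).

(** The derivative of the barycentric coordinate of a in the direction v. *)
Definition slope K a v : R :=
  dot (normal K a) v / dot (normal K a) (a - (enum_fset (K `\ a)%fset)`_0).

(** Encoded as the height over the facet opposite to a, normalised to 1 at a, which makes it an
    affine function on the whole space. *)
Definition bary K a x : R := slope K a (x - (enum_fset (K `\ a)%fset)`_0).

Lemma slopeD K a v w : slope K a (v + w) = slope K a v + slope K a w.
Proof. by rewrite /slope dotDr mulrDl. Qed.

Lemma slopeZ K a c v : slope K a (c *: v) = c * slope K a v.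
Proof. by rewrite /slope dotZr mulrA. Qed.

Lemma baryD K a x v : bary K a (x + v) = bary K a x + slope K a v.
Proof. by rewrite /bary -slopeD addrAC. Qed.

Lemma slopeB K a x y : slope K a (x - y) = bary K a x - bary K a y.
Proof. by apply/eqP; rewrite eq_sym subr_eq addrC -baryD subrKC. Qed.

Lemma bary_line K a x y t :
  bary K a (x + t *: (y - x)) = (1 - t) * bary K a x + t * bary K a y.
Proof. by rewrite baryD slopeZ slopeB; ring. Qed.

Lemma Pk_bary K a : Pk 1 (bary K a).
Proof.
rewrite (_ : bary K a = fun x => bary K a 0 + slope K a x).
  apply: PkD; first exact: Pk_cst.
  by rewrite /slope; under eq_fun do rewrite mulrC; apply: PkZ; exact: Pk_dot.
by apply/funext => x; rewrite -baryD add0r.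
Qed.

Lemma bary_continuous K a : continuous (bary K a).
Proof. exact: Pk_continuous (Pk_bary K a). Qed.

Section full.
Variable K : simplex.
Hypothesis fK : simplex_full K.

Lemma base_in a : a \in K -> (enum_fset (K `\ a)%fset)`_0 \in (K `\ a)%fset.
Proof.
move=> Ka; have [cF _] := simplex_full_D1 fK Ka.
exact: (spans_in (spans_enum cF) (leq0n n)).
Qed.

Lemma bary_self a : a \in K -> bary K a a = 1.
Proof.
move=> Ka; have [_ _ /(_ _ (base_in Ka))] := is_normal_normal fK Ka.
by rewrite /bary /slope => h; rewrite divff// lt_eqF.
Qed.

Lemma bary_other a b : a \in K -> b \in K -> b != a -> bary K a b = 0.
Proof.
move=> Ka Kb ba; have [_ h _] := is_normal_normal fK Ka.
by rewrite /bary /slope h ?mul0r// ?base_in// !inE ba.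
Qed.

Lemma slope_lt0 a : a \in K ->
  dot (normal K a) (a - (enum_fset (K `\ a)%fset)`_0) < 0.
Proof. by move=> Ka; have [_ _ /(_ _ (base_in Ka))] := is_normal_normal fK Ka. Qed.

Lemma slope_normal_neq0 a : a \in K -> slope K a (normal K a) != 0.
Proof.
move=> Ka; have [n1 _ _] := is_normal_normal fK Ka.
by rewrite /slope n1 mul1r invr_eq0 lt_eqF// slope_lt0.
Qed.

Lemma bary_affcomb a (lam : pt -> R) : a \in K -> \sum_(b <- K) lam b = 1 ->
  bary K a (\sum_(b <- K) lam b *: b) = lam a.
Proof.
move=> Ka l1.
(* For weights of arbitrary sum an affine function needs the correction by its value at 0; this form
   is open to induction on the list. *)
suff H (r : seq pt) : bary K a (\sum_(b <- r) lam b *: b) =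
    \sum_(b <- r) lam b * bary K a b + (1 - \sum_(b <- r) lam b) * bary K a 0.
  rewrite H l1 subrr mul0r addr0 (big_fsetD1 a)//= bary_self// mulr1.
  rewrite big_seq big1 ?addr0// => b; rewrite !inE => /andP[ba Kb].
  by rewrite bary_other// mulr0.
elim: r => [|b r IH]; first by rewrite !big_nil subr0 mul1r add0r.
rewrite !big_cons addrC baryD IH slopeZ -[X in slope K a X]subr0 slopeB.
ring.
Qed.

Lemma affine_span x : exists lam : pt -> R,
  \sum_(b <- K) lam b = 1 /\ x = \sum_(b <- K) lam b *: b.
Proof.
have [s sp] := full_spans fK; have Eu := edges_unit fK sp.
pose t := (x - s`_0) *m invmx (edges n.+1 s).
have xE : x = s`_0 + t *m edges n.+1 s by rewrite /t mulmxKV// subrKC.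
have [lam [l0 lS]] := spans_weights (1 - \sum_i t 0 i) t sp.
exists lam; split.
  rewrite (big_spans _ sp) l0 -[RHS](subrK (\sum_i t 0 i)); congr (_ + _).
  by apply: eq_bigr => i _; rewrite lS.
rewrite {1}xE (big_spans _ sp) l0 chart_sum; congr (_ + _).
by apply: eq_bigr => i _; rewrite lS.
Qed.

Lemma bary_sum x : \sum_(a <- K) bary K a x = 1.
Proof.
have [lam [l1 ->]] := affine_span x; rewrite -[RHS]l1.
by rewrite big_seq [RHS]big_seq; apply: eq_bigr => a Ka; rewrite bary_affcomb.
Qed.

Lemma bary_comb x : x = \sum_(a <- K) bary K a x *: a.
Proof.
have [lam [l1 xE]] := affine_span x; rewrite {1}xE.
rewrite big_seq [RHS]big_seq; apply: eq_bigr => a Ka.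
by rewrite xE bary_affcomb.
Qed.

Lemma hull_bary x : hull K x <-> forall a, a \in K -> 0 <= bary K a x.
Proof.
split=> [[lam [l0 l1 ->]] a Ka|h]; first by rewrite bary_affcomb// l0.
by exists (bary K ^~ x); split=> //; [exact: bary_sum|exact: bary_comb].
Qed.

(** By uniqueness of barycentric coordinates: the weights on the vertices of [G], extended by 0, are
    the coordinates with respect to [K]. *)
Lemma hull_face_bary G x : (G `<=` K)%fset ->
  hull G x <-> hull K x /\ forall a, a \in K -> a \notin G -> bary K a x = 0.
Proof.
move=> GK; have sub (V : zmodType) (F : pt -> V) :
    (forall a, a \in K -> a \notin G -> F a = 0) ->
    \sum_(a <- K) F a = \sum_(a <- G) F a.
  move=> F0; rewrite (bigID (fun a => a \in G)) /= [X in _ + X]big_seq_cond.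
  rewrite [X in _ + X]big1 ?addr0; last by move=> a /andP[/F0].
  rewrite -big_filter; apply: perm_big; apply: uniq_perm.
  - exact/filter_uniq/fset_uniq.
  - exact: fset_uniq.
  - by move=> a; rewrite mem_filter andbC; case aG: (a \in G);
      rewrite ?andbF// (fsubsetP GK).
split=> [[lam [l0 l1 ->]]|[Kx G0]].
  pose lam' a := if a \in G then lam a else 0.
  have e1 : \sum_(a <- K) lam' a = 1.
    rewrite sub; last by move=> a _ /negPf aG; rewrite /lam' aG.
    by rewrite -[RHS]l1 big_seq [RHS]big_seq; apply: eq_bigr => a aG; rewrite /lam' aG.
  have e2 : \sum_(a <- G) lam a *: a = \sum_(a <- K) lam' a *: a.
    rewrite sub; last by move=> a _ /negPf aG; rewrite /lam' aG scale0r.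
    by rewrite big_seq [RHS]big_seq; apply: eq_bigr => a aG; rewrite /lam' aG.
  rewrite e2; split.
    apply/hull_bary => a Ka; rewrite bary_affcomb// /lam'.
    by case: ifP => // /l0.
  by move=> a Ka /negPf aG; rewrite bary_affcomb// /lam' aG.
exists (bary K ^~ x); split.
- by move=> a aG; apply: (hull_bary x).1 => //; exact: (fsubsetP GK).
- by rewrite -[RHS](bary_sum x) sub.
- by rewrite {1}[x]bary_comb sub// => a Ka aG; rewrite G0// scale0r.
Qed.

Lemma hull_facet_bary a x : a \in K ->
  hull (K `\ a)%fset x -> bary K a x = 0 /\ hull K x.
Proof.
move=> Ka /(hull_face_bary x (fsubD1set K a)) [Kx h]; split=> //.
by apply: h => //; rewrite !inE eqxx.
Qed.

Definition open_simplex : set pt := [set x | forall a, a \in K -> 0 < bary K a x].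

Lemma open_simplex_hull x : open_simplex x -> hull K x.
Proof. by move=> h; apply/hull_bary => a Ka; rewrite ltW// h. Qed.

Lemma open_open_simplex : open open_simplex.
Proof.
(* Openness of a finite intersection, by induction on the list of vertices. *)
suff H (r : seq pt) : open [set x | forall a, a \in r -> 0 < bary K a x].
  exact: H (enum_fset K).
elim: r => [|b r IH].
  by rewrite (_ : [set _ | _] = setT); [exact: openT|apply/seteqP; split].
rewrite (_ : [set _ | _] = (bary K b @^-1` [set r | 0 < r]) `&`
    [set x | forall a, a \in r -> 0 < bary K a x]).
  apply: openI => //; apply: open_comp; last exact: open_gt.
  by move=> y _; exact: bary_continuous.
apply/seteqP; split=> [x h|x [hb h] a].
  by split=> [|a ar]; apply: h; rewrite in_cons ?eqxx// ar orbT.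
by rewrite in_cons => /predU1P[->|/h].
Qed.

(** A full simplex in dimension n + 1 has n + 2 vertices. *)
Definition barycenter : pt := \sum_(a <- K) (n.+2%:R^-1 : R) *: a.

Lemma bary_barycenter a : a \in K -> bary K a barycenter = n.+2%:R^-1.
Proof.
move=> Ka; rewrite /barycenter (bary_affcomb (lam := fun=> _))//.
rewrite big_const_seq count_predT -[size _]/(#|` K|) fK.1 iter_addr addr0.
by rewrite -[_ *+ _]mulr_natl divff// pnatr_eq0.
Qed.

Lemma open_simplex_barycenter : open_simplex barycenter.
Proof. by move=> a Ka; rewrite bary_barycenter// invr_gt0. Qed.

Lemma hull_box : exists c r, 0 < r /\ box c r `<=` hull K.
Proof.
exists barycenter; have /nbhs_ballP[e /= e0 H] : nbhs barycenter open_simplex.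
  by apply: open_nbhs_nbhs; split; [exact: open_open_simplex|exact: open_simplex_barycenter].
exists (e / 2); split; first by rewrite divr_gt0.
move=> x bx; apply/open_simplex_hull/H; split=> [//|i j]; rewrite ord1.
rewrite -ball_normE /= distrC (le_lt_trans (bx j))//.
by rewrite ltr_pdivrMr// ltr_pMr// ltr1n.
Qed.

Lemma hull_int_eq0 k (p : pt -> R) : Pk k p -> (forall x, hull K x -> 0 <= p x) ->
  vol_int (hull K) p = 0 -> forall x, p x = 0.
Proof.
move=> Pp p0 i0; have [c [r [r0 cr]]] := hull_box.
exact: vol_int_eq0_everywhere (hull_mbounded fK) Pp p0 r0 cr i0.
Qed.

Lemma poly_zero_hull k (p : pt -> R) : Pk k p ->
  (forall x, hull K x -> p x = 0) -> forall x, p x = 0.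
Proof.
move=> Pp h; apply: (poly_zero_open Pp open_open_simplex).
  by exists barycenter; exact: open_simplex_barycenter.
by move=> x /open_simplex_hull/h.
Qed.

End full.
End barycentric.

Section surface.
Context {R : realType} {n : nat}.
Local Notation pt := 'rV[R]_n.+1.
Local Notation simplex := (@simplex R n.+1).
Variable F : simplex.
Hypotheses (cF : #|` F| = n.+1) (aF : affinely_independent F).
Let sp := spans_enum cF.
Implicit Types p q : pt -> R.

Lemma surf_int_eq p q : (forall x, hull F x -> p x = q x) ->
  surf_int F p = surf_int F q.
Proof.
move=> pq; rewrite /surf_int; congr (_ * _); apply: eq_vol_int => t rt.
have sz : size (enum_fset F) = n.+1 by case: sp.
apply: pq; move: t rt; rewrite -/(edges _ _) sz /= => t rt.
by rewrite (hull_chart sp); exists t.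
Qed.

Lemma surf_int_ge0 p : (forall x, hull F x -> 0 <= p x) -> 0 <= surf_int F p.
Proof.
move=> p0; rewrite /surf_int mulr_ge0 ?sqrtr_ge0// vol_int_ge0// => t rt.
have sz : size (enum_fset F) = n.+1 by case: sp.
apply: p0; move: t rt; rewrite -/(edges _ _) sz /= => t rt.
by rewrite (hull_chart sp); exists t.
Qed.

Lemma surf_int0 : surf_int F (fun=> 0) = 0.
Proof.
rewrite (surf_int_spans aF sp (Pk_cst _ 0%N 0)).
by rewrite /vol_int Rintegral_cst ?mul0r ?mulr0//; exact: (ref_simplex_mbounded _).1.
Qed.

Lemma surf_intD k l p q : Pk k p -> Pk l q ->
  surf_int F (fun x => p x + q x) = surf_int F p + surf_int F q.
Proof.
move=> Pp Pq.
have Ppq : Pk (maxn k l) (fun x => p x + q x).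
  by apply: PkD; [apply: Pk_leq Pp|apply: Pk_leq Pq]; rewrite ?leq_maxl ?leq_maxr.
rewrite (surf_int_spans aF sp Ppq) (surf_int_spans aF sp Pp).
rewrite (surf_int_spans aF sp Pq) -mulrDr; congr (_ * _).
exact: (vol_intD (ref_simplex_mbounded _) (Pk_chart _ _ Pp) (Pk_chart _ _ Pq)).
Qed.

Lemma surf_int_le k l p q : Pk k p -> Pk l q ->
  (forall x, hull F x -> p x <= q x) -> surf_int F p <= surf_int F q.
Proof.
move=> Pp Pq pq; rewrite -subr_ge0 -mulN1r -(surf_intZ _ cF aF Pp).
rewrite -(surf_intD Pq (PkZ (-1) Pp)) surf_int_ge0// => x Fx.
by rewrite mulN1r subr_ge0 pq.
Qed.

Lemma surf_int_sum I (r : seq I) k (p : I -> pt -> R) :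
  (forall i, Pk k (p i)) ->
  surf_int F (fun x => \sum_(i <- r) p i x) = \sum_(i <- r) surf_int F (p i).
Proof.
move=> Pp; elim: r => [|i r IH].
  by rewrite big_nil; under eq_fun do rewrite big_nil; exact: surf_int0.
rewrite big_cons -IH -(surf_intD (Pp i) (Pk_sum _ (fun j _ => Pp j))).
by congr (surf_int _ _); apply/funext => x; rewrite big_cons.
Qed.

End surface.

Section facet_surface.
Context {R : realType} {n : nat}.
Local Notation pt := 'rV[R]_n.+1.

(** The nonzero volume factor of [K] is the height times the Gram factor. *)
Lemma facet_gram (K : @simplex R n.+1) a : simplex_full K -> a \in K ->
  exists s, spans s (K `\ a)%fset n /\ 0 < gram n s.
Proof.
move=> fK Ka; have [b [r [spF spK]]] := facet_spans fK Ka.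
exists (b :: r); split=> //; rewrite lt_neqAle sqrtr_ge0 andbT eq_sym.
have := edges_unit fK spK; rewrite unitmxE unitfE -normr_eq0.
by rewrite (det_height fK Ka spF spK) mulf_eq0 negb_or => /andP[].
Qed.

(** The pull-back of [p] to the facet chart vanishes identically, which gives zeros on the facet and
    not off its plane. *)
Lemma surf_int_eq0 (K : @simplex R n.+1) a k (p : pt -> R) :
  simplex_full K -> a \in K -> Pk k p ->
  (forall x, hull (K `\ a)%fset x -> 0 <= p x) ->
  surf_int (K `\ a)%fset p = 0 -> forall x, hull (K `\ a)%fset x -> p x = 0.
Proof.
move=> fK Ka Pp p0; have [s [sp g0]] := facet_gram fK Ka.
have [_ aF] := simplex_full_D1 fK Ka.
rewrite (surf_int_spans aF sp Pp) => /eqP; rewrite mulf_eq0 gt_eqF//= => /eqP int0 x.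
rewrite (hull_chart sp) => -[t rt <-].
apply: (ref_int_eq0 (Pk_chart _ _ Pp) _ int0) => y ry.
by apply: p0; rewrite (hull_chart sp); exists y.
Qed.

End facet_surface.

(** * Pressures determined on one element *)

Section local_pressure.
Context {R : realType} {n : nat}.
Local Notation pt := 'rV[R]_n.+1.
Local Notation simplex := (@simplex R n.+1).

Lemma divv_scale k (g : pt -> R) (t : pt) x : Pk k g ->
  divv (fun y => g y *: t) x = 'D_t g x.
Proof.
move=> Pg; rewrite [t in RHS]row_sum_delta (derive_lincomb _ _ _ _ Pg).
rewrite /divv /mxtrace; apply: eq_bigr => i _; rewrite mxE.
under eq_fun do rewrite mxE mulrC.
exact: Pk_deriveZ Pg.
Qed.

Lemma poly_vec_scale k (g : pt -> R) (t : pt) : Pk k g ->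
  poly_vec k (fun y => g y *: t).
Proof.
by move=> Pg i; under eq_fun do rewrite mxE mulrC; exact: PkZ.
Qed.

Variable K : simplex.
Hypothesis fK : simplex_full K.

Lemma normal_edge0 a b c : c \in K -> a \in K -> b \in K -> a != c -> b != c ->
  dot (b - a) (normal K c) = 0.
Proof.
move=> Kc Ka Kb ac bc; have [_ h _] := is_normal_normal fK Kc.
by rewrite dotC h// !inE ?ac ?bc.
Qed.

Lemma normal_edge_gt0 a b : a \in K -> b \in K -> b != a ->
  0 < dot (b - a) (normal K a).
Proof.
move=> Ka Kb ba; have [_ _ h] := is_normal_normal fK Ka.
by rewrite dotC -[b - a]opprB dotNr oppr_gt0 h// !inE ba.
Qed.

Let spF a (Ka : a \in K) := simplex_full_D1 fK Ka.

Lemma directions_zero k (p : pt -> R) : Pk k p ->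
  (forall a b, a \in K -> b \in K -> a != b -> forall x, 'D_(b - a) p x = 0) ->
  exists c, p = fun=> c.
Proof.
move=> Pp p0.
have D0 v x : 'D_v p x = 0.
  have [|[a Ka]] := fset_0Vmem K; first by move=> K0; have := fK.1; rewrite K0 cardfs0.
  (* The edges issuing from one vertex span the space. *)
  have vE : v = \sum_(b <- K) bary K b (a + v) *: (b - a).
    under eq_bigr do rewrite scalerBr.
    by rewrite sumrB -bary_comb// -scaler_suml bary_sum// scale1r addrC addKr.
  rewrite vE (derive_lincomb _ _ _ _ Pp) big_seq big1// => b Kb.
  have [->|ba] := eqVneq a b; last by rewrite p0// mulr0.
  by rewrite subrr deriveE ?linear0 ?mulr0//; exact: Pk_differentiable Pp.
exists (p 0); apply/funext => x; have [q hq] := Pk_line 0 x Pp.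
have q0 t : q^`().[t] = 0 by rewrite -(derivative_line t Pp hq).
have := FTC_poly q (ler01 : 0 <= 1 :> R).
under eq_integral do rewrite q0.
rewrite integral0 => -[/eqP]; rewrite eq_sym subr_eq0 -!hq scale1r scale0r.
by rewrite add0r addr0 => /eqP.
Qed.

(** On the facet x is the combination of the vertices with weights [bary K b x], which sum to 1.
    Inserting both facts in e = c + sum x_i q_i gives r_b = c + sum b_i q_i, of degree one less than
    [e]. *)
Lemma facet_decomposition k a (e : pt -> R) : a \in K -> Pk k.+1 e ->
  exists r : pt -> pt -> R, (forall b, Pk k (r b)) /\
    forall x, hull (K `\ a)%fset x ->
      e x = \sum_(b <- (K `\ a)%fset) bary K b x * r b x.
Proof.
move=> Ka /Pk_dec[c [q [Pq ->]]].
exists (fun b x => c + \sum_i b 0 i * q i x); split=> [b|x Fx].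
  apply: PkD; first exact: Pk_cst.
  by apply: Pk_sum => i _; exact: PkZ.
have [x0 _] := hull_facet_bary fK Ka Fx.
transitivity (\sum_(b <- K) bary K b x * (c + \sum_i b 0 i * q i x)); last first.
  by rewrite (big_fsetD1 a)//= x0 mul0r add0r.
under [RHS]eq_bigr do rewrite mulrDr mulr_sumr.
rewrite big_split /= -mulr_suml bary_sum// mul1r; congr (_ + _).
rewrite exchange_big /=; apply: eq_bigr => i _.
under [RHS]eq_bigr do rewrite mulrA.
rewrite -mulr_suml; congr (_ * _).
rewrite {1}(bary_comb fK x) summxE; apply: eq_bigr => b _.
by rewrite mxE.
Qed.

Variables (k : nat) (p : pt -> R) (pb : pt -> pt -> R).
Hypotheses (k1 : (1 <= k)%N) (Pp : Pk k.-1 p).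
Hypothesis Ppb : forall a, a \in K -> Pk k (pb a).
Hypothesis orth : forall w : pt -> pt, poly_vec k w ->
  - vol_int (hull K) (fun x => p x * divv w x) +
  \sum_(a <- K) surf_int (K `\ a)%fset
    (fun x => pb a x * dot (w x) (normal K a)) = 0.

(* For w along the edge from a to b, only the facets opposite to a and b see a
   nonzero normal component. *)
Let orth_edge a b (g : pt -> R) : a \in K -> b \in K -> a != b -> Pk k g ->
  (forall x, hull (K `\ b)%fset x -> g x = 0) ->
  vol_int (hull K) (fun x => p x * 'D_(b - a) g x) =
  dot (b - a) (normal K a) * surf_int (K `\ a)%fset (fun x => pb a x * g x).
Proof.
move=> Ka Kb ab Pg gb0.
have := orth (poly_vec_scale (b - a) Pg).
rewrite (eq_vol_int (q := fun x => p x * 'D_(b - a) g x)); last first.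
  by move=> x _; rewrite (divv_scale _ _ Pg).
move/eqP; rewrite addrC subr_eq0 => /eqP <-.
rewrite (big_fsetD1 a)//= big_seq big1 ?addr0; last first.
  move=> c; rewrite !inE => /andP[ca Kc].
  have [cFc aFc] := spF Kc.
  rewrite (surf_int_eq cFc (q := fun=> 0)) ?surf_int0// => x Fx.
  rewrite dotZl; have [cb|cb] := eqVneq c b.
    by rewrite gb0 ?mul0r ?mulr0// -cb.
  by rewrite normal_edge0// ?mulr0// eq_sym.
have [cFa aFa] := spF Ka.
rewrite -(surf_intZ _ cFa aFa (PkM (Ppb Ka) Pg)).
by congr (surf_int _ _); apply/funext => x; rewrite dotZl; ring.
Qed.

(** For k >= 2 the product lam_a lam_b (D_t p) has degree at most (k - 2) + 2, so it is admissible
    in the test, and it vanishes on both facets that see the edge. Integration by parts then leaves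
    the integral of lam_a lam_b (D_t p)^2. *)
Lemma pressure_const : exists c, p = fun=> c.
Proof.
case: k k1 Pp Ppb orth_edge => [//|[|l]] _ /= Pp' Ppb' oe; first exact: Pk0_cst.
apply: (directions_zero Pp') => a b Ka Kb ab.
have Pr : Pk l (fun x => 'D_(b - a) p x) := Pk_derive _ Pp'.
have [r rE] : exists r, forall x, 'D_(b - a) p x = r x by eexists.
have {}Pr : Pk l r by rewrite (_ : r = (fun x => 'D_(b - a) p x))//; apply/funext.
have Pm := PkM (Pk_bary K a) (Pk_bary K b).
have [g gE] : exists g, forall x, g x = bary K a x * bary K b x * r x by eexists.
have Pg : Pk l.+2 g.
  rewrite (_ : g = fun x => bary K a x * bary K b x * r x); first exact: PkM Pm Pr.
  exact/funext.
have gb x : hull (K `\ b)%fset x -> g x = 0.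
  by move=> /(hull_facet_bary fK Kb)[h _]; rewrite gE h mulr0 mul0r.
have ga x : hull (K `\ a)%fset x -> g x = 0.
  by move=> /(hull_facet_bary fK Ka)[h _]; rewrite gE h !mul0r.
have [cFa aFa] := spF Ka; have [cFb aFb] := spF Kb.
have := oe a b g Ka Kb ab Pg gb.
rewrite [X in _ * X](_ : _ = 0) ?mulr0; last first.
  by rewrite (surf_int_eq cFa (q := fun=> 0)) ?surf_int0// => x /ga ->; rewrite mulr0.
move=> int1.
have Ppg := PkM Pp' Pg.
have za : surf_int (K `\ a)%fset (fun x => p x * g x) = 0.
  by rewrite (surf_int_eq cFa (q := fun=> 0)) ?surf_int0// => x /ga ->; rewrite mulr0.
have zb : surf_int (K `\ b)%fset (fun x => p x * g x) = 0.
  by rewrite (surf_int_eq cFb (q := fun=> 0)) ?surf_int0// => x /gb ->; rewrite mulr0.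
have e0 (u v : R) : u * 0 + v * 0 = 0 by rewrite !mulr0 addr0.
have := edge_divergence fK Ka Kb ab Ppg; rewrite za zb e0.
rewrite (eq_vol_int (q := fun x => r x * g x + p x * 'D_(b - a) g x)); last first.
  by move=> x _; rewrite (Pk_deriveM _ _ Pp' Pg) rE.
rewrite (vol_intD (hull_mbounded fK) (PkM Pr Pg) (PkM Pp' (Pk_derive (b - a) Pg))).
rewrite int1 addr0 => int2.
have rg0 := hull_int_eq0 fK (PkM Pr Pg) _ int2.
have {}rg0 x : r x * g x = 0.
  apply: rg0 => y /(hull_bary fK) Ky.
  have h (u v : R) : 0 <= u -> 0 <= u * (v * v).
    by move=> u0; rewrite mulr_ge0// -expr2 sqr_ge0.
  by rewrite gE mulrCA; apply/h/mulr_ge0; exact: Ky.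
move=> x; rewrite rE; apply: (poly_zero_open Pr (@open_open_simplex _ _ K)).
  by exists (barycenter K); exact: open_simplex_barycenter.
(* In the open simplex the positive factors lam_a and lam_b can be cancelled. *)
have h (u v w : R) : 0 < u -> 0 < v -> w * (u * v * w) = 0 -> w = 0.
  move=> u0 v0 e; have uv0 := lt0r_neq0 (mulr_gt0 u0 v0).
  apply/eqP; rewrite -[_ == 0]orbb -mulf_eq0; apply/eqP/(mulfI uv0).
  by rewrite mulr0 -[RHS]e; ring.
by move=> y oy; apply: (h _ _ _ (oy a Ka) (oy b Kb)); rewrite -gE.
Qed.

(** With p = c, the edge identity makes e = pb - c orthogonal on the facet to each lam_b r_b with b
    in the facet. By [facet_decomposition] these add up to e itself, so the integral of e^2 is 0. *)
Lemma facet_pressure a x : a \in K -> hull (K `\ a)%fset x -> pb a x = p x.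
Proof.
move=> Ka Fx; have [c pE] := pressure_const.
have [cFa aFa] := spF Ka.
case: k k1 Ppb orth_edge => [//|l] _ Ppb' oe.
pose e y := pb a y - c.
have Pe : Pk l.+1 e by apply: PkD; [exact: Ppb'|exact: Pk_cst].
have [r [Pr er]] := facet_decomposition Ka Pe.
have er0 b : b \in (K `\ a)%fset ->
    surf_int (K `\ a)%fset (fun y => e y * (bary K b y * r b y)) = 0.
  rewrite !inE => /andP[ba Kb]; rewrite eq_sym in ba.
  have [g gE] : exists g, g = fun y => bary K b y * r b y by eexists.
  have Pg : Pk l.+1 g by rewrite gE; exact: PkM (Pk_bary K b) (Pr b).
  have gb y : hull (K `\ b)%fset y -> g y = 0.
    by move=> /(hull_facet_bary fK Kb)[h _]; rewrite gE h mul0r.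
  have := oe a b g Ka Kb ba Pg gb.
  rewrite pE (vol_intZ _ (hull_mbounded fK) (Pk_derive (b - a) Pg)).
  rewrite (edge_divergence fK Ka Kb ba Pg).
  have [cFb aFb] := spF Kb.
  have zb : surf_int (K `\ b)%fset g = 0.
    by rewrite (surf_int_eq cFb (q := fun=> 0))// surf_int0.
  have e1 (u v w : R) : u * w + v * 0 = u * w by rewrite mulr0 addr0.
  rewrite zb e1.
  have d0 : dot (b - a) (normal K a) != 0.
    by rewrite gt_eqF// normal_edge_gt0// eq_sym.
  rewrite mulrCA => /(mulfI d0) h.
  rewrite (surf_int_eq cFa (q := fun y => pb a y * g y + - c * g y)); last first.
    by move=> y _; rewrite gE /e mulrBl mulNr.
  rewrite (surf_intD cFa aFa (PkM (Ppb' a Ka) Pg) (PkZ (- c) Pg)).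
  by rewrite (surf_intZ _ cFa aFa Pg) -h mulNr subrr.
apply/eqP; rewrite -subr_eq0 pE -/(e x) -sqrf_eq0 expr2; apply/eqP.
apply: (surf_int_eq0 fK Ka (PkM Pe Pe) _ _ Fx) => [y _|].
  by rewrite -expr2 sqr_ge0.
rewrite (surf_int_eq cFa
  (q := fun y => \sum_(b <- (K `\ a)%fset) e y * (bary K b y * r b y))); last first.
  by move=> y Fy; rewrite {2}er// mulr_sumr.
have Ps b : Pk (l.+1 + l.+1) (fun y => e y * (bary K b y * r b y)).
  by apply: PkM => //; exact: (PkM (Pk_bary K b) (Pr b)).
rewrite (surf_int_sum cFa aFa _ Ps).
by rewrite big_seq big1// => b bF; rewrite er0.
Qed.

End local_pressure.

(** * Discrete trace inequality *)

Section psd_forms.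
Context {R : realType}.

(** Fredholm alternative: the row space of a symmetric matrix is the orthogonal complement of its
    kernel. *)
Lemma symmetric_solve N (A : 'M[R]_N) (l : 'rV[R]_N) : A^T = A ->
  (forall x : 'rV[R]_N, x *m A = 0 -> x *m l^T = 0) -> exists y, y *m A = l.
Proof.
move=> sA kerl; suff /submxP[y ->] : (l <= A)%MS by exists y.
rewrite submxE; apply/eqP; set C := cokermx A.
have CA : C^T *m A = 0 by rewrite -{1}sA -trmx_mul mulmx_coker trmx0.
apply: trmx_inj; rewrite trmx0 trmx_mul; apply/row_matrixP => i.
by rewrite row_mul row0 kerl// -row_mul CA row0.
Qed.

Definition psd_form (V : lmodType R) (B : V -> V -> R) :=
  [/\ forall x y, B x y = B y x, forall a x y, B (a *: x) y = a * B x y,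
      forall x y z, B (x + y) z = B x z + B y z & forall x, 0 <= B x x].

Section forms.
Variables (V : lmodType R) (B : V -> V -> R).
Hypothesis hB : psd_form B.
Let symB x y : B x y = B y x. Proof. by case: hB. Qed.
Let BZ a x y : B (a *: x) y = a * B x y. Proof. by case: hB. Qed.
Let BD x y z : B (x + y) z = B x z + B y z. Proof. by case: hB. Qed.
Let B_ge0 x : 0 <= B x x. Proof. by case: hB. Qed.

Lemma formN x y : B (- x) y = - B x y.
Proof. by rewrite -scaleN1r BZ mulN1r. Qed.

Lemma form_sum I (r : seq I) (F : I -> V) y :
  B (\sum_(i <- r) F i) y = \sum_(i <- r) B (F i) y.
Proof.
elim: r => [|i r IH]; last by rewrite !big_cons BD IH.
by rewrite !big_nil -(scale0r 0) BZ mul0r.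
Qed.

(** Degenerate Cauchy-Schwarz inequality: otherwise B (t x + y) (t x + y) would be affine in t with
    nonzero slope, hence negative somewhere. *)
Lemma form_null x y : B x x = 0 -> B x y = 0.
Proof.
move=> x0; apply/eqP; apply: contraT => xy.
have H t : 0 <= B y y + t * B x y *+ 2.
  have := B_ge0 (t *: x + y).
  rewrite BD BZ symB BD BZ x0 mulr0 add0r [B y (t *: x + y)]symB BD BZ.
  by rewrite [B y x]symB mulr2n; lra.
have := H (- (B y y + 1) / B x y).
by rewrite divfK// mulr2n; have := B_ge0 y; lra.
Qed.

Lemma form_square x y : B (x + y) (x + y) = B x x + B x y *+ 2 + B y y.
Proof.
by rewrite BD [B x _]symB [B y (_ + _)]symB !BD [B y x]symB mulr2n; ring.
Qed.

Lemma form_square_le x y : B (x + y) (x + y) <= B x x *+ 2 + B y y *+ 2.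
Proof.
have := B_ge0 (x - y); rewrite !form_square.
by rewrite [B x (- y)]symB !formN [B y (- y)]symB formN [B y x]symB !mulr2n; lra.
Qed.

(** These are the normal equations of a projection. Their Gram matrix may be singular, but a kernel
    row gives a null vector, which [form_null] makes orthogonal to x, so they are solvable. *)
Lemma form_projection N (e : 'I_N -> V) x :
  exists c : 'I_N -> R, forall j, B (x - \sum_i c i *: e i) (e j) = 0.
Proof.
pose G : 'M[R]_N := \matrix_(i, j) B (e i) (e j).
have [] := @symmetric_solve N G (\row_j B x (e j)).
- by apply/matrixP => i j; rewrite !mxE symB.
- move=> y yG; set v := \sum_i y 0 i *: e i.
  have ve j : B v (e j) = 0.
    have /rowP/(_ j) := yG; rewrite !mxE => <-.
    by rewrite /v form_sum; apply: eq_bigr => i _; rewrite BZ mxE.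
  have vv : B v v = 0.
    rewrite {2}/v symB form_sum big1// => j _.
    by rewrite BZ symB ve mulr0.
  apply/matrixP => a b; rewrite !ord1 !mxE -[RHS](form_null x vv).
  by rewrite /v form_sum; apply: eq_bigr => i _; rewrite !mxE BZ symB.
- move=> y yG; exists (fun i => y 0 i) => j.
  have /rowP/(_ j) := yG; rewrite !mxE => h.
  rewrite BD formN form_sum -h; apply/eqP; rewrite subr_eq0; apply/eqP.
  by apply: eq_bigr => i _; rewrite BZ mxE.
Qed.

End forms.

(** Induction on the number of generators, by a Gram-Schmidt step for [B2]: the first generator is
    replaced by its part z orthogonal to the others. If z is null for [B2] it is null for [B1];
    otherwise the ratio of the two forms at z is a constant. *)
Lemma form_domination (V : lmodType R) (B1 B2 : V -> V -> R) N (e : 'I_N -> V) :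
  psd_form B1 -> psd_form B2 ->
  (forall x, B2 x x = 0 -> B1 x x = 0) ->
  exists2 C, 0 < C & forall (c : 'I_N -> R) v, v = \sum_i c i *: e i ->
    B1 v v <= C * B2 v v.
Proof.
move=> h1 h2 h12.
have [_ Z1 D1 P1] := h1; have [S2 Z2 D2 P2] := h2.
elim: N e => [|N IH] e.
  exists 1 => // c v ->; rewrite mul1r big_ord0.
  by rewrite -{1}(scale0r 0) Z1 mul0r.
have [C C0 HC] := IH (fun i => e (lift ord0 i)).
have [a za] := form_projection h2 (fun i => e (lift ord0 i)) (e ord0).
set z := _ - _ in za.
pose C' := if B2 z z == 0 then 0 else B1 z z / B2 z z.
have C'0 : 0 <= C' by rewrite /C'; case: ifP => // _; rewrite divr_ge0.
have zC : B1 z z <= C' * B2 z z.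
  rewrite /C'; case: eqVneq => [/h12 ->|z0]; first by rewrite mul0r.
  by rewrite divfK.
(* The factor 2 comes from [form_square_le], since the splitting is orthogonal for [B2] only. *)
exists (C *+ 2 + C' *+ 2) => [|c v cv]; first by rewrite !mulr2n; lra.
pose w := \sum_(i < N) (c (lift ord0 i) + c ord0 * a i) *: e (lift ord0 i).
have vE : v = c ord0 *: z + w.
  rewrite cv big_ord_recl /z scalerBr -addrA; congr (_ + _).
  rewrite /w; under [X in _ = _ + X]eq_bigr do rewrite scalerDl.
  rewrite big_split /= addrCA scaler_sumr.
  under [X in _ = _ + (- X + _)]eq_bigr do rewrite scalerA.
  by rewrite addNr addr0.
have zw : B2 z w = 0.
  by rewrite S2 /w (form_sum h2) big1// => i _; rewrite Z2 S2 za mulr0.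
have v2 : B2 v v = c ord0 ^+ 2 * B2 z z + B2 w w.
  rewrite vE (form_square h2) !Z2 S2 Z2 zw mulr0 mul0rn addr0 expr2.
  by rewrite mulrA.
have v1 : B1 v v <= (c ord0 ^+ 2 * B1 z z) *+ 2 + B1 w w *+ 2.
  rewrite vE (le_trans (form_square_le h1 _ _))// lerD2r lerMn2r/= Z1.
  by have [S1 _ _ _] := h1; rewrite S1 Z1 mulrA -expr2.
apply: (le_trans v1); rewrite v2.
have w1 := HC (fun i => c (lift ord0 i) + c ord0 * a i) w erefl.
have c2 : 0 <= c ord0 ^+ 2 := sqr_ge0 _.
have p2z := P2 z; have p2w := P2 w.
have hz : c ord0 ^+ 2 * B1 z z <= C' * (c ord0 ^+ 2 * B2 z z).
  by rewrite mulrCA ler_wpM2l.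
have q1 : 0 <= C * (c ord0 ^+ 2 * B2 z z).
  by apply: mulr_ge0; [exact: ltW|exact: mulr_ge0].
have q2 : 0 <= C' * B2 w w by rewrite mulr_ge0.
rewrite !mulr2n; move: hz w1 q1 q2; lra.
Qed.

End psd_forms.

Section trace_inequality.
Context {R : realType}.

(** A spanning family indexed by all exponents, with 0 in place of the monomials of too large total
    degree. *)
Lemma Pk_basis d k : exists N (m : 'I_N -> 'rV[R]_d -> R),
  (forall i, Pk k (m i)) /\
  forall p, Pk k p -> exists c : 'I_N -> R, p = fun x => \sum_i c i * m i x.
Proof.
pose I : finType := {ffun 'I_d -> 'I_k.+1}.
pose m (a : I) (x : 'rV[R]_d) : R :=
  if (\sum_i a i <= k)%N then \prod_i x 0 i ^+ a i else 0.
exists #|I|, (fun i => m (enum_val i)); split=> [i|p [c hc]].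
  rewrite /m; case h: (_ <= k)%N; last exact: Pk0.
  exact: (Pk_monom (a := fun j => enum_val i j : nat)).
exists (fun i => c (enum_val i)); apply/funext => x; rewrite hc big_mkcond /=.
rewrite (reindex (@enum_val _ I)) /=; last first.
  by exists enum_rank => a _; [exact: enum_valK|exact: enum_rankK].
by apply: eq_bigr => i _; rewrite /m; case: ifP => // _; rewrite mulr0.
Qed.

(** The L^2 form on coefficient vectors; the affine map allows integration over a face as well as
    over the simplex. *)
Lemma integral_form d m k (E : 'M[R]_(d, m)) (s0 : 'rV[R]_m) :
  forall N (e : 'I_N -> 'rV[R]_m -> R), (forall i, Pk k (e i)) ->
  psd_form (fun x y : 'rV[R]_N => vol_int (@ref_simplex R d) (fun t =>
    (\sum_i x 0 i * e i (s0 + t *m E)) * (\sum_i y 0 i * e i (s0 + t *m E)))).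
Proof.
move=> N e Pe.
have PP (x : 'rV[R]_N) : Pk k (fun t => \sum_i x 0 i * e i (s0 + t *m E)).
  by apply: Pk_sum => i _; apply: PkZ; exact: Pk_chart.
have mr := @ref_simplex_mbounded R d.
split.
- by move=> x y; apply: eq_vol_int => t _; rewrite mulrC.
- move=> a x y; rewrite -(vol_intZ _ mr (PkM (PP x) (PP y))).
  apply: eq_vol_int => t _; rewrite mulrA; congr (_ * _).
  by rewrite mulr_sumr; apply: eq_bigr => i _; rewrite mxE mulrA.
- move=> x y z; rewrite -(vol_intD mr (PkM (PP x) (PP z)) (PkM (PP y) (PP z))).
  apply: eq_vol_int => t _; rewrite -mulrDl; congr (_ * _).
  by rewrite -big_split; apply: eq_bigr => i _; rewrite mxE mulrDl.
- by move=> x; apply: vol_int_ge0 => t _; rewrite -expr2 sqr_ge0.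
Qed.

(** Both sides are semi-definite forms in the coefficients, and the right one vanishes only for the
    zero polynomial. The matrix [J] embeds the facet h = 0. *)
Lemma ref_trace n k : exists2 C : R, 0 < C & forall p : 'rV[R]_n.+1 -> R, Pk k p ->
  vol_int (@ref_simplex R n) (fun s => p (rvcons 0 s) * p (rvcons 0 s)) <=
  C * vol_int (@ref_simplex R n.+1) (fun t => p t * p t).
Proof.
have [N [m [Pm span]]] := Pk_basis n.+1 k.
pose J : 'M[R]_(n, n.+1) := \matrix_i rvcons 0 (delta_mx 0 i).
have JE (s : 'rV[R]_n) : 0 + s *m J = rvcons 0 s.
  rewrite add0r mulmx_sum_row; apply/rowP => j; rewrite summxE.
  under eq_bigr do rewrite mxE rowK.
  case: (unliftP ord0 j) => [l|] ->.
    rewrite rvconsS (bigD1 l)//= rvconsS mxE !eqxx mulr1 big1 ?addr0// => i il.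
    by rewrite rvconsS mxE eqxx (eq_sym l) (negPf il) mulr0.
  by rewrite rvcons0 big1// => i _; rewrite rvcons0 mulr0.
have h1 := integral_form J 0 Pm.
have h2 := integral_form (1%:M : 'M[R]_n.+1) 0 Pm.
have PP (x : 'rV[R]_N) : Pk k (fun t => \sum_i x 0 i * m i t).
  by apply: Pk_sum => i _; exact: PkZ.
have [|C C0 HC] := form_domination (fun i => delta_mx 0 i) h1 h2.
  move=> x; rewrite (eq_vol_int (q := fun t => (\sum_i x 0 i * m i t) *
    (\sum_i x 0 i * m i t))); last by move=> t _; rewrite mulmx1 add0r.
  move=> /(ref_int_eq0 (PkM (PP x) (PP x))) H.
  rewrite (eq_vol_int (q := fun=> 0)).
    by rewrite /vol_int Rintegral_cst ?mul0r//; exact: (ref_simplex_mbounded _).1.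
  by move=> t _; apply: H => y _; rewrite -expr2 sqr_ge0.
exists C => // p /span[c ->].
have := HC c (\sum_i c i *: delta_mx 0 i) erefl.
have cE i : (\sum_j c j *: delta_mx 0 j : 'rV[R]_N) 0 i = c i.
  rewrite summxE (bigD1 i)//= !mxE !eqxx mulr1 big1 ?addr0// => j ji.
  by rewrite !mxE eqxx eq_sym (negPf ji) mulr0.
rewrite (eq_vol_int (q := fun s => (\sum_i c i * m i (rvcons 0 s)) *
   (\sum_i c i * m i (rvcons 0 s)))); last first.
  by move=> s _; rewrite JE; under eq_bigr do rewrite cE.
rewrite [X in _ <= C * X -> _](eq_vol_int (q := fun s => (\sum_i c i * m i s) *
   (\sum_i c i * m i s)))//.
by move=> s _; rewrite mulmx1 add0r; under eq_bigr do rewrite cE.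
Qed.

End trace_inequality.

(** * Diameter, height and inscribed balls *)

Section mesh_size.
Context {R : realType} {n : nat}.
Local Notation pt := 'rV[R]_n.+1.
Local Notation simplex := (@simplex R n.+1).
Implicit Types K : simplex.

Lemma enorm_ge0 (x : pt) : 0 <= enorm x.
Proof. exact: sqrtr_ge0. Qed.

Lemma enorm_sqr (x : pt) : enorm x ^+ 2 = dot x x.
Proof. by rewrite sqr_sqrtr// dot_ge0. Qed.

Lemma other_vertex K a : simplex_full K -> a \in K ->
  exists2 b, b \in K & b != a.
Proof.
move=> fK Ka; have := base_in fK Ka; set b := _`_0; rewrite !inE => /andP[ba Kb].
by exists b.
Qed.

Lemma vertex_hull K a : a \in K -> hull K a.
Proof.
move=> Ka; exists (fun b => (b == a)%:R); split.
- by move=> y _; rewrite ler0n.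
- rewrite (big_fsetD1 a)//= eqxx big_seq big1 ?addr0// => y.
  by rewrite !inE => /andP[/negPf ->].
- rewrite (big_fsetD1 a)//= eqxx scale1r big_seq big1 ?addr0// => y.
  by rewrite !inE => /andP[/negPf ->]; rewrite scale0r.
Qed.

Lemma simplex_nonempty K : simplex_full K -> exists a, a \in K.
Proof.
move=> fK; have [K0|[a Ka]] := fset_0Vmem K; last by exists a.
by have := fK.1; rewrite K0 cardfs0.
Qed.

Lemma diameter_gt0 K : simplex_full K -> 0 < diameter K.
Proof.
move=> fK; have [a Ka] := simplex_nonempty fK.
have [b Kb ba] := other_vertex fK Ka.
have ab0 : 0 < enorm (a - b).
  rewrite lt_neqAle enorm_ge0 andbT eq_sym; apply/eqP => e0.
  move: ba; rewrite eq_sym -subr_eq0 => /eqP; apply; apply: dot_eq0.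
  by rewrite -enorm_sqr e0 expr0n.
apply: (lt_le_trans ab0); apply: ub_le_sup; last first.
  by exists a, b; split=> //; exact: vertex_hull.
(* The supremum dominates its elements once the set of distances is bounded. *)
have [r Kr] := hull_bounded K.
exists (Num.sqrt (\sum_(i < n.+1) (r + r) ^+ 2)) => _ [x [y [Kx Ky ->]]].
rewrite ler_sqrt; last by apply: sumr_ge0 => i _; exact: sqr_ge0.
apply: ler_sum => i _; rewrite -expr2 -real_normK ?num_real//.
rewrite lerXn2r ?nnegrE//.
  by rewrite (le_trans (normr_ge0 (x 0 i)))//
    (le_trans _ (lerD (Kr _ Kx i) (Kr _ Ky i)))// mxE subr0 lerDl.
have := lerD (Kr _ Kx i) (Kr _ Ky i); rewrite !mxE !subr0.
by apply: le_trans; rewrite ler_normB.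
Qed.

Definition height K a := dot (normal K a) ((enum_fset (K `\ a)%fset)`_0 - a).

Lemma height_gt0 K a : simplex_full K -> a \in K -> 0 < height K a.
Proof.
by move=> fK Ka; rewrite /height -opprB dotNr oppr_gt0; exact: slope_lt0.
Qed.

Lemma heightE K a b : simplex_full K -> a \in K -> b \in (K `\ a)%fset ->
  dot (b - a) (normal K a) = height K a.
Proof.
move=> fK Ka Fb; have [_ h _] := is_normal_normal fK Ka.
apply/eqP; rewrite /height dotC -subr_eq0 -dotBr opprB addrA subrK.
by rewrite h// base_in.
Qed.

(** Across a ball of radius r in [K], moving along the normal changes the coordinate of a by 2 r /
    height, and this coordinate stays in [0, 1]. *)
Lemma indiameter_le_height K a : simplex_full K -> a \in K ->
  indiameter K <= height K a.
Proof.
move=> fK Ka; have h0 := height_gt0 fK Ka.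
have [n1 _ _] := is_normal_normal fK Ka.
apply: ge_sup.
  (* The ball of radius 0 at a vertex shows that the supremum is over a nonempty set. *)
  exists 0; exists a, 0; split; rewrite ?mulr0// => y /= ya.
  suff -> : y = a by exact: vertex_hull.
  apply/eqP; rewrite -subr_eq0; apply/eqP/dot_eq0; rewrite -enorm_sqr.
  by have -> : enorm (y - a) = 0; [apply/eqP; rewrite eq_le ya enorm_ge0|rewrite expr0n].
move=> _ [c [r [r0 sub ->]]].
have sl t : slope K a (t *: normal K a) = - t / height K a.
  by rewrite /slope dotZr n1 mulr1 /height -opprB dotNr invrN mulrN mulNr.
have in_hull t : `|t| <= r -> 0 <= bary K a (c + t *: normal K a) <= 1.
  move=> tr; have Kx : hull K (c + t *: normal K a).
    apply: sub; rewrite /= addrAC subrr add0r enormZ /enorm n1 sqrtr1 mulr1 //.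
  have b0 b : b \in K -> 0 <= bary K b (c + t *: normal K a).
    exact: (hull_bary fK _).1.
  rewrite b0//= -(bary_sum fK (c + t *: normal K a)) (big_fsetD1 a)//= lerDl.
  by rewrite big_seq sumr_ge0// => b; rewrite !inE => /andP[_ /b0].
have := in_hull r; rewrite ger0_norm// => /(_ (lexx _)).
have := in_hull (- r); rewrite normrN ger0_norm// => /(_ (lexx _)).
rewrite !baryD !sl opprK => /andP[_ h1] /andP[h2 _].
have : r / height K a + r / height K a <= 1 by move: h1 h2; rewrite mulNr; lra.
by rewrite -mulrDl ler_pdivrMr// mul1r -mulr2n mulr_natl.
Qed.

(** The Jacobian of the element chart is the height times the Gram factor of the facet, so after
    multiplication by the height both sides scale alike, and the constant of the reference simplex
    is valid for every [K]. *)
Lemma trace_inequality k : exists2 C : R, 0 < C &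
  forall K a (w : pt -> R), simplex_full K -> a \in K -> Pk k w ->
  height K a * surf_int (K `\ a)%fset (fun x => w x * w x) <=
  C * vol_int (hull K) (fun x => w x * w x).
Proof.
have [C C0 HC] := @ref_trace R n k; exists C => // K a w fK Ka Pw.
have [b [r [spF spK]]] := facet_spans fK Ka.
have [_ aF] := simplex_full_D1 fK Ka.
have d := det_height fK Ka spF spK.
rewrite (surf_int_spans aF spF (PkM Pw Pw)) (vol_int_simplex fK spK (PkM Pw Pw)).
rewrite d (heightE fK Ka) ?(spans_in spF (leq0n _))//.
have e (h g V : R) : C * (h * g * V) = h * (g * (C * V)) by ring.
rewrite e; apply: ler_wpM2l; first exact/ltW/height_gt0.
apply: ler_wpM2l; first exact: sqrtr_ge0.
have := HC (fun t => w (b + t *m edges n.+1 [:: b, a & r])) (Pk_chart _ _ Pw).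
apply: le_trans; rewrite le_eqVlt; apply/orP; left; apply/eqP.
by apply: eq_vol_int => s _; rewrite chart_cons scale0r add0r.
Qed.

End mesh_size.

(** * Topology of triangulations *)

Section mesh_topology.
Context {R : realType} {n : nat}.
Local Notation pt := 'rV[R]_n.+1.
Local Notation simplex := (@simplex R n.+1).
Local Notation mesh := (@mesh R n.+1).
Implicit Types (K L F G : simplex) (T : mesh).

(** Otherwise the closed sets would cut [A] into two nonempty disjoint relatively closed pieces. *)
Lemma connected_closed_cover (X : topologicalType) (A U C : set X) :
  connected A -> closed U -> closed C -> A `<=` U `|` C ->
  (A `&` U) !=set0 -> (A `&` C) !=set0 -> exists x, [/\ A x, U x & C x].
Proof.
move=> cA cU cC AUC AU0 [z [Az Cz]]; apply: contrapT => no.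
have AUA : A `&` U = A.
  apply: cA => //; last by exists U.
  exists (~` C); first by rewrite openC.
  apply/seteqP; split=> x [Ax Ux]; split=> //.
    by move=> Cx; apply: no; exists x.
  by case: (AUC x Ax).
by apply: no; exists z; split => //; have [] : (A `&` U) z by rewrite AUA.
Qed.

Definition segment (a b : pt) (t : R) : pt := a + t *: (b - a).

Lemma segment0 a b : segment a b 0 = a.
Proof. by rewrite /segment scale0r addr0. Qed.

Lemma segment1 a b : segment a b 1 = b.
Proof. by rewrite /segment scale1r subrKC. Qed.

Lemma segment_continuous a b : continuous (segment a b).
Proof.
by move=> t; apply: cvgD; [exact: cvg_cst|apply: cvgZl; exact: cvg_id].
Qed.

Lemma near_segment a b (V : set pt) : open V -> V a ->
  exists t, [/\ 0 < t, t < 1 & V (segment a b t)].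
Proof.
move=> oV Va; have : \forall t \near (0 : R), V (segment a b t).
  by apply: segment_continuous; apply: open_nbhs_nbhs; split=> //; rewrite segment0.
move=> /nbhs_ballP[e /= e0 He]; exists (Num.min (e / 2) (1 / 2)); split.
- by rewrite lt_min !divr_gt0.
- by rewrite gt_min; apply/orP; right; lra.
- apply: He; rewrite /ball /= sub0r normrN gtr0_norm ?lt_min ?divr_gt0//.
  by rewrite gt_min ltr_pdivrMr// ltr_pMr// ltr1n.
Qed.

(** The hyperplanes through [a] are removed one at a time. What is left of the open set is open, and
    a small step along the normal [v] shows that it is nonempty. *)
Lemma avoid_hyperplanes a (l : seq pt) (V : set pt) :
  (forall v, v \in l -> v != 0) -> open V -> V !=set0 ->
  exists2 b, V b & forall v, v \in l -> dot v (b - a) != 0.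
Proof.
elim: l V => [|v l IH] V l0 oV [x Vx]; first by exists x.
pose W := V `&` [set b | dot v (b - a) != 0].
have cd : continuous (fun b : pt => dot v (b - a)).
  rewrite (_ : (fun b : pt => _) = fun b => dot v b + - dot v a); last first.
    by apply/funext => y; rewrite dotBr.
  exact: (Pk_continuous (PkD (Pk_dot v) (Pk_cst _ 1%N _))).
have oW : open W.
  apply: openI => //; apply: (@open_comp _ _ _ [set r | r != 0]); last exact: open_neq.
  by move=> y _; exact: cd.
have v0 : v != 0 by rewrite l0// mem_head.
have W0 : W !=set0.
  have [vx|vx] := eqVneq (dot v (x - a)) 0; last by exists x.
  have [t [t0 _ Vt]] := near_segment (x + v) oV Vx.
  exists (segment x (x + v) t); split=> //=.
  rewrite /segment (addrC x v) addrK addrAC dotDr vx add0r dotZr.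
  apply: mulf_neq0; first by rewrite gt_eqF.
  by apply: contra v0 => /eqP/dot_eq0 ->.
have [|b [Vb vb] hb] := IH W _ oW W0.
  by move=> u ul; rewrite l0// in_cons ul orbT.
exists b => // u; rewrite in_cons => /predU1P[->//|]; exact: hb.
Qed.

(** At most n difference vectors cannot span a space of dimension n + 1, so some [v] is orthogonal
    to all of them. *)
Lemma face_hyperplane G a : (#|` G| <= n)%N ->
  exists2 v : pt, v != 0 & forall x, hull G x -> dot v (x - a) = 0.
Proof.
move=> cG; pose s := enum_fset G; pose N := size s.
pose M : 'M[R]_(N, n.+1) := \matrix_(i < N) (s`_i - a).
have /rowV0Pn[v /sub_kermxP vM v0] : kermx M^T != 0.
  rewrite kermx_eq0 /row_free mxrank_tr; apply/eqP => h.
  have := leq_trans (rank_leq_row M) cG; rewrite h; by rewrite ltnn.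
exists v => // _ [lam [_ l1 ->]].
have -> : \sum_(b <- G) lam b *: b - a = \sum_(b <- G) lam b *: (b - a).
  under [RHS]eq_bigr do rewrite scalerBr.
  by rewrite sumrB -scaler_suml l1 scale1r.
rewrite dot_sumr big_seq big1// => b bG; rewrite dotZr.
have bs : (index b s < N)%N by rewrite index_mem.
have /rowP/(_ (Ordinal bs)) := vM.
rewrite !mxE => e; rewrite [dot _ _](_ : _ = 0) ?mulr0// -[RHS]e.
by apply: eq_bigr => i _; rewrite !mxE /= nth_index// mxE.
Qed.

Lemma bary_lincomb K a (r : seq pt) (lam : pt -> R) : \sum_(b <- r) lam b = 1 ->
  bary K a (\sum_(b <- r) lam b *: b) = \sum_(b <- r) lam b * bary K a b.
Proof.
move=> l1.
suff -> : bary K a (\sum_(b <- r) lam b *: b) =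
    \sum_(b <- r) lam b * bary K a b + (1 - \sum_(b <- r) lam b) * bary K a 0.
  by rewrite l1 subrr mul0r addr0.
elim: r {l1} => [|b r IH]; first by rewrite !big_nil subr0 mul1r add0r.
rewrite !big_cons addrC baryD IH slopeZ -[X in slope K a X]subr0 slopeB.
ring.
Qed.

Lemma hull_closed K : simplex_full K -> closed (hull K).
Proof.
move=> fK; suff H (r : seq pt) : closed [set x | forall a, a \in r -> 0 <= bary K a x].
  rewrite (_ : hull K = [set x | forall a, a \in enum_fset K -> 0 <= bary K a x])//.
  by apply/seteqP; split=> x /=; move/(hull_bary fK x).
elim: r => [|b r IH].
  by rewrite (_ : [set _ | _] = setT); [exact: closedT|apply/seteqP; split].
rewrite (_ : [set _ | _] = (bary K b @^-1` [set r | 0 <= r]) `&`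
    [set x | forall a, a \in r -> 0 <= bary K a x]).
  apply: closedI => //; apply: closed_comp; last exact: closed_ge.
  by move=> y _; exact: bary_continuous.
apply/seteqP; split=> [x h|x [hb h] a].
  by split=> [|a ar]; apply: h; rewrite in_cons ?eqxx// ar orbT.
by rewrite in_cons => /predU1P[->|/h].
Qed.

Lemma closed_hulls T (P : simplex -> Prop) :
  (forall K, K \in T -> simplex_full K) ->
  closed [set x | exists K, [/\ K \in T, P K & hull K x]].
Proof.
move=> fT; suff H (r : seq simplex) : {subset r <= T} ->
    closed [set x | exists K, [/\ K \in r, P K & hull K x]] by exact: H.
elim: r => [|L r IH] sub.
  by rewrite (_ : [set _ | _] = set0); [exact: closed0|apply/seteqP; split=> // x [K []]].
have {}IH : closed [set x | exists K, [/\ K \in r, P K & hull K x]].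
  by apply: IH => K Kr; apply: sub; rewrite in_cons Kr orbT.
have LT : L \in T by apply: sub; rewrite mem_head.
have [PL|PL] := pselect (P L); last first.
  rewrite (_ : [set _ | _] = [set x | exists K, [/\ K \in r, P K & hull K x]])//.
  apply/seteqP; split=> x [K [Kr PK Kx]]; exists K; split=> //; last first.
    by rewrite in_cons Kr orbT.
  by move: Kr; rewrite in_cons => /predU1P[KL|//]; case: PL; rewrite -KL.
rewrite (_ : [set _ | _] = hull L `|` [set x | exists K, [/\ K \in r, P K & hull K x]]).
  by apply: closedU => //; exact/hull_closed/fT.
apply/seteqP; split=> x.
  move=> [K [+ PK Kx]]; rewrite in_cons => /predU1P[<-|Kr]; first by left.
  by right; exists K.
move=> [Lx|[K [Kr PK Kx]]]; first by exists L; rewrite mem_head.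
by exists K; rewrite in_cons Kr orbT.
Qed.

Lemma card_facet K F : simplex_full K -> (F `<=` K)%fset -> #|` F| = n.+1 ->
  exists2 a, a \in K & F = (K `\ a)%fset.
Proof.
move=> [cK _] FK cF; have cD : #|` (K `\` F)%fset| = 1%N.
  by rewrite cardfsDS// cK cF subSnn.
have /cardfs1P[a aE] : #|` (K `\` F)%fset| == 1%N by rewrite cD.
have : a \in (K `\` F)%fset by rewrite aE inE.
rewrite inE => /andP[aF aK]; exists a => //; apply/fsetP => x.
have : (x \in (K `\` F)%fset) = (x == a) by rewrite aE inE.
rewrite !inE => <-; case: (boolP (x \in F)) => [/(fsubsetP FK) ->|_] //=.
by rewrite andNb.
Qed.

Lemma card_inter K L : simplex_full K -> simplex_full L -> K != L ->
  (#|` (K `&` L)%fset| <= n.+1)%N.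
Proof.
move=> [cK _] [cL _] KL; rewrite leqNgt; apply/negP => h.
have KLK : (K `&` L)%fset = K.
  by apply/eqP; rewrite eqEfcard fsubsetIl/= cK.
have KLL : (K `&` L)%fset = L.
  by apply/eqP; rewrite eqEfcard fsubsetIr/= cL.
by move: KL; rewrite -{1}KLK KLL eqxx.
Qed.

End mesh_topology.

(** * Passage between elements through facets *)

Section mesh_connectivity.
Context {R : realType} {n : nat}.
Local Notation pt := 'rV[R]_n.+1.
Local Notation simplex := (@simplex R n.+1).
Local Notation mesh := (@mesh R n.+1).
Implicit Types (K L F G : simplex) (T : mesh) (Om : set pt).

Lemma triangulation_full Om T K : triangulation Om T -> K \in T -> simplex_full K.
Proof. by move=> [h _ _] /h. Qed.

Lemma triangulation_cover Om T x : triangulation Om T ->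
  closure Om x <-> exists K, [/\ K \in T, True & hull K x].
Proof.
move=> [_ _ ->]; split=> [[K KT Kx]|[K [KT _ Kx]]]; by exists K.
Qed.

(** A triangulation describes the closure of [Om] only; points of [Om] itself are found because open
    simplices are open. *)
Lemma open_simplex_meets Om T K (V : set pt) : triangulation Om T -> K \in T ->
  open V -> (V `&` open_simplex K) !=set0 -> exists x, [/\ Om x, V x & open_simplex K x].
Proof.
move=> hT KT oV [x [Vx ox]].
have : closure Om x.
  by apply/(triangulation_cover _ hT); exists K; split=> //;
    exact: open_simplex_hull (triangulation_full hT KT) _ ox.
move=> /(_ (V `&` open_simplex K)) [].
  by apply: open_nbhs_nbhs; split=> //; apply: openI => //; exact: open_open_simplex.
by move=> y [Oy [Vy oy]]; exists y.
Qed.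

Lemma open_simplex_near K x (V : set pt) : simplex_full K -> hull K x ->
  open V -> V x -> (V `&` open_simplex K) !=set0.
Proof.
move=> fK Kx oV Vx; have [t [t0 t1 Vt]] := near_segment (barycenter K) oV Vx.
exists (segment x (barycenter K) t); split=> // a Ka; rewrite /segment bary_line.
apply: ltr_wpDl; last by apply: mulr_gt0 => //; exact: open_simplex_barycenter.
by apply: mulr_ge0; [rewrite subr_ge0 ltW|exact: (hull_bary fK x).1].
Qed.

Lemma conforming_inter Om T K L x : triangulation Om T -> K \in T -> L \in T ->
  hull K x -> hull L x -> hull (K `&` L)%fset x.
Proof. by move=> [_ cT _] KT LT Kx Lx; rewrite -cT. Qed.

(** A point of the open simplex lies on no proper face. *)
Lemma open_simplex_unique K L x : simplex_full K -> simplex_full L ->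
  open_simplex K x -> hull (K `&` L)%fset x -> K = L.
Proof.
move=> fK fL ox /(hull_face_bary fK _ (fsubsetIl K L)) [_ h].
have KL : (K `<=` L)%fset.
  apply/fsubsetP => a Ka; apply: contraT => aL.
  have := ox a Ka; rewrite h ?ltxx// !inE Ka /=; exact: aL.
by apply/eqP; rewrite eqEfcard KL fK.1 fL.1 leqnn.
Qed.

Definition facet_adjacent K L :=
  exists a b, [/\ a \in K, b \in L & (K `\ a)%fset = (L `\ b)%fset].

(** If [S] failed somewhere, connectedness of [Om] would give a point x of [Om] in two elements, one
    of each class. A generic segment near x, from inside the first to inside the second, changes
    class at a point of two elements with n + 1 common vertices, hence a common facet. A ball around
    x keeps the segment in [Om], which may be nonconvex. *)
Lemma facet_connected Om T (S : simplex -> Prop) :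
  open Om -> connected Om -> triangulation Om T ->
  (exists2 K, K \in T & S K) ->
  (forall K L, K \in T -> L \in T -> S K -> facet_adjacent K L -> S L) ->
  forall K, K \in T -> S K.
Proof.
move=> oOm cOm hT [K0 K0T SK0] adj L0 L0T; apply: contrapT => SL0.
have fT K : K \in T -> simplex_full K := triangulation_full hT.
pose U := [set x | exists K, [/\ K \in T, S K & hull K x]].
pose C := [set x | exists K, [/\ K \in T, ~ S K & hull K x]].
have cU : closed U by exact: closed_hulls.
have cC : closed C by exact: closed_hulls.
have OmUC : Om `<=` U `|` C.
  move=> x /subset_closure/(triangulation_cover x hT)[K [KT _ Kx]].
  by have [SK|SK] := pselect (S K); [left|right]; exists K.
have [x [Ox [K [KT SK Kx]] [L [LT SL Lx]]]] : exists x, [/\ Om x, U x & C x].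
  apply: connected_closed_cover => //.
    have [|x [Ox _ ox]] := open_simplex_meets (V := setT) hT K0T openT.
      by exists (barycenter K0); split=> //; exact: open_simplex_barycenter (fT _ K0T).
    by exists x; split=> //; exists K0; split=> //; exact: open_simplex_hull (fT _ K0T) _ ox.
  have [|x [Ox _ ox]] := open_simplex_meets (V := setT) hT L0T openT.
    by exists (barycenter L0); split=> //; exact: open_simplex_barycenter (fT _ L0T).
  by exists x; split=> //; exists L0; split=> //; exact: open_simplex_hull (fT _ L0T) _ ox.
have [fK fL] := (fT _ KT, fT _ LT).
have /nbhs_ballP[e /= e0 He] : nbhs x Om by apply: open_nbhs_nbhs.
have oB : open (ball x e) by exact: ball_open.
have Bx : ball x e x by exact: ballxx.
have [a [Ba oa]] := open_simplex_near fK Kx oB Bx.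
have /choice[hyp hhyp] : forall G : simplex, exists v : pt, (#|` G| <= n)%N ->
    v != 0 /\ forall x, hull G x -> dot v (x - a) = 0.
  move=> G; have [cG|cG] := pselect (is_true (#|` G| <= n)%N).
    by have [v v0 hv] := face_hyperplane a cG; exists v.
  by exists 0 => /cG.
(* Common faces of codimension at least 2; each spans with [a] a hyperplane to be avoided by the end
   point [b]. *)
pose Gs : seq {fset pt} := [seq G <-
  [seq (p.1 `&` p.2)%fset | p <- [seq (K', L') | K' <- T, L' <- T]]
  | (#|` G| <= n)%N].
have Gs_in K' L' : K' \in T -> L' \in T -> (#|` (K' `&` L')%fset| <= n)%N ->
    ((K' `&` L')%fset : {fset pt}) \in Gs.
  move=> K'T L'T h; rewrite mem_filter h /=.
  apply/mapP; exists (K', L') => //=; apply/allpairsP.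
  by exists (K', L').
have oV : open (ball x e `&` open_simplex L).
  by apply: openI => //; exact: open_open_simplex.
have [|b [Bb ob] hb] := @avoid_hyperplanes R n a [seq hyp G | G <- Gs] _ _ oV
    (open_simplex_near fL Lx oB Bx).
  by move=> v /mapP[G]; rewrite mem_filter => /andP[/hhyp[v0 _] _] ->.
have segB t : `[0, 1]%classic t -> Om (segment a b t).
  rewrite /= in_itv /= => /andP[t0 t1]; apply: He; rewrite -ball_normE /=.
  move: Ba Bb; rewrite -!ball_normE /= => Ba Bb.
  have -> : x - segment a b t = (1 - t) *: (x - a) + t *: (x - b).
    by rewrite /segment; apply/rowP => i; rewrite !mxE; ring.
  rewrite (le_lt_trans (ler_normD _ _))// !normrZ !ger0_norm// ?subr_ge0//.
  have [->|tn0] := eqVneq t 0; first by rewrite subr0 mul1r mul0r addr0.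
  have tp : 0 < t by rewrite lt_neqAle eq_sym tn0.
  have h1 : (1 - t) * `|x - a| <= (1 - t) * e by rewrite ler_wpM2l ?subr_ge0// ltW.
  have h2 : t * `|x - b| < t * e by rewrite ltr_pM2l.
  by move: h1 h2; lra.
have [t [/= t01 [K1 [K1T SK1 K1t]] [L1 [L1T SL1 L1t]]]] :
    exists t, [/\ `[0, 1]%classic t, (segment a b @^-1` U) t & (segment a b @^-1` C) t].
  apply: connected_closed_cover.
  - exact: segment_connected.
  - by apply: closed_comp => // y _; exact: segment_continuous.
  - by apply: closed_comp => // y _; exact: segment_continuous.
  - by move=> t /segB/OmUC.
  - exists 0; split; first by rewrite /= in_itv/= lexx ler01.
    by rewrite /= segment0; exists K; split=> //; exact: open_simplex_hull oa.
  - exists 1; split; first by rewrite /= in_itv/= lexx ler01.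
    by rewrite /= segment1; exists L; split=> //; exact: open_simplex_hull ob.
(* All these hyperplanes contain [a], so t = 0 is treated apart: there the point is interior to [K]
   and belongs to no other element. *)
have [t0|tn0] := eqVneq t 0.
  move: L1t; rewrite t0 segment0 => L1a.
  have Ka : hull K a by exact: open_simplex_hull oa.
  have KL1 := open_simplex_unique fK (fT _ L1T) oa (conforming_inter hT KT L1T Ka L1a).
  by apply: SL1; rewrite -KL1.
have KL1 : K1 != L1 by apply/eqP => KL1; apply: SL1; rewrite -KL1.
have K1L1 := conforming_inter hT K1T L1T K1t L1t.
have [fK1 fL1] := (fT _ K1T, fT _ L1T).
have := card_inter fK1 fL1 KL1; rewrite leq_eqVlt => /orP[/eqP cG|].
  have [a' K1a aE] := card_facet fK1 (fsubsetIl _ _) cG.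
  have [b' L1b bE] := card_facet fL1 (fsubsetIr _ _) cG.
  apply: SL1; apply: (adj K1 L1) => //; exists a', b'; split=> //.
  by rewrite -aE -bE.
rewrite ltnS => cG; have [v0 hv] := hhyp _ cG.
have := hb (hyp (K1 `&` L1)%fset); rewrite map_f ?Gs_in// => /(_ isT).
have := hv _ K1L1; rewrite /segment addrAC subrr add0r dotZr => /eqP.
by rewrite mulf_eq0 (negPf tn0) /= => ->.
Qed.

End mesh_connectivity.

Local Opaque slope bary.

(** * Two elements with a common facet *)

Section mesh_facets.
Context {R : realType} {n : nat}.
Local Notation pt := 'rV[R]_n.+1.
Local Notation simplex := (@simplex R n.+1).
Local Notation mesh := (@mesh R n.+1).
Implicit Types (K L F G : simplex) (T : mesh) (Om : set pt).

(** Both sides are affine in y, vanish on the common facet and agree at b. *)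
Lemma bary_facet_ratio K L a b y : simplex_full K -> simplex_full L ->
  a \in K -> b \in L -> (K `\ a)%fset = (L `\ b)%fset ->
  bary K a y = bary L b y * bary K a b.
Proof.
move=> fK fL Ka Lb KL; rewrite {1}(bary_comb fL y).
rewrite bary_lincomb ?bary_sum// (big_fsetD1 b)//= -KL.
rewrite big_seq big1 ?addr0// => c; rewrite !inE => /andP[ca Kc].
by rewrite (bary_other fK Ka Kc ca) mulr0.
Qed.

Definition open_facet K a : set pt :=
  [set x | bary K a x = 0 /\ forall c, c \in (K `\ a)%fset -> 0 < bary K c x].

Lemma open_facet_hull K a x : simplex_full K -> a \in K ->
  open_facet K a x -> hull (K `\ a)%fset x.
Proof.
move=> fK Ka [x0 xp]; apply/(hull_face_bary fK x (fsubD1set K a)); split.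
  apply/(hull_bary fK) => c Kc; have [->|ca] := eqVneq c a; first by rewrite x0.
  by rewrite ltW// xp// !inE ca.
by move=> c Kc; rewrite !inE Kc andbT negbK => /eqP ->.
Qed.

Lemma open_facet_face K a G x : simplex_full K -> a \in K -> (G `<=` K)%fset ->
  open_facet K a x -> hull G x -> (K `\ a `<=` G)%fset.
Proof.
move=> fK Ka GK [_ xp] /(hull_face_bary fK x GK)[_ h].
apply/fsubsetP => c cF; apply: contraT => cG.
have := xp c cF; move: cF; rewrite !inE => /andP[_ Kc].
by rewrite h ?ltxx.
Qed.

Definition facet_center K a : pt := \sum_(c <- (K `\ a)%fset) (n.+1%:R^-1 : R) *: c.

Lemma bary_facet_center K a c : simplex_full K -> a \in K -> c \in K ->
  bary K c (facet_center K a) = if c == a then 0 else n.+1%:R^-1.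
Proof.
move=> fK Ka Kc; have [cF _] := simplex_full_D1 fK Ka.
rewrite /facet_center bary_lincomb; last first.
  rewrite big_const_seq count_predT -[size _]/(#|` (K `\ a)%fset|) cF iter_addr addr0.
  by rewrite -[_ *+ _]mulr_natl divff// pnatr_eq0.
case: eqVneq => [->|ca].
  rewrite big_seq big1// => b; rewrite !inE => /andP[ba Kb].
  by rewrite bary_other// mulr0.
rewrite (big_fsetD1 c) ?inE ?ca ?Kc//= bary_self// mulr1.
rewrite big_seq big1 ?addr0// => b; rewrite !inE => /andP[bc /andP[ba Kb]].
by rewrite bary_other// mulr0.
Qed.

Lemma open_facet_center K a : simplex_full K -> a \in K ->
  open_facet K a (facet_center K a).
Proof.
move=> fK Ka; split; first by rewrite bary_facet_center// eqxx.
move=> c; rewrite !inE => /andP[ca Kc].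
by rewrite bary_facet_center// (negPf ca) invr_gt0.
Qed.

(** Otherwise a small step from the facet center towards b stays in both elements, hence in their
    common face, which does not contain a. Then [bary K a b] is 0, which contradicts
    [bary_facet_ratio] with the roles exchanged. *)
Lemma conforming_opposite K L a b : simplex_full K -> simplex_full L ->
  a \in K -> b \in L -> (K `\ a)%fset = (L `\ b)%fset -> K != L ->
  hull K `&` hull L = hull (K `&` L)%fset -> bary K a b < 0.
Proof.
move=> fK fL Ka Lb KL nKL conf; rewrite ltNge; apply/negP => b0.
set y := facet_center K a.
have oy := open_facet_center fK Ka : open_facet K a y.
(* Near the facet center all coordinates except that of a stay positive. *)
pose V := [set x | forall c, c \in enum_fset (K `\ a)%fset -> 0 < bary K c x].
have oV : open V.
  rewrite /V; elim: (enum_fset _) => [|c r IH].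
    by rewrite (_ : [set _ | _] = setT); [exact: openT|apply/seteqP; split].
  rewrite (_ : [set _ | _] = (bary K c @^-1` [set r | 0 < r]) `&`
      [set x | forall a, a \in r -> 0 < bary K a x]).
    apply: openI => //; apply: open_comp; last exact: open_gt.
    by move=> z _; exact: bary_continuous.
  apply/seteqP; split=> [x h|x [hb h] d].
    by split=> [|d dr]; apply: h; rewrite in_cons ?eqxx// dr orbT.
  by rewrite in_cons => /predU1P[->|/h].
have [t [t0 t1 Vt]] := near_segment b oV oy.2.
set z := segment y b t in Vt.
have Ly : hull L y.
  have : hull (L `\ b)%fset y by rewrite -KL; exact: open_facet_hull.
  by move=> /(hull_facet_bary fL Lb)[].
have Lz : hull L z.
  apply/(hull_bary fL) => c Lc; rewrite /z /segment bary_line.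
  have t1' : 0 <= 1 - t by rewrite subr_ge0 ltW.
  apply: addr_ge0; first exact: mulr_ge0 t1' ((hull_bary fL y).1 Ly c Lc).
  apply: mulr_ge0; first exact: ltW.
  have [->|cb] := eqVneq c b; first by rewrite bary_self.
  by rewrite bary_other// eq_sym.
have za : bary K a z = t * bary K a b.
  by rewrite /z /segment bary_line oy.1 mulr0 add0r.
have Kz : hull K z.
  apply/(hull_bary fK) => c Kc; have [->|ca] := eqVneq c a.
    by rewrite za mulr_ge0// ltW.
  by apply/ltW/Vt; rewrite -[_ \in _]/(c \in (K `\ a)%fset) !inE ca.
have : hull (K `&` L)%fset z by rewrite -conf.
move=> /(hull_face_bary fK z (fsubsetIl K L))[_ /(_ a Ka)].
have aL : a \notin L.
  apply/negP => La; move: nKL; apply/negP; rewrite negbK eqEfcard fK.1 fL.1 leqnn andbT.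
  apply/fsubsetP => c Kc; have [->//|ca] := eqVneq c a.
  have : c \in (L `\ b)%fset by rewrite -KL !inE ca.
  by rewrite !inE => /andP[].
rewrite !inE negb_and aL orbT => /(_ isT); rewrite za => /eqP.
rewrite mulf_eq0 (gt_eqF t0) /= => /eqP ab0.
have := bary_facet_ratio b fL fK Lb Ka (esym KL).
have := bary_facet_ratio a fL fK Lb Ka (esym KL).
have := bary_facet_ratio b fL fK Lb Ka (esym KL).
by rewrite (bary_self fL Lb) ab0 mul0r => /eqP; rewrite oner_eq0.
Qed.

Lemma mem_facet_eq K L a : a \in K -> (K `\ a `<=` L)%fset -> simplex_full K ->
  simplex_full L -> exists2 b, b \in L & (K `\ a)%fset = (L `\ b)%fset.
Proof.
move=> Ka KL fK fL; have [cF _] := simplex_full_D1 fK Ka.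
exact: card_facet.
Qed.

(** Near such a point the sign of [bary K a] decides between [K] and [L], because a and b lie on
    different sides of the facet. *)
Lemma open_facet_interior K L a b x : simplex_full K -> simplex_full L ->
  a \in K -> b \in L -> (K `\ a)%fset = (L `\ b)%fset -> K != L ->
  hull K `&` hull L = hull (K `&` L)%fset -> open_facet K a x ->
  nbhs x (hull K `|` hull L).
Proof.
move=> fK fL Ka Lb KL nKL conf [x0 xp].
have ab := conforming_opposite fK fL Ka Lb KL nKL conf.
have openV (M : simplex) (r : seq pt) : open [set y | forall c, c \in r -> 0 < bary M c y].
  elim: r => [|c r IH].
    by rewrite (_ : [set _ | _] = setT); [exact: openT|apply/seteqP; split].
  rewrite (_ : [set _ | _] = (bary M c @^-1` [set r | 0 < r]) `&`
      [set x | forall a, a \in r -> 0 < bary M a x]).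
    apply: openI => //; apply: open_comp; last exact: open_gt.
    by move=> z _; exact: bary_continuous.
  apply/seteqP; split=> [z h|z [hb h] d].
    by split=> [|d dr]; apply: h; rewrite in_cons ?eqxx// dr orbT.
  by rewrite in_cons => /predU1P[->|/h].
have xL c : c \in (L `\ b)%fset -> 0 < bary L c x.
  move=> cF; rewrite {1}(bary_comb fK x) bary_lincomb ?bary_sum//.
  rewrite (big_fsetD1 a)//= x0 mul0r add0r KL (big_fsetD1 c)//=.
  have Lc : c \in L by move: cF; rewrite !inE => /andP[].
  have e (u v w : R) : v = 1 -> w = 0 -> u * v + w = u by move=> -> ->; ring.
  rewrite (e _ _ _ (bary_self fL Lc)); first by apply: xp; rewrite KL.
  rewrite big_seq big1// => d; rewrite !inE => /and3P[dc _ Ld].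
  by rewrite (bary_other fL Lc Ld dc) mulr0.
apply: (@filterS _ _ _ ([set y | forall c, c \in enum_fset (K `\ a)%fset -> 0 < bary K c y] `&`
    [set y | forall c, c \in enum_fset (L `\ b)%fset -> 0 < bary L c y])); last first.
  by apply: open_nbhs_nbhs; split; [apply: openI; exact: openV|split].
move=> y [yK yL]; have [ya|ya] := leP 0 (bary K a y); [left|right].
  apply/(hull_bary fK) => c Kc; have [->//|ca] := eqVneq c a.
  by apply/ltW/yK; rewrite -[_ \in _]/(c \in (K `\ a)%fset) !inE ca.
apply/(hull_bary fL) => c Lc; have [->|cb] := eqVneq c b.
  have h (u v : R) : v < 0 -> u * v < 0 -> 0 <= u by move=> v0; nra.
  by apply: h ab _; rewrite -(bary_facet_ratio y fK fL Ka Lb KL).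
by apply/ltW/yL; rewrite -[_ \in _]/(c \in (L `\ b)%fset) !inE cb.
Qed.

End mesh_facets.

(** * Boundary and interface facets *)

Section coupled_meshes.
Context {R : realType} {n : nat}.
Local Notation pt := 'rV[R]_n.+1.
Local Notation simplex := (@simplex R n.+1).
Local Notation mesh := (@mesh R n.+1).
Implicit Types (K L F G : simplex) (T : mesh) (Om : set pt).

Definition boundary_facet T K a :=
  [/\ K \in T, a \in K & forall L, L \in T -> (K `\ a `<=` L)%fset -> L = K].

Lemma triangulation_conforming Om T K L : triangulation Om T ->
  K \in T -> L \in T -> hull K `&` hull L = hull (K `&` L)%fset.
Proof. by move=> [_ cT _] KT LT; exact: cT. Qed.

(** If every facet were shared, the part of a generic segment covered by the mesh would be open and
    closed, although the segment starts inside an element and ends outside the mesh. *)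
Lemma exists_boundary_facet Om T : bounded_set Om -> triangulation Om T ->
  (exists K, K \in T) -> exists K a, boundary_facet T K a.
Proof.
move=> bOm hT [K0 K0T]; apply: contrapT => no.
have fT K : K \in T -> simplex_full K := triangulation_full hT.
have shared K a : K \in T -> a \in K ->
    exists L, [/\ L \in T, (K `\ a `<=` L)%fset & L <> K].
  move=> KT Ka; apply: contrapT => noL; apply: no; exists K, a; split=> // L LT KL.
  by apply: contrapT => LK; apply: noL; exists L.
pose U := [set x | exists K, [/\ K \in T, True & hull K x]].
have cU : closed U by exact: closed_hulls.
have nU : (~` U) !=set0.
  (* Finitely many bounded hulls leave a point with large coordinates uncovered. *)
  have [r Ur] : exists r, U `<=` box 0 r.
    suff [r Hr] : exists r, forall K x, K \in enum_fset T -> hull K x -> box 0 r x.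
      by exists r => x [K [KT _ Kx]]; exact: Hr KT Kx.
    elim: (enum_fset T) => [|L l [r IH]]; first by exists 0 => x K.
    have [r' Lr] := hull_bounded L; exists (Num.max r r') => K x.
    rewrite in_cons => /predU1P[->|Kl] Kx i.
      by rewrite le_max (Lr x Kx i) orbT.
    by rewrite le_max (IH K x Kl Kx i).
  exists (const_mx (`|r| + 1)) => /Ur/(_ ord0); rewrite !mxE subr0 ger0_norm ?addr_ge0//.
  by have := ler_norm r; lra.
set a := barycenter K0.
have oa : open_simplex K0 a by exact: open_simplex_barycenter (fT _ K0T).
have /choice[hyp hhyp] : forall G : simplex, exists v : pt, (#|` G| <= n)%N ->
    v != 0 /\ forall x, hull G x -> dot v (x - a) = 0.
  move=> G; have [cG|cG] := pselect (is_true (#|` G| <= n)%N).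
    by have [v v0 hv] := face_hyperplane a cG; exists v.
  by exists 0 => /cG.
(* Faces obtained by removing two vertices; the cardinality test discards the case c = d. *)
pose Gs : seq {fset pt} :=
  [seq G <- flatten [seq [seq (K `\ p.1 `\ p.2)%fset |
       p <- [seq (c, d) | c <- enum_fset K, d <- enum_fset K]] | K : {fset pt} <- T]
   | (#|` G| <= n)%N].
have Gs_in K c d : K \in T -> c \in K -> d \in K ->
    (#|` (K `\ c `\ d)%fset| <= n)%N -> ((K `\ c `\ d)%fset : {fset pt}) \in Gs.
  move=> KT Kc Kd h; rewrite mem_filter h /=.
  apply/flattenP; exists [seq (K `\ p.1 `\ p.2)%fset |
       p <- [seq (c, d) | c <- enum_fset K, d <- enum_fset K]].
    by apply/mapP; exists K.
  by apply/mapP; exists (c, d) => //=; apply/allpairsP; exists (c, d).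
have [|||b /= bU hb] := @avoid_hyperplanes R n a [seq hyp G | G <- Gs] (~` U).
- by move=> v /mapP[G]; rewrite mem_filter => /andP[/hhyp[v0 _] _] ->.
- by rewrite openC.
- exact: nU.
have Uint t : `[0, 1]%classic t -> U (segment a b t) -> nbhs (segment a b t) U.
  move=> _ [K [KT _ Kx]]; set x := segment a b t in Kx *.
  have fK := fT _ KT.
  have intK L y : L \in T -> open_simplex L y -> nbhs y U.
    move=> LT oy; apply: (@filterS _ _ _ (open_simplex L)).
      by move=> z oz; exists L; split=> //; exact: open_simplex_hull (fT _ LT) _ oz.
    by apply: open_nbhs_nbhs; split=> //; exact: open_open_simplex.
  have [t0|tn0] := eqVneq t 0.
    by rewrite /x t0 segment0; exact: intK oa.
  have [ox|/existsNP[c /not_implyP[Kc /negP xc]]] := pselect (open_simplex K x).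
    exact: intK ox.
  have xc0 : bary K c x = 0.
    by apply/eqP; rewrite eq_le (hull_bary fK x).1// andbT leNgt.
  (* A second vanishing coordinate would put x on a face of codimension 2, which the segment avoids
     for t != 0. *)
  have of_ : open_facet K c x.
    split=> // d; rewrite !inE => /andP[dc Kd].
    rewrite lt_neqAle (hull_bary fK x).1// andbT eq_sym; apply/eqP => xd0.
    have cG : (#|` (K `\ c `\ d)%fset| <= n)%N.
      have [cF _] := simplex_full_D1 fK Kc.
      by have := cardfsD1 d (K `\ c)%fset; rewrite cF !inE dc Kd add1n => -[<-].
    have Gx : hull (K `\ c `\ d)%fset x.
      have sub := fsubset_trans (fsubD1set (K `\ c)%fset d) (fsubD1set K c).
      apply: (hull_face_bary fK x sub).2.
      split; first exact: Kx.
      move=> e Ke.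
      rewrite !inE Ke andbT negb_and !negbK.
      by move=> /orP[/eqP ->|/eqP ->]; [exact: xd0|exact: xc0].
    have [_ hv] := hhyp _ cG.
    have := hb (hyp (K `\ c `\ d)%fset); rewrite map_f ?Gs_in// => /(_ isT).
    have := hv _ Gx; rewrite /x /segment addrAC subrr add0r dotZr => /eqP.
    by rewrite mulf_eq0 (negPf tn0) /= => ->.
  have [L [LT KL LK]] := shared K c KT Kc.
  have [d Ld KLd] := mem_facet_eq Kc KL fK (fT _ LT).
  have := open_facet_interior fK (fT _ LT) Kc Ld KLd _
    (triangulation_conforming hT KT LT) of_.
  move=> H; apply: filterS (H _); last by apply/eqP => KLe; apply: LK.
  by move=> y [Ky|Ly]; [exists K|exists L].
have s0 : `[0, 1]%classic (0 : R) by rewrite /= in_itv/= lexx ler01.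
have s1 : `[0, 1]%classic (1 : R) by rewrite /= in_itv/= lexx ler01.
have : `[0, 1] `&` (segment a b @^-1` U) = `[0, 1]%classic.
  apply: (@segment_connected R 0 1).
  - exists 0; split=> //=; rewrite segment0; exists K0; split=> //.
    exact: open_simplex_hull (fT _ K0T) _ oa.
  - exists (segment a b @^-1` (interior U)).
      apply: open_comp; last exact: open_interior.
      by move=> y _; exact: segment_continuous.
    apply/seteqP; split=> t [t01 Ut]; split=> //=.
      exact: Uint.
    exact: interior_subset Ut.
  - exists (segment a b @^-1` U) => //.
    by apply: closed_comp => // y _; exact: segment_continuous.
by move=> /seteqP[_ /(_ 1 s1)[_ /=]]; rewrite segment1.
Qed.

Lemma open_facet_near K a x (V : set pt) : simplex_full K -> a \in K ->
  hull (K `\ a)%fset x -> open V -> V x -> exists y, V y /\ open_facet K a y.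
Proof.
move=> fK Ka Fx oV Vx; have [x0 Kx] := hull_facet_bary fK Ka Fx.
have [c0 cp] := open_facet_center fK Ka.
have [t [t0 t1 Vt]] := near_segment (facet_center K a) oV Vx.
exists (segment x (facet_center K a) t); split=> //; split=> [|c cF].
  by rewrite /segment bary_line x0 c0 !mulr0 addr0.
rewrite /segment bary_line; apply: ltr_wpDl; last exact: mulr_gt0 (cp c cF).
apply: mulr_ge0; first by rewrite subr_ge0 ltW.
by apply: (hull_bary fK x).1 => //; move: cF; rewrite !inE => /andP[].
Qed.

Variables (Om Os Od : set pt) (Ts Td : mesh).
Hypothesis hdom : coupled_domain Om Os Od.
Hypotheses (hTs : triangulation Os Ts) (hTd : triangulation Od Td).
Hypothesis conf : conforming Ts Td.

Let fTs K : K \in Ts -> simplex_full K := triangulation_full hTs.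
Let fTd K : K \in Td -> simplex_full K := triangulation_full hTd.

Lemma hull_sub_closure O T K x : triangulation O T -> K \in T -> hull K x ->
  closure O x.
Proof.
by move=> hT KT Kx; apply/(triangulation_cover x hT); exists K.
Qed.

(** The interior of a common element would contain points of [Os], and then points of [Od] inside
    the open set [Os]. *)
Lemma mesh_disjoint K : K \in Ts -> K \in Td -> False.
Proof.
move=> Ks Kd; have [_ [_ [oOs _ _ _] _] dsj _] := hdom.
have ob := open_simplex_barycenter (fTs Ks).
have [|x [Osx _ ox]] := open_simplex_meets (V := setT) hTs Ks openT.
  by exists (barycenter K); split.
have [|y [Ody Osy _]] := open_simplex_meets (V := Os) hTd Kd oOs.
  by exists x.
by have : (Os `&` Od) y by []; rewrite dsj.
Qed.

Lemma interface_facet_sub K L a x : K \in Ts -> a \in K -> L \in Td ->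
  open_facet K a x -> hull L x -> (K `\ a `<=` L)%fset.
Proof.
move=> KT Ka LT ofx Lx.
have KLx : hull (K `&` L)%fset x.
  by rewrite -(conf KT LT); split=> //;
    have [] := hull_facet_bary (fTs KT) Ka (open_facet_hull (fTs KT) Ka ofx).
have := open_facet_face (fTs KT) Ka (fsubsetIl K L) ofx KLx.
by move=> h; apply: fsubset_trans h (fsubsetIr _ _).
Qed.

(** If a relatively interior point of the facet is in the closure of [Od], conformity puts the whole
    facet in an element of [Td]. Otherwise all such points stay away from [Od] and are limits of
    points outside the closure of [Os], which makes the facet part of both boundaries. *)
Lemma boundary_facet_dichotomy K a : boundary_facet Ts K a ->
  hull (K `\ a)%fset `<=` interface Os Od \/
  hull (K `\ a)%fset `<=` outer_boundary Os Om.
Proof.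
move=> [KT Ka bF]; have fK := fTs KT.
have [_ [[oOm _ _ _] [oOs _ _ _] _] _ cl] := hdom.
have FK x : hull (K `\ a)%fset x -> hull K x.
  by move=> /(hull_facet_bary fK Ka)[].
have [[y oy Ody]|no] := pselect (exists2 y, open_facet K a y & closure Od y).
  left; move=> x Fx; split; first exact: hull_sub_closure hTs KT (FK _ Fx).
  have /(triangulation_cover y hTd)[L [LT _ Ly]] := Ody.
  have KL := interface_facet_sub KT Ka LT oy Ly.
  apply: (hull_sub_closure hTd LT).
  move: Fx => [lam [l0 l1 ->]].
  have := (hull_face_bary (fTd LT) (\sum_(b <- (K `\ a)%fset) lam b *: b) KL).1.
  by case=> //; exists lam.
right.
have key y : open_facet K a y -> ~ nbhs y (closure Os).
  move=> oy ny.
  pose W := [set z | exists L, [/\ L \in Ts, ~ hull L y & hull L z]].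
  have cW : closed W by exact: closed_hulls.
  have oW : open (~` W) by rewrite openC.
  have Wy : (~` W) y by move=> [L [_ nLy Ly]].
  have oV : open (interior (closure Os) `&` ~` W).
    by apply: openI => //; exact: open_interior.
  (* A short step from y away from a crosses the facet, with [bary K a] equal to -t. Elements that
     miss y are avoided by [W], and those that contain y reduce to [K], which misses the new
     point. *)
  have [t [t0 _ [zO zW]]] := near_segment (y - (a - y)) oV (conj ny Wy).
  set z := segment _ _ _ in zO zW.
  have /(triangulation_cover z hTs)[L [LT _ Lz]] := interior_subset zO.
  have Ly : hull L y by apply: contrapT => nLy; apply: zW; exists L.
  have yF := open_facet_hull fK Ka oy.
  have KLy : hull (K `&` L)%fset y.
    by rewrite -(triangulation_conforming hTs KT LT); split=> //; exact: FK.
  have FL := open_facet_face fK Ka (fsubsetIl K L) oy KLy.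
  have LK := bF L LT (fsubset_trans FL (fsubsetIr _ _)).
  have := (hull_bary fK z).1; rewrite -LK => /(_ Lz a); rewrite LK => /(_ Ka).
  rewrite /z /segment [y - _]addrC addrK scalerN -scaleNr baryD slopeZ slopeB.
  rewrite bary_self// oy.1 => h.
  by have : 0 < 0 :> R; [move: h t0; lra|rewrite ltxx].
move=> x Fx.
(* Every open set around x contains relatively interior points of the facet, where [key] applies.
   Used for the interiors of [Os] and of [Om]. *)
have nO (O : set pt) : open O -> (forall y, O y -> nbhs y (closure Om)) -> ~ O x.
  move=> oO hO Ox; have [y [Oy oy]] := open_facet_near fK Ka Fx oO Ox.
  apply: (key y oy).
  have nOd : ~ closure Od y by move=> Ody; apply: no; exists y.
  have : nbhs y (~` closure Od).
    by apply: open_nbhs_nbhs; split=> //; rewrite openC; exact: closed_closure.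
  apply: filterS2 (hO y Oy) => z; rewrite cl => -[//|Odz] nOdz.
  by case: nOdz.
have cOs : closure Os x by exact: hull_sub_closure hTs KT (FK _ Fx).
split; split=> //.
- apply: nO; first exact: open_interior.
  move=> y Oy; apply: filterS Oy => z Oz; rewrite cl; left; exact: subset_closure.
- by rewrite cl; left.
- apply: nO; first exact: open_interior.
  by move=> y Oy; apply: filterS Oy => z Oz; exact: subset_closure.
Qed.

(** Two elements of [Td] on the same facet would lie on opposite sides of it, and both opposite to
    [K]: in [bary_facet_ratio] a negative number would be a product of two negative ones. *)
Lemma interface_facet K a : K \in Ts -> a \in K ->
  hull (K `\ a)%fset `<=` interface Os Od ->
  exists L b, [/\ L \in Td, b \in L, (L `\ b)%fset = (K `\ a)%fset &
    forall L' b', L' \in Td -> b' \in L' -> (L' `\ b')%fset = (K `\ a)%fset ->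
      L' = L /\ b' = b].
Proof.
move=> KT Ka FI; have fK := fTs KT.
have oc := open_facet_center fK Ka.
have [_ /(triangulation_cover _ hTd)[L [LT _ Lc]]] := FI _ (open_facet_hull fK Ka oc).
have KL := interface_facet_sub KT Ka LT oc Lc.
have [b Lb FE] := mem_facet_eq Ka KL fK (fTd LT).
exists L, b; split=> // L' b' L'T L'b' FE'.
have neg M c : M \in Td -> c \in M -> (K `\ a)%fset = (M `\ c)%fset -> bary K a c < 0.
  move=> MT Mc KM; apply: (conforming_opposite fK (fTd MT) Ka Mc KM).
    by apply/eqP => KMe; apply: (mesh_disjoint KT); rewrite KMe.
  exact: conf.
have [LL|LL] := eqVneq L L'.
  split=> //; apply/eqP; apply: contraT => bb.
  have : b' \in (L `\ b)%fset by rewrite !inE bb LL.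
  by rewrite -FE -FE' !inE eqxx.
have FLL : (L `\ b)%fset = (L' `\ b')%fset by rewrite -FE FE'.
have n1 := conforming_opposite (fTd LT) (fTd L'T) Lb L'b' FLL LL
  (triangulation_conforming hTd LT L'T).
have n2 := neg L b LT Lb FE.
have n3 := neg L' b' L'T L'b' (esym FE').
have h (u v w : R) : u < 0 -> v < 0 -> w < 0 -> u = v * w -> False.
  by move=> u0 v0 w0 e; move: u0; rewrite e nmulr_rlt0// ltNge ltW.
by case: (h _ _ _ n3 n1 n2 (bary_facet_ratio b' fK (fTd LT) Ka Lb FE)).
Qed.

End coupled_meshes.

(** * Calculus of polynomial fields *)

Section polynomial_functions.
Context {R : realType} {d : nat}.
Local Notation pt := 'rV[R]_d.
Implicit Types (f g : pt -> R) (v w : pt -> pt).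

(** The degree is left open, as additivity of integrals depends only on the integrand being a
    polynomial. *)
Definition polyf f := exists k, Pk k f.
Definition polyv v := forall i, polyf (fun x => v x 0 i).

Lemma polyf_Pk k f : Pk k f -> polyf f. Proof. by exists k. Qed.

Lemma polyv_Pk k v : poly_vec k v -> polyv v.
Proof. by move=> pv i; exists k; exact: pv. Qed.

Lemma polyf_cst c : polyf (fun=> c).
Proof. by exists 0%N; exact: Pk_cst. Qed.

Lemma polyfD f g : polyf f -> polyf g -> polyf (fun x => f x + g x).
Proof.
move=> [k Pf] [l Pg]; exists (maxn k l).
by apply: PkD; [apply: Pk_leq Pf|apply: Pk_leq Pg]; rewrite ?leq_maxl ?leq_maxr.
Qed.

Lemma polyfM f g : polyf f -> polyf g -> polyf (fun x => f x * g x).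
Proof. by move=> [k Pf] [l Pg]; exists (k + l)%N; exact: PkM. Qed.

Lemma polyfZ c f : polyf f -> polyf (fun x => c * f x).
Proof. exact: polyfM (polyf_cst c). Qed.

Lemma polyfN f : polyf f -> polyf (fun x => - f x).
Proof. by move=> Pf; under eq_fun do rewrite -mulN1r; exact: polyfZ. Qed.

Lemma polyfB f g : polyf f -> polyf g -> polyf (fun x => f x - g x).
Proof. by move=> Pf Pg; apply: polyfD => //; exact: polyfN. Qed.

Lemma polyf_sum I (r : seq I) (F : I -> pt -> R) : (forall i, polyf (F i)) ->
  polyf (fun x => \sum_(i <- r) F i x).
Proof.
move=> PF; elim: r => [|i r IH].
  by under eq_fun do rewrite big_nil; exact: polyf_cst.
by under eq_fun do rewrite big_cons; exact: polyfD.
Qed.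

Lemma polyf_dot v w : polyv v -> polyv w -> polyf (fun x => dot (v x) (w x)).
Proof. by move=> Pv Pw; apply: polyf_sum => i; exact: polyfM. Qed.

Lemma polyv_cst c : polyv (fun=> c).
Proof. by move=> i; exact: polyf_cst. Qed.

Lemma polyvD v w : polyv v -> polyv w -> polyv (fun x => v x + w x).
Proof. by move=> Pv Pw i; under eq_fun do rewrite mxE; exact: polyfD. Qed.

Lemma polyvZ f v : polyf f -> polyv v -> polyv (fun x => f x *: v x).
Proof. by move=> Pf Pv i; under eq_fun do rewrite mxE; exact: polyfM. Qed.

Lemma polyvN v : polyv v -> polyv (fun x => - v x).
Proof. by move=> Pv i; under eq_fun do rewrite mxE; exact: polyfN. Qed.

Lemma polyvB v w : polyv v -> polyv w -> polyv (fun x => v x - w x).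
Proof. by move=> Pv Pw; apply: polyvD => //; exact: polyvN. Qed.

Lemma polyv_tangential c v : polyv v -> polyv (fun x => tangential c (v x)).
Proof.
move=> Pv; apply: polyvB => //; apply: polyvZ; last exact: polyv_cst.
exact: polyf_dot Pv (polyv_cst c).
Qed.

Lemma polyf_gradv v i j : polyv v -> polyf (fun x => gradv v x i j).
Proof.
by move=> /(_ i)[k Pv]; exists k.-1; under eq_fun do rewrite mxE; exact: Pk_derive.
Qed.

Lemma polyf_symgrad v i j : polyv v -> polyf (fun x => symgrad v x i j).
Proof.
move=> Pv; under eq_fun do rewrite mxE; apply: polyfZ.
under eq_fun do rewrite mxE; apply: polyfD; first exact: polyf_gradv.
by under eq_fun do rewrite mxE; exact: polyf_gradv.
Qed.

Lemma polyf_divv v : polyv v -> polyf (fun x => divv v x).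
Proof. by move=> Pv; apply: polyf_sum => i; exact: polyf_gradv. Qed.

Lemma polyf_ddot v w : polyv v -> polyv w ->
  polyf (fun x => ddot (symgrad v x) (symgrad w x)).
Proof.
move=> Pv Pw; apply: polyf_sum => i; apply: polyf_sum => j.
by apply: polyfM; exact: polyf_symgrad.
Qed.

Lemma polyv_traction c v : polyv v -> polyv (fun x => c *m (symgrad v x)^T).
Proof.
move=> Pv i; under eq_fun do rewrite mxE; apply: polyf_sum => j.
apply: polyfM; first exact: polyf_cst.
by under eq_fun do rewrite mxE; exact: polyf_symgrad.
Qed.

Lemma Pk_symgrad k v i j : poly_vec k v -> Pk k (fun x => symgrad v x i j).
Proof.
move=> Pv; under eq_fun do rewrite mxE; apply: PkZ.
have H a b : Pk k (fun x => gradv v x a b).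
  under eq_fun do rewrite mxE.
  by apply: Pk_leq (Pk_derive _ (Pv a)); exact: leq_pred.
under eq_fun do rewrite mxE; apply: PkD; first exact: H.
by under eq_fun do rewrite mxE; exact: H.
Qed.

End polynomial_functions.

Section polynomial_integral_rules.
Context {R : realType} {n : nat}.
Local Notation pt := 'rV[R]_n.+1.
Local Notation simplex := (@simplex R n.+1).
Implicit Types (f g : pt -> R).

Lemma hull_intD K f g : simplex_full K -> polyf f -> polyf g ->
  vol_int (hull K) (fun x => f x + g x) = vol_int (hull K) f + vol_int (hull K) g.
Proof.
by move=> fK [k Pf] [l Pg]; exact: (vol_intD (hull_mbounded fK) Pf Pg).
Qed.

Lemma hull_intZ K c f : simplex_full K -> polyf f ->
  vol_int (hull K) (fun x => c * f x) = c * vol_int (hull K) f.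
Proof. by move=> fK [k Pf]; exact: (vol_intZ _ (hull_mbounded fK) Pf). Qed.

Lemma hull_int_sum K I (r : seq I) (F : I -> pt -> R) : simplex_full K ->
  (forall i, polyf (F i)) ->
  vol_int (hull K) (fun x => \sum_(i <- r) F i x) =
  \sum_(i <- r) vol_int (hull K) (F i).
Proof.
move=> fK PF; elim: r => [|i r IH].
  rewrite big_nil; under eq_fun do rewrite big_nil.
  by rewrite /vol_int Rintegral_cst ?mul0r//; exact: (hull_mbounded fK).1.
rewrite big_cons -IH -hull_intD//; last exact: polyf_sum.
by apply: eq_vol_int => x _; rewrite big_cons.
Qed.

Lemma facet_intD K a f g : simplex_full K -> a \in K -> polyf f -> polyf g ->
  surf_int (K `\ a)%fset (fun x => f x + g x) =
  surf_int (K `\ a)%fset f + surf_int (K `\ a)%fset g.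
Proof.
move=> fK Ka [k Pf] [l Pg]; have [cF aF] := simplex_full_D1 fK Ka.
exact: (surf_intD cF aF Pf Pg).
Qed.

Lemma facet_intZ K a c f : simplex_full K -> a \in K -> polyf f ->
  surf_int (K `\ a)%fset (fun x => c * f x) = c * surf_int (K `\ a)%fset f.
Proof.
move=> fK Ka [k Pf]; have [cF aF] := simplex_full_D1 fK Ka.
exact: (surf_intZ c cF aF Pf).
Qed.

Lemma facet_int_eq K a f g : simplex_full K -> a \in K ->
  (forall x, hull (K `\ a)%fset x -> f x = g x) ->
  surf_int (K `\ a)%fset f = surf_int (K `\ a)%fset g.
Proof.
by move=> fK Ka; have [cF _] := simplex_full_D1 fK Ka; exact: surf_int_eq.
Qed.

Lemma facet_int_ge0 K a f : simplex_full K -> a \in K ->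
  (forall x, hull (K `\ a)%fset x -> 0 <= f x) -> 0 <= surf_int (K `\ a)%fset f.
Proof.
by move=> fK Ka; have [cF _] := simplex_full_D1 fK Ka; exact: surf_int_ge0.
Qed.

Lemma facet_int_le K a f g : simplex_full K -> a \in K -> polyf f -> polyf g ->
  (forall x, hull (K `\ a)%fset x -> f x <= g x) ->
  surf_int (K `\ a)%fset f <= surf_int (K `\ a)%fset g.
Proof.
move=> fK Ka [k Pf] [l Pg]; have [cF aF] := simplex_full_D1 fK Ka.
exact: (surf_int_le cF aF Pf Pg).
Qed.

Lemma facet_int_sum K a I (r : seq I) (F : I -> pt -> R) : simplex_full K ->
  a \in K -> (forall i, polyf (F i)) ->
  surf_int (K `\ a)%fset (fun x => \sum_(i <- r) F i x) =
  \sum_(i <- r) surf_int (K `\ a)%fset (F i).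
Proof.
move=> fK Ka PF; have [cF aF] := simplex_full_D1 fK Ka.
elim: r => [|i r IH].
  by rewrite big_nil; under eq_fun do rewrite big_nil; exact: surf_int0.
rewrite big_cons -IH -facet_intD//; last exact: polyf_sum.
by congr (surf_int _ _); apply/funext => x; rewrite big_cons.
Qed.

End polynomial_integral_rules.

(** * Coercivity *)

Section coercivity.
Context {R : realType} {n : nat}.
Local Notation pt := 'rV[R]_n.+1.
Local Notation simplex := (@simplex R n.+1).

(** From |t x - y|^2 >= 0, divided by t. *)
Lemma dot_young (t : R) (x y : pt) : 0 < t ->
  2 * dot x y <= t * dot x x + t^-1 * dot y y.
Proof.
move=> t0; have := dot_ge0 (t *: x - y).
rewrite dotBl !dotBr !dotZl !dotZr (dotC y x) => h.
rewrite -(ler_pM2l t0) mulrDr mulrA mulVKf ?gt_eqF//; lra.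
Qed.

(** Cauchy-Schwarz on each row of [A], from the square of its component orthogonal to the unit
    vector [v]. *)
Lemma traction_le (v : pt) (A : 'M[R]_n.+1) : dot v v = 1 ->
  dot (v *m A^T) (v *m A^T) <= ddot A A.
Proof.
move=> v1; apply: ler_sum => i _.
have -> : (v *m A^T) 0 i = dot v (row i A).
  by rewrite mxE; apply: eq_bigr => j _; rewrite !mxE.
have -> : \sum_j A i j * A i j = dot (row i A) (row i A).
  by apply: eq_bigr => j _; rewrite mxE.
set r := row i A; set c := dot v r.
have := dot_ge0 (r - c *: v).
by rewrite dotBl !dotBr !dotZl !dotZr (dotC r v) -/c v1; lra.
Qed.

Lemma ddot_ge0 (A : 'M[R]_n.+1) : 0 <= ddot A A.
Proof. by apply: sumr_ge0 => i _; apply: sumr_ge0 => j _; rewrite -expr2 sqr_ge0. Qed.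

Variables (k : nat) (theta C : R).
Hypotheses (theta0 : 0 < theta) (C0 : 0 < C).
Hypothesis traceC : forall (K : simplex) a (w : pt -> R), simplex_full K -> a \in K ->
  Pk k w -> height K a * surf_int (K `\ a)%fset (fun x => w x * w x) <=
  C * vol_int (hull K) (fun x => w x * w x).

(** The trace inequality for each entry of the strain, with the height bounded below by the diameter
    over theta. *)
Lemma strain_trace (K : simplex) a (v : pt -> pt) : simplex_full K -> a \in K ->
  diameter K <= theta * indiameter K -> poly_vec k v ->
  diameter K * surf_int (K `\ a)%fset (fun x => ddot (symgrad v x) (symgrad v x)) <=
  theta * C * vol_int (hull K) (fun x => ddot (symgrad v x) (symgrad v x)).
Proof.
move=> fK Ka hK Pv; have Pp := polyv_Pk Pv.
have Pe i j : polyf (fun x => symgrad v x i j * symgrad v x i j).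
  by apply: polyfM; exact: polyf_symgrad.
have Pes i : polyf (fun x => \sum_j symgrad v x i j * symgrad v x i j).
  by apply: polyf_sum => j; exact: Pe.
rewrite /ddot (facet_int_sum _ fK Ka Pes) (hull_int_sum _ fK Pes) !mulr_sumr.
apply: ler_sum => i _.
rewrite (facet_int_sum _ fK Ka (Pe i)) (hull_int_sum _ fK (Pe i)) !mulr_sumr.
apply: ler_sum => j _.
set S := surf_int _ _; have S0 : 0 <= S.
  by apply: facet_int_ge0 => // x _; rewrite -expr2 sqr_ge0.
apply: (@le_trans _ _ (theta * (height K a * S))).
  rewrite mulrA ler_wpM2r// (le_trans hK)// ler_wpM2l ?(ltW theta0)//.
  exact: indiameter_le_height.
rewrite -mulrA ler_wpM2l ?(ltW theta0)//.
exact: traceC fK Ka (Pk_symgrad i j Pv).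
Qed.

(** The n + 2 facets of an element share a quarter of the strain term 2 mu V for each of the two
    consistency terms: with weight h / b in Young's inequality, one facet costs theta C V / b = V /
    (2 (n + 2)). *)
Definition beta_threshold : R := 2 * n.+2%:R * theta * C.

Lemma beta_threshold_gt0 : 0 < beta_threshold.
Proof. by rewrite /beta_threshold !mulr_gt0// ltr0n. Qed.

(** [D a] stands for the jump of the velocity on the facet opposite to a, and the repeated sum for
    the consistency term and its transpose. Half of the strain energy absorbs both, and the excess
    of [beta] over the threshold controls the jumps. *)
Lemma element_coercive (K : simplex) (v : pt -> pt) (D : pt -> pt -> pt) mu beta :
  simplex_full K -> diameter K <= theta * indiameter K -> poly_vec k v ->
  (forall a, a \in K -> polyv (D a)) -> 0 < mu ->
  mu * vol_int (hull K) (fun x => ddot (symgrad v x) (symgrad v x)) +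
    \sum_(a <- K) 2 * (beta - beta_threshold) * mu * (diameter K)^-1 *
      surf_int (K `\ a)%fset (fun x => dot (D a x) (D a x)) <=
  vol_int (hull K) (fun x => 2 * mu * ddot (symgrad v x) (symgrad v x)) -
  \sum_(a <- K) surf_int (K `\ a)%fset (fun x =>
     2 * mu * dot (normal K a *m (symgrad v x)^T) (D a x)) -
  \sum_(a <- K) surf_int (K `\ a)%fset (fun x =>
     2 * mu * dot (normal K a *m (symgrad v x)^T) (D a x)) +
  \sum_(a <- K) surf_int (K `\ a)%fset (fun x =>
     2 * beta * mu * (diameter K)^-1 * dot (D a x) (D a x)).
Proof.
move=> fK hK Pv PD mu0; have Pp := polyv_Pk Pv.
set V := vol_int (hull K) (fun x => ddot (symgrad v x) (symgrad v x)).
have h0 := diameter_gt0 fK; set h := diameter K in h0 hK *.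
have b0 := beta_threshold_gt0; set b := beta_threshold in b0 *.
have PDD a : a \in K -> polyf (fun x => dot (D a x) (D a x)).
  by move=> Ka; apply: polyf_dot; exact: PD.
have PT a : a \in K -> polyf (fun x => dot (normal K a *m (symgrad v x)^T) (D a x)).
  by move=> Ka; apply: polyf_dot; [exact: polyv_traction|exact: PD].
have PE := polyf_ddot Pp Pp.
rewrite (hull_intZ _ fK PE) -/V.
pose S a := surf_int (K `\ a)%fset (fun x => dot (D a x) (D a x)).
pose T a := surf_int (K `\ a)%fset
  (fun x => dot (normal K a *m (symgrad v x)^T) (D a x)).
(* Young's inequality with weight h / b, then the trace bound for the strain. *)
have TS a : a \in K -> 2 * T a <= n.+2%:R^-1 * V / 2 + b * h^-1 * S a.
  move=> Ka; have [n1 _ _] := is_normal_normal fK Ka.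
  have hb0 : 0 < h * b^-1 by rewrite mulr_gt0 ?invr_gt0.
  rewrite /T -(facet_intZ 2 fK Ka (PT a Ka)).
  apply: (@le_trans _ _ (surf_int (K `\ a)%fset (fun x =>
     h * b^-1 * ddot (symgrad v x) (symgrad v x) + b * h^-1 * dot (D a x) (D a x)))).
    apply: facet_int_le => //.
    - exact/polyfZ/PT.
    - by apply: polyfD; apply: polyfZ => //; exact: PDD.
    - move=> x _; apply: (le_trans (dot_young _ _ hb0)).
      rewrite invf_div lerD2r ler_wpM2l ?(ltW hb0)//.
      exact: traction_le.
  rewrite (facet_intD fK Ka (polyfZ _ PE) (polyfZ _ (PDD a Ka))).
  rewrite (facet_intZ _ fK Ka PE) (facet_intZ _ fK Ka (PDD a Ka)) lerD2r.
  rewrite mulrAC; apply: (@le_trans _ _ (theta * C * V * b^-1)).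
    by rewrite ler_wpM2r ?invr_ge0 ?(ltW b0)//; exact: strain_trace.
  rewrite le_eqVlt; apply/orP; left; apply/eqP; rewrite /b /beta_threshold.
  have t0 : theta != 0 by rewrite gt_eqF.
  have c0 : C != 0 by rewrite gt_eqF.
  have : (n.+2%:R : R) != 0 by rewrite pnatr_eq0.
  by move: (n.+2%:R : R) => N N0; field; rewrite c0 t0 N0.
have -> : \sum_(a <- K) surf_int (K `\ a)%fset (fun x =>
     2 * mu * dot (normal K a *m (symgrad v x)^T) (D a x)) = \sum_(a <- K) 2 * mu * T a.
  rewrite big_seq [RHS]big_seq; apply: eq_bigr => a Ka.
  by rewrite (facet_intZ _ fK Ka (PT a Ka)).
have -> : \sum_(a <- K) surf_int (K `\ a)%fset (fun x =>
     2 * beta * mu * h^-1 * dot (D a x) (D a x)) =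
     \sum_(a <- K) 2 * beta * mu * h^-1 * S a.
  rewrite big_seq [RHS]big_seq; apply: eq_bigr => a Ka.
  by rewrite (facet_intZ _ fK Ka (PDD a Ka)).
have key : \sum_(a <- K) 2 * T a <= V / 2 + \sum_(a <- K) b * h^-1 * S a.
  have -> : V / 2 = \sum_(a <- K) n.+2%:R^-1 * V / 2.
    rewrite big_const_seq count_predT -[size _]/(#|` K|) fK.1 iter_addr addr0.
    rewrite -[RHS]mulr_natl; have : (n.+2%:R : R) != 0 by rewrite pnatr_eq0.
    by move: (n.+2%:R : R) => N N0; field.
  rewrite -big_split /= big_seq [leRHS]big_seq; apply: ler_sum => a Ka; exact: TS.
move: key; rewrite -!mulr_sumr => key.
set ST := \sum_(a <- K) T a in key *; set SS := \sum_(a <- K) S a in key *.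
have := ler_wpM2l (ltW mu0) key; move: (h^-1) => hi.
lra.
Qed.

End coercivity.

(** * Rigid motions *)

Section rigid_motions.
Context {R : realType} {n : nat}.
Local Notation pt := 'rV[R]_n.+1.
Local Notation simplex := (@simplex R n.+1).

Lemma constant_along k (p : pt -> R) z x : Pk k p ->
  (forall y, 'D_z p y = 0) -> p (x + z) = p x.
Proof.
move=> Pp p0; have [q hq] := Pk_line x z Pp.
have q0 t : q^`().[t] = 0 by rewrite -(derivative_line t Pp hq).
have := FTC_poly q (ler01 : 0 <= 1 :> R).
under eq_integral do rewrite q0.
rewrite integral0 => -[/eqP]; rewrite eq_sym subr_eq0 -!hq scale1r scale0r.
by rewrite addr0 => /eqP.
Qed.

(** x -> m . (x - y0) is affine and vanishes on the facet, so it is a multiple of [bary K a]; a zero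
    off the facet plane makes it vanish everywhere. *)
Lemma affine_functional_zero (K : simplex) a (m y0 z : pt) :
  simplex_full K -> a \in K ->
  (forall c, c \in (K `\ a)%fset -> dot m (c - y0) = 0) ->
  bary K a z != 0 -> dot m (z - y0) = 0 -> m = 0.
Proof.
move=> fK Ka hF za hz.
have aff x : dot m (x - y0) = bary K a x * dot m (a - y0).
  have -> : x - y0 = \sum_(b <- K) bary K b x *: (b - y0).
    under eq_bigr do rewrite scalerBr.
    by rewrite sumrB -bary_comb// -scaler_suml bary_sum// scale1r.
  rewrite dot_sumr (big_fsetD1 a)//= dotZr big_seq big1 ?addr0// => c cF.
  by rewrite dotZr hF// mulr0.
have ma : dot m (a - y0) = 0.
  by apply: (mulfI za); rewrite -(aff z) hz mulr0.
apply: dot_eq0; have := aff (y0 + m); rewrite ma mulr0.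
by rewrite addrAC subrr add0r.
Qed.

(** The derivative of v . z in the direction z is the quadratic form of the gradient at z, which is
    0 for an antisymmetric gradient. *)
Lemma rigid_motion k (v : pt -> pt) x y : poly_vec k v ->
  (forall x, symgrad v x = 0) -> dot (v y) (y - x) = dot (v x) (y - x).
Proof.
move=> Pv e0.
have [z zE] : exists z, y - x = z by exists (y - x).
rewrite zE.
have Pg : Pk k (fun x => dot (v x) z).
  by apply: Pk_sum => i _; under eq_fun do rewrite mulrC; apply: PkZ; exact: Pv.
have -> : y = x + z by rewrite -zE subrKC.
apply: (constant_along x Pg) => w.
have dz i : 'D_z (fun x => v x 0 i) w = \sum_j z 0 j * gradv v w i j.
  rewrite [z in LHS]row_sum_delta (derive_lincomb _ _ _ _ (Pv i)).
  by apply: eq_bigr => j _; rewrite /gradv [in RHS]mxE.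
have -> : 'D_z (fun x => dot (v x) z) w = \sum_i z 0 i * 'D_z (fun x => v x 0 i) w.
  rewrite /dot; elim: (index_enum _) => [|i r IH].
    by rewrite big_nil; under eq_fun do rewrite big_nil; rewrite derive_cst0.
  rewrite big_cons -IH -(Pk_deriveZ _ _ _ (Pv i)).
  under eq_fun do rewrite big_cons mulrC.
  apply: (Pk_deriveD (k := k) (l := k)); first exact: PkZ.
  by apply: Pk_sum => j _; under eq_fun do rewrite mulrC; apply: PkZ; exact: Pv.
under eq_bigr do rewrite dz.
have sym i j : gradv v w i j + gradv v w j i = 0.
  have /matrixP/(_ i j) := e0 w; rewrite !mxE => /eqP.
  by rewrite mulf_eq0 invr_eq0 pnatr_eq0 /= => /eqP.
set G := \sum_i _.
have GE : G = \sum_i \sum_j z 0 i * z 0 j * gradv v w i j.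
  by apply: eq_bigr => i _; rewrite mulr_sumr; apply: eq_bigr => j _; rewrite mulrA.
have GT : G = \sum_i \sum_j z 0 i * z 0 j * gradv v w j i.
  rewrite GE exchange_big; apply: eq_bigr => i _; apply: eq_bigr => j _.
  by rewrite [z 0 j * _]mulrC.
have GG : G + G = 0.
  rewrite {1}GE GT -big_split big1// => i _; rewrite -big_split big1// => j _.
  by rewrite /= -mulrDr sym mulr0.
by move: GG; lra.
Qed.

(** At an interior point y, [rigid_motion] makes v(y) orthogonal to y - c for every vertex c of the
    facet, and these vectors span the space. *)
Lemma rigid_zero k (K : simplex) a (v : pt -> pt) : simplex_full K -> a \in K ->
  poly_vec k v -> (forall x, symgrad v x = 0) ->
  (forall x, hull (K `\ a)%fset x -> v x = 0) -> forall x, v x = 0.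
Proof.
move=> fK Ka Pv e0 v0 x; apply/rowP => i; rewrite [RHS]mxE.
apply: (poly_zero_open (Pv i) (@open_open_simplex _ _ K)) x => [|y oy].
  by exists (barycenter K); exact: open_simplex_barycenter.
have vc c : c \in (K `\ a)%fset -> dot (v y) (y - c) = 0.
  by move=> cF; rewrite (rigid_motion _ _ Pv e0) v0 ?dot0l//; exact: vertex_hull.
suff -> : v y = 0 by rewrite mxE.
have [c cF] : exists c, c \in (K `\ a)%fset.
  by exists ((enum_fset (K `\ a)%fset)`_0); apply: (base_in fK Ka).
apply: (@affine_functional_zero K a (v y) c y) => //.
- move=> d dF; have := vc d dF; have := vc c cF; rewrite !dotBr => h1 h2.
  by move: h1 h2; lra.
- by rewrite gt_eqF// oy.
- exact: vc.
Qed.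

Lemma psum_eq0 (I : eqType) (r : seq I) (F : I -> R) :
  (forall i, i \in r -> 0 <= F i) -> \sum_(i <- r) F i = 0 ->
  forall i, i \in r -> F i = 0.
Proof.
move=> F0; rewrite big_seq => /eqP; rewrite psumr_eq0; last exact: F0.
by move=> /allP h i ir; have := h i ir; rewrite ir => /eqP.
Qed.

End rigid_motions.

Section mesh_pressure.
Context {R : realType} {n : nat}.
Local Notation pt := 'rV[R]_n.+1.
Local Notation simplex := (@simplex R n.+1).
Local Notation mesh := (@mesh R n.+1).

Lemma hull_volume_gt0 (K : simplex) : simplex_full K ->
  0 < vol_int (hull K) (fun=> 1).
Proof.
move=> fK; rewrite lt_neqAle eq_sym vol_int_ge0 ?andbT//; apply/eqP => i0.
have /(_ _ 0)/eqP := hull_int_eq0 fK (Pk_cst _ 0%N 1) _ i0.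
by rewrite oner_eq0 => H; have : false by apply: H => x _; exact: ler01.
Qed.

(** Adjacent elements have equal constants since both agree with the single-valued [pb] on the
    common facet. *)
Lemma mesh_pressure_const (O : set pt) (T : mesh) k (p pb : @sfield R n.+1) :
  (1 <= k)%N -> open O -> connected O -> triangulation O T ->
  (exists K, K \in T) ->
  (forall K, K \in T -> Pk k.-1 (p K)) -> Qbarh k T pb ->
  (forall K, K \in T -> forall w, poly_vec k w ->
     - vol_int (hull K) (fun x => p K x * divv w x) +
     \sum_(a <- K) surf_int (K `\ a)%fset
       (fun x => pb (K `\ a)%fset x * dot (w x) (normal K a)) = 0) ->
  exists c, (forall K x, K \in T -> p K x = c) /\
    forall F x, is_facet T F -> hull F x -> pb F x = c.
Proof.
move=> k1 oO cO hT [K0 K0T] Pp Ppb orth.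
have fT K : K \in T -> simplex_full K := triangulation_full hT.
have Pb K a : K \in T -> a \in K -> Pk k (pb (K `\ a)%fset).
  by move=> KT Ka; apply: Ppb; exists K, a.
have pc K : K \in T -> exists c, p K = fun=> c.
  move=> KT; apply: (@pressure_const _ _ K (fT K KT) k (p K)
    (fun a => pb (K `\ a)%fset) k1 (Pp K KT)).
    by move=> a Ka; exact: Pb.
  exact: orth.
have pf K a x : K \in T -> a \in K -> hull (K `\ a)%fset x ->
    pb (K `\ a)%fset x = p K x.
  move=> KT Ka Fx; apply: (@facet_pressure _ _ K (fT K KT) k (p K)
    (fun a => pb (K `\ a)%fset) k1 (Pp K KT)) => //.
    by move=> b Kb; exact: Pb.
  exact: orth.
have [c cE] := pc K0 K0T; exists c.
have all_c K : K \in T -> p K = fun=> c.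
  apply: (facet_connected (S := fun K => p K = fun=> c) oO cO hT).
    by exists K0.
  move=> K1 L1 K1T L1T pK [a [b [Ka Lb KL]]].
  have [d dE] := pc L1 L1T; rewrite dE; apply/funext => _.
  have Fx := open_facet_hull (fT _ K1T) Ka (open_facet_center (fT _ K1T) Ka).
  have := pf K1 a _ K1T Ka Fx; rewrite pK => <-.
  by rewrite KL pf// ?dE// -KL.
split=> [K x KT|F x [K [a [KT Ka ->]]] Fx]; first by rewrite all_c.
by rewrite pf// all_c.
Qed.

End mesh_pressure.

(** * Reduction to finite dimension *)

Section finite_reduction.
Context {R : realType}.

(** [P] is an arbitrary set of rows; a family of maximal rank in it spans it. *)
Lemma row_span N (P : 'rV[R]_N -> Prop) : exists r (B : 'M[R]_(r, N)),
  (forall i, P (row i B)) /\ forall x, P x -> (x <= B)%MS.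
Proof.
pose Q m := exists r (B : 'M[R]_(r, N)), (forall i, P (row i B)) /\ \rank B = m.
have Q0 : exists m, `[< Q m >].
  by exists 0%N; apply/asboolP; exists 0%N, 0; split=> [[]//|]; rewrite mxrank0.
have QN m : `[< Q m >] -> (m <= N)%N.
  by move=> /asboolP[r [B [_ <-]]]; exact: rank_leq_col.
case: (ex_maxnP Q0 QN) => m /asboolP[r [B [PB rB]]] max.
exists r, B; split=> // x Px; apply: contraT => xB.
have : (m < \rank (B + x)%MS)%N.
  rewrite -rB ltnNge; apply/negP => le.
  have /eqP : \rank B == \rank (B + x)%MS.
    by rewrite eqn_leq le andbT mxrankS// addsmxSl.
  move=> /eqP e; have := mxrank_leqif_sup (addsmxSl B x).
  by move=> [_]; rewrite e => /esym; rewrite addsmx_sub (negPf xB) andbF.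
move=> lt; have := max (\rank (B + x)%MS); rewrite leqNgt lt => /(_ _)/negP[]//.
apply/asboolP; exists (r + 1)%N, (col_mx B x); split; last by rewrite addsmxE.
move=> i; case: (split_ordP i) => j ->.
  by rewrite (_ : row _ _ = row j B) ?PB//; apply/rowP => l; rewrite !mxE (unsplitK (inl j)).
rewrite (_ : row _ _ = x) //; apply/rowP => l.
by rewrite !mxE (unsplitK (inr j)) ord1.
Qed.

(** The evaluations at points of [A] live in a finite-dimensional space, so finitely many of them
    span the others. These points serve as degrees of freedom on [A]. *)
Lemma Pk_unisolvent d k (A : set 'rV[R]_d) : exists N (x : 'I_N -> 'rV[R]_d),
  (forall i, A (x i)) /\ forall p, Pk k p -> (forall i, p (x i) = 0) ->
    forall y, A y -> p y = 0.
Proof.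
have [N [m [_ span]]] := @Pk_basis R d k.
pose ev x : 'rV[R]_N := \row_i m i x.
have [r [B [BA AB]]] := row_span (fun v => exists2 x, A x & v = ev x).
pose x i := sval (cid2 (BA i)).
have xA i : A (x i) by rewrite /x; case: cid2.
have xB i : row i B = ev (x i) by rewrite /x; case: cid2.
exists r, x; split=> // p /span[c ->] p0 y Ay.
have /submxP[z yE] : (ev y <= B)%MS by apply: AB; exists y.
have evE w : \sum_i c i * m i w = (ev w *m \col_i c i) 0 0.
  by rewrite mxE; apply: eq_bigr => i _; rewrite !mxE mulrC.
rewrite evE yE -mulmxA (_ : B *m _ = 0) ?mulmx0 ?mxE//.
apply/row_matrixP => i; rewrite row_mul xB row0; apply/rowP => j.
by rewrite ord1 -evE p0 mxE.
Qed.

Section separation.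
Variables (V : lmodType R) (S : V -> Prop).

(** Expresses that [S] modulo [Z] is finite-dimensional without forming a quotient. *)
Definition finitely_separated (Z : V -> Prop) := exists (I : finType) (phi : I -> V -> R),
  (forall i c v w, phi i (c *: v + w) = c * phi i v + phi i w) /\
  forall v, S v -> (forall i, phi i v = 0) -> Z v.

Lemma separated_and Z1 Z2 : finitely_separated Z1 -> finitely_separated Z2 ->
  finitely_separated (fun v => Z1 v /\ Z2 v).
Proof.
move=> [I [f [fl fZ]]] [J [g [gl gZ]]].
exists (I + J)%type, (fun i => match i with inl i => f i | inr j => g j end).
split=> [[i|j]|v Sv h]; [exact: fl|exact: gl|split].
  by apply: fZ => // i; exact: (h (inl i)).
by apply: gZ => // j; exact: (h (inr j)).
Qed.

Lemma separated_all (J : eqType) (s : seq J) (Z : J -> V -> Prop) :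
  (forall j, j \in s -> finitely_separated (Z j)) ->
  finitely_separated (fun v => forall j, j \in s -> Z j v).
Proof.
elim: s => [_|j s IH h].
  by exists void, (fun _ _ => 0); split=> [[]|v _ _ j].
have [I [phi [phil phiZ]]] := separated_and (h j (mem_head _ _))
  (IH (fun i is_ => h i (mem_behead (s := j :: s) is_))).
exists I, phi; split=> // v Sv v0 i; have [hj hs] := phiZ v Sv v0.
by rewrite in_cons => /orP[/eqP->|/hs].
Qed.

Hypothesis S_lin : forall c v w, S v -> S w -> S (c *: v + w).
Hypothesis S0 : S 0.

Lemma closed_lincomb_sum N (e : 'I_N -> V) (c : 'I_N -> R) : (forall i, S (e i)) ->
  S (\sum_i c i *: e i).
Proof. by move=> Se; elim/big_rec: _ => // i x _ Sx; exact: S_lin. Qed.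

(** Choose elements of [S] whose functional values span those of all of [S]; the remainder of v is
    then killed by every functional. *)
Lemma finite_reduction Z : finitely_separated Z -> exists N (e : 'I_N -> V),
  (forall i, S (e i)) /\
  forall v, S v -> exists c : 'I_N -> R, Z (v - \sum_i c i *: e i).
Proof.
move=> [I [phi [phil phiZ]]].
pose Phi v : 'rV[R]_#|I| := \row_i phi (enum_val i) v.
have PhiL c v w : Phi (c *: v + w) = c *: Phi v + Phi w.
  by apply/rowP => i; rewrite !mxE phil.
have Phi0 : Phi 0 = 0.
  by have := PhiL (-1) 0 0; rewrite scaler0 addr0 scaleN1r addNr.
have [r [B [BS SB]]] := row_span (fun u => exists2 v, S v & u = Phi v).
pose e i := sval (cid2 (BS i)).
have eS i : S (e i) by rewrite /e; case: cid2.
have eB i : row i B = Phi (e i) by rewrite /e; case: cid2.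
exists r, e; split=> // v Sv.
have /submxP[y yE] : (Phi v <= B)%MS by apply: SB; exists v.
exists (y 0).
have PhiS (c : 'I_r -> R) : Phi (\sum_i c i *: e i) = \sum_i c i *: Phi (e i).
  by elim/big_rec2: _ => // i a b _ <-; rewrite PhiL.
have : Phi (v - \sum_i y 0 i *: e i) = 0.
  rewrite addrC -scaleN1r PhiL PhiS yE mulmx_sum_row scaleN1r.
  by under eq_bigr do rewrite -eB; rewrite addNr.
move=> /rowP h; apply: phiZ => [|i].
  by rewrite addrC -scaleN1r; apply: S_lin => //; exact: closed_lincomb_sum.
by have := h (enum_rank i); rewrite !mxE enum_rankK.
Qed.

(* A symmetric bilinear form whose left kernel in S consists of null vectors
   represents every functional that vanishes on null vectors. *)
Lemma symmetric_existence (Z : V -> Prop) (B : V -> V -> R) (l : V -> R) :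
  finitely_separated Z ->
  (forall v w, B v w = B w v) ->
  (forall c v w z, S v -> S w -> S z -> B (c *: v + w) z = c * B v z + B w z) ->
  (forall v z, S v -> S z -> Z z -> B z v = 0) ->
  (forall c v w, S v -> S w -> l (c *: v + w) = c * l v + l w) ->
  (forall z, S z -> Z z -> l z = 0) ->
  (forall v, S v -> (forall w, S w -> B v w = 0) -> Z v) ->
  exists2 v, S v & forall w, S w -> B v w = l w.
Proof.
move=> sZ sB BL BZ lL lZ inj.
have [N [e [eS spanS]]] := finite_reduction sZ.
have B0 z : S z -> B 0 z = 0.
  move=> Sz; have := BL (-1) 0 0 z S0 S0 Sz; rewrite scaler0 addr0; lra.
have l0 : l 0 = 0 by have := lL (-1) 0 0 S0 S0; rewrite scaler0 addr0; lra.
have BS (c : 'I_N -> R) z : S z -> B (\sum_i c i *: e i) z = \sum_i c i * B (e i) z.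
  move=> Sz.
  suff [] : B (\sum_i c i *: e i) z = \sum_i c i * B (e i) z /\
    S (\sum_i c i *: e i) by [].
  elim/big_rec2: _ => [|i a b _ [<- Sb]]; first by split=> //; exact: B0.
  by split; [rewrite BL|exact: S_lin].
have lS (c : 'I_N -> R) : l (\sum_i c i *: e i) = \sum_i c i * l (e i).
  suff [] : l (\sum_i c i *: e i) = \sum_i c i * l (e i) /\
    S (\sum_i c i *: e i) by [].
  elim/big_rec2: _ => [|i a b _ [<- Sb]]; first by split.
  by split; [rewrite lL|exact: S_lin].
have decomp w : S w -> exists (c : 'I_N -> R) z,
    [/\ S z, Z z & w = \sum_i c i *: e i + z].
  move=> Sw; have [c cZ] := spanS w Sw; exists c, (w - \sum_i c i *: e i).
  split=> //; last by rewrite addrC subrK.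
  by rewrite addrC -scaleN1r; apply: S_lin => //; exact: closed_lincomb_sum.
have Bw v w : S v -> S w -> (forall j, B v (e j) = 0) -> B v w = 0.
  move=> Sv Sw h; have [c [z [Sz Zz ->]]] := decomp w Sw.
  have Sc := closed_lincomb_sum c eS.
  rewrite sB -[\sum_i _]scale1r BL// (BZ v z)// addr0 mul1r BS// big1// => i _.
  by rewrite sB h mulr0.
(* Gram matrix of the representatives. A kernel row gives a null vector by injectivity, the load
   vanishes on it, and the Fredholm alternative applies. *)
pose A : 'M[R]_N := \matrix_(i, j) B (e i) (e j).
have [] := @symmetric_solve _ N A (\row_j l (e j)).
- by apply/matrixP => i j; rewrite !mxE sB.
- move=> x xA; set v := \sum_i x 0 i *: e i.
  have Sv : S v by exact: closed_lincomb_sum.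
  have Zv : Z v.
    apply: inj => // w Sw; apply: Bw => // j.
    rewrite BS//; move/rowP: xA => /(_ j); rewrite !mxE => xA.
    by rewrite -[RHS]xA; apply: eq_bigr => i _; rewrite mxE.
  apply/rowP => j; rewrite ord1 !mxE.
  have := lZ v Sv Zv; rewrite /v lS => l0'; rewrite -[RHS]l0'.
  by apply: eq_bigr => i _; rewrite !mxE.
- move=> y yA; exists (\sum_i y 0 i *: e i); first exact: closed_lincomb_sum.
  move=> w Sw; have [c [z [Sz Zz wE]]] := decomp w Sw.
  have Sc := closed_lincomb_sum c eS; have Sy := closed_lincomb_sum (y 0) eS.
  rewrite wE sB -[\sum_i c i *: _]scale1r BL// (BZ _ z)// lL// (lZ z)// !mul1r !addr0.
  rewrite BS// lS; apply: eq_bigr => j _; rewrite sB BS//.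
  move/rowP: yA => /(_ j); rewrite !mxE => <-.
  by congr (_ * _); apply: eq_bigr => i _; rewrite mxE.
Qed.

End separation.
End finite_reduction.

(** * Linearity of the integrals and of the forms *)

Section linear_functionals.
Context {R : realType} {n : nat}.
Local Notation pt := 'rV[R]_n.+1.
Local Notation simplex := (@simplex R n.+1).
Variables (V : lmodType R) (S : V -> Prop).

(** Relative to [S], because integrals are additive on polynomial fields and not on arbitrary
    ones. *)
Definition lin (phi : V -> R) := forall c v w, S v -> S w ->
  phi (c *: v + w) = c * phi v + phi w.

Definition lin_family (f : V -> pt -> R) := (forall v, S v -> polyf (f v)) /\
  forall c v w, S v -> S w -> forall x, f (c *: v + w) x = c * f v x + f w x.

Lemma linD f g : lin f -> lin g -> lin (fun v => f v + g v).
Proof. by move=> lf lg c v w Sv Sw; rewrite lf// lg//; ring. Qed.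

Lemma linN f : lin f -> lin (fun v => - f v).
Proof. by move=> lf c v w Sv Sw; rewrite lf//; ring. Qed.

Lemma linB f g : lin f -> lin g -> lin (fun v => f v - g v).
Proof. by move=> lf lg; apply: linD => //; exact: linN. Qed.

Lemma lin_sum (I : eqType) (r : seq I) (P : pred I) (f : I -> V -> R) :
  (forall i, i \in r -> P i -> lin (f i)) ->
  lin (fun v => \sum_(i <- r | P i) f i v).
Proof.
move=> lf c v w Sv Sw; rewrite mulr_sumr -big_split [LHS]big_seq_cond [RHS]big_seq_cond.
by apply: eq_bigr => i /andP[ir Pi]; exact: lf.
Qed.

Lemma lin_hull K f : simplex_full K -> lin_family f ->
  lin (fun v => vol_int (hull K) (f v)).
Proof.
move=> fK [Pf lf] c v w Sv Sw.
rewrite -hull_intZ -?hull_intD//; [|exact: polyfZ (Pf v Sv)|exact: Pf|exact: Pf].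
by apply: eq_vol_int => x _; exact: lf.
Qed.

Lemma lin_facet K a f : simplex_full K -> a \in K -> lin_family f ->
  lin (fun v => surf_int (K `\ a)%fset (f v)).
Proof.
move=> fK Ka [Pf lf] c v w Sv Sw.
rewrite -facet_intZ -?facet_intD//; [|exact: polyfZ (Pf v Sv)|exact: Pf|exact: Pf].
by apply: facet_int_eq => // x _; exact: lf.
Qed.

End linear_functionals.

Section linear_gradient.
Context {R : realType} {d : nat}.
Local Notation pt := 'rV[R]_d.

Lemma gradv_lincomb c (v w : pt -> pt) x : polyv v -> polyv w ->
  gradv (fun y => c *: v y + w y) x = c *: gradv v x + gradv w x.
Proof.
move=> Pv Pw; apply/matrixP => i j; rewrite !mxE.
have [[k Pi] [l Qi]] := (Pv i, Pw i).
rewrite (_ : (fun y => (c *: v y + w y) 0 i) = fun y => c * v y 0 i + w y 0 i).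
  by rewrite (Pk_deriveD _ _ (PkZ c Pi) Qi) (Pk_deriveZ _ c _ Pi).
by apply/funext => y; rewrite mxE [in LHS]mxE.
Qed.

Lemma symgrad_lincomb c (v w : pt -> pt) x : polyv v -> polyv w ->
  symgrad (fun y => c *: v y + w y) x = c *: symgrad v x + symgrad w x.
Proof.
move=> Pv Pw; rewrite /symgrad gradv_lincomb//.
move: (gradv v x) (gradv w x) => A B.
by apply/matrixP => i j; rewrite !mxE; ring.
Qed.

Lemma divv_lincomb c (v w : pt -> pt) x : polyv v -> polyv w ->
  divv (fun y => c *: v y + w y) x = c * divv v x + divv w x.
Proof. by move=> Pv Pw; rewrite /divv gradv_lincomb// mxtraceD mxtraceZ. Qed.

Lemma ddot_lincomb c (A B C : 'M[R]_d) :
  ddot (c *: A + B) C = c * ddot A C + ddot B C.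
Proof.
rewrite /ddot mulr_sumr -big_split; apply: eq_bigr => i _.
rewrite mulr_sumr -big_split; apply: eq_bigr => j _ /=.
by rewrite !mxE; ring.
Qed.

Lemma ddotC (A B : 'M[R]_d) : ddot A B = ddot B A.
Proof. by apply: eq_bigr => i _; apply: eq_bigr => j _; rewrite mulrC. Qed.

Lemma dot_lincomb c (x y z : pt) : dot (c *: x + y) z = c * dot x z + dot y z.
Proof. by rewrite dotDl dotZl. Qed.

Lemma tangential_lincomb c (m x y : pt) :
  tangential m (c *: x + y) = c *: tangential m x + tangential m y.
Proof.
by rewrite /tangential dot_lincomb; apply/rowP => i; rewrite !mxE; ring.
Qed.

Lemma traction_lincomb c (m : pt) (A B : 'M[R]_d) :
  m *m (c *: A + B)^T = c *: (m *m A^T) + m *m B^T.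
Proof. by rewrite linearD linearZ/= mulmxDr -scalemxAr. Qed.

End linear_gradient.

Section states.
Context {R : realType} {n : nat}.
Local Notation pt := 'rV[R]_n.+1.
Local Notation simplex := (@simplex R n.+1).

(* The fields (v, \bar v, v^m, (q, \bar q^s, \bar q^d, q^m, \bar q^m)). *)
Definition state : lmodType R :=
  ((simplex -> pt -> pt) * (simplex -> pt -> pt) * (simplex -> pt -> pt) *
   ((simplex -> pt -> R) * (simplex -> pt -> R) * (simplex -> pt -> R) *
    (simplex -> pt -> R) * (simplex -> pt -> R)))%type.

Definition vel_of (w : state) : velocity R n.+1 :=
  Velocity w.1.1.1 w.1.1.2 w.1.2.
Definition prs_of (w : state) : pressure R n.+1 :=
  Pressure w.2.1.1.1.1 w.2.1.1.1.2 w.2.1.1.2 w.2.1.2 w.2.2.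
Definition state_of (u : velocity R n.+1) (p : pressure R n.+1) : state :=
  ((vel u, vel_bar u, vel_m u),
   (prs p, prs_bars p, prs_bard p, prs_m p, prs_barm p)).

Lemma vel_ofK u p : vel_of (state_of u p) = u. Proof. by case: u. Qed.
Lemma prs_ofK u p : prs_of (state_of u p) = p. Proof. by case: p. Qed.

Section state_lincomb.
Variables (c : R) (w z : state) (K : simplex).
Local Notation s := (c *: w + z).

(** Linear combinations of states are taken pointwise in each field, so these identities hold by
    conversion. *)
Lemma vel_lincomb : vel (vel_of s) K =
  fun x => c *: vel (vel_of w) K x + vel (vel_of z) K x.
Proof. rewrite /vel_of /=. reflexivity. Qed.

Lemma vel_bar_lincomb : vel_bar (vel_of s) K =
  fun x => c *: vel_bar (vel_of w) K x + vel_bar (vel_of z) K x.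
Proof. rewrite /vel_of /=. reflexivity. Qed.

Lemma vel_m_lincomb : vel_m (vel_of s) K =
  fun x => c *: vel_m (vel_of w) K x + vel_m (vel_of z) K x.
Proof. rewrite /vel_of /=. reflexivity. Qed.

Lemma prs_lincomb : prs (prs_of s) K =
  fun x => c * prs (prs_of w) K x + prs (prs_of z) K x.
Proof. rewrite /prs_of /=. reflexivity. Qed.

Lemma prs_bars_lincomb : prs_bars (prs_of s) K =
  fun x => c * prs_bars (prs_of w) K x + prs_bars (prs_of z) K x.
Proof. rewrite /prs_of /=. reflexivity. Qed.

Lemma prs_bard_lincomb : prs_bard (prs_of s) K =
  fun x => c * prs_bard (prs_of w) K x + prs_bard (prs_of z) K x.
Proof. rewrite /prs_of /=. reflexivity. Qed.

Lemma prs_m_lincomb : prs_m (prs_of s) K =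
  fun x => c * prs_m (prs_of w) K x + prs_m (prs_of z) K x.
Proof. rewrite /prs_of /=. reflexivity. Qed.

Lemma prs_barm_lincomb : prs_barm (prs_of s) K =
  fun x => c * prs_barm (prs_of w) K x + prs_barm (prs_of z) K x.
Proof. rewrite /prs_of /=. reflexivity. Qed.

End state_lincomb.

Definition state_lincomb := (vel_lincomb, vel_bar_lincomb, vel_m_lincomb,
  prs_lincomb, prs_bars_lincomb, prs_bard_lincomb, prs_m_lincomb,
  prs_barm_lincomb).

End states.

Section bilinear_forms.
Context {R : realType} {n : nat}.
Local Notation pt := 'rV[R]_n.+1.
Local Notation simplex := (@simplex R n.+1).
Local Notation mesh := (@mesh R n.+1).
Local Notation state := (@state R n).
Variables (Ts Td : mesh) (GamI : set pt).
Hypotheses (fTs : forall K, K \in Ts -> simplex_full K)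
  (fTd : forall K, K \in Td -> simplex_full K)
  (facetI : forall F, is_facet Td F -> hull F `<=` GamI -> is_facet Ts F).

(** Weaker than membership in the discrete spaces, without degrees, boundary values or means, but
    enough for the integrals in the forms to be additive. *)
Definition poly_state (w : state) : Prop :=
  [/\ forall K, K \in (Ts `|` Td)%fset -> polyv (vel (vel_of w) K),
      forall F, is_facet Ts F -> polyv (vel_bar (vel_of w) F) &
      forall K, K \in Td -> polyv (vel_m (vel_of w) K)] /\
  [/\ forall K, K \in (Ts `|` Td)%fset -> polyf (prs (prs_of w) K),
      forall F, is_facet Ts F -> polyf (prs_bars (prs_of w) F),
      forall F, is_facet Td F -> polyf (prs_bard (prs_of w) F),
      forall K, K \in Td -> polyf (prs_m (prs_of w) K) &
      forall F, is_facet Td F -> polyf (prs_barm (prs_of w) F)].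

Lemma is_facet_mesh (T : mesh) K a : K \in T -> a \in K -> is_facet T (K `\ a)%fset.
Proof. by exists K, a. Qed.
Hint Resolve is_facet_mesh : core.

Lemma mem_unionl K : K \in Ts -> K \in (Ts `|` Td)%fset.
Proof. by rewrite inE => ->. Qed.
Lemma mem_unionr K : K \in Td -> K \in (Ts `|` Td)%fset.
Proof. by rewrite inE orbC => ->. Qed.
Hint Resolve mem_unionl mem_unionr : core.

Local Notation lin := (lin poly_state).

Lemma lin_elem (T : mesh) (f : simplex -> state -> pt -> R) :
  (forall K, K \in T -> simplex_full K) ->
  (forall K, K \in T -> lin_family poly_state (f K)) ->
  lin (fun w => elem_int T (fun K => f K w)).
Proof.
by move=> fT lf; apply: lin_sum => K KT _; apply: lin_hull; [exact: fT|exact: lf].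
Qed.

Lemma lin_bdry (T : mesh) (f : simplex -> simplex -> pt -> state -> pt -> R) :
  (forall K, K \in T -> simplex_full K) ->
  (forall K a m, K \in T -> a \in K ->
    lin_family poly_state (f K (K `\ a)%fset m)) ->
  lin (fun w => bdry_int T (fun K F m => f K F m w)).
Proof.
move=> fT lf; apply: lin_sum => K KT _; apply: lin_sum => a Ka _.
by apply: lin_facet => //; [exact: fT|exact: lf].
Qed.

Lemma lin_part (Gam : set pt) (T : mesh) (f : simplex -> pt -> state -> pt -> R) :
  (forall K, K \in T -> simplex_full K) ->
  (forall K a m, K \in T -> a \in K -> hull (K `\ a)%fset `<=` Gam ->
    lin_family poly_state (f (K `\ a)%fset m)) ->
  lin (fun w => part_int Gam T (fun F m => f F m w)).
Proof.
move=> fT lf; apply: lin_sum => K KT _; apply: lin_sum => a Ka /asboolP h.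
by apply: lin_facet => //; [exact: fT|exact: lf].
Qed.

Variables (mu kappa_f kappa_m alpha sigma beta : R).

Lemma lincombZ (r c a b : R) : r * (c * a + b) = c * (r * a) + r * b.
Proof. ring. Qed.

Lemma ah_lin z : poly_state z -> lin (fun w =>
  ah Ts Td GamI mu kappa_f kappa_m alpha beta (vel_of w) (vel_of z)).
Proof.
move=> [[zv zb zm] _].
apply: linD; first apply: linD; first apply: linD; first apply: linD;
  first apply: linB; first apply: linB.
- apply: lin_elem => // K KT; split=> [v [[pv _ _] _]|c v w [[pv _ _] _] [[pw _ _] _] x].
    by apply/polyfZ/polyf_ddot; [apply: pv|apply: zv]; exact: mem_unionl.
  rewrite state_lincomb symgrad_lincomb; [|exact/pv/mem_unionl|exact/pw/mem_unionl].
  by rewrite ddot_lincomb lincombZ.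
- apply: lin_bdry => // K a m KT Ka; have Kf := is_facet_mesh KT Ka.
  split=> [v [[pv _ _] _]|c v w [[pv _ _] _] [[pw _ _] _] x].
    apply/polyfZ/polyf_dot; first by apply/polyv_traction/pv/mem_unionl.
    by apply: polyvB; [exact/zv/mem_unionl|exact: zb].
  rewrite state_lincomb symgrad_lincomb; [|exact/pv/mem_unionl|exact/pw/mem_unionl].
  by rewrite traction_lincomb dot_lincomb lincombZ.
- apply: lin_bdry => // K a m KT Ka; have Kf := is_facet_mesh KT Ka.
  split=> [v [[pv pb _] _]|c v w _ _ x].
    apply/polyfZ/polyf_dot; first by apply/polyv_traction/zv/mem_unionl.
    by apply: polyvB; [exact/pv/mem_unionl|exact: pb].
  rewrite !state_lincomb.
  set t := _ *m _; rewrite ![dot t _]dotC !dotBl !dot_lincomb; ring.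
- apply: lin_bdry => // K a m KT Ka; have Kf := is_facet_mesh KT Ka.
  split=> [v [[pv pb _] _]|c v w _ _ x].
    apply/polyfZ/polyf_dot; apply: polyvB;
      [exact/pv/mem_unionl|exact: pb|exact/zv/mem_unionl|exact: zb].
  by rewrite !state_lincomb !dotBl !dot_lincomb; ring.
- apply: lin_elem => // K KT; split=> [v [[pv _ _] _]|c v w _ _ x].
    by apply/polyfZ/polyf_dot; [apply: pv|apply: zv]; exact: mem_unionr.
  by rewrite state_lincomb dot_lincomb; ring.
- apply: lin_elem => // K KT; split=> [v [[_ _ pv] _]|c v w _ _ x].
    by apply/polyfZ/polyf_dot; [apply: pv|apply: zm].
  by rewrite state_lincomb dot_lincomb; ring.
- apply: lin_part => // K a m KT Ka _; have Kf := is_facet_mesh KT Ka.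
  split=> [v [[_ pb _] _]|c v w _ _ x].
    by apply/polyfZ/polyf_dot; apply: polyv_tangential; [exact: pb|exact: zb].
  by rewrite state_lincomb tangential_lincomb dot_lincomb; ring.
Qed.

Lemma bh_lin_pressure z : poly_state z -> lin (fun w =>
  bh Ts Td GamI (prs_of w) (vel_of z)).
Proof.
move=> [[zv zb zm] _].
apply: linD; first apply: linB; first apply: linD.
- apply: linB; first apply: linD; first apply: linN.
  + apply: lin_elem => // K KT; split=> [v [_ [pv _ _ _ _]]|c v w _ _ x].
      by apply: polyfM; [exact/pv/mem_unionl|exact/polyf_divv/zv/mem_unionl].
    by rewrite state_lincomb; ring.
  + apply: lin_bdry => // K a m KT Ka; have Kf := is_facet_mesh KT Ka.
    split=> [v [_ [_ pv _ _ _]]|c v w _ _ x].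
      by apply: polyfM; [exact: pv|exact: polyf_dot (zv _ (mem_unionl KT)) (polyv_cst _)].
    by rewrite state_lincomb; ring.
  + apply: lin_part => // K a m KT Ka _; have Kf := is_facet_mesh KT Ka.
    split=> [v [_ [_ pv _ _ _]]|c v w _ _ x].
      by apply: polyfM; [exact: pv|exact: polyf_dot (zb _ Kf) (polyv_cst _)].
    by rewrite state_lincomb; ring.
- apply: linB; first apply: linD; first apply: linN.
  + apply: lin_elem => // K KT; split=> [v [_ [pv _ _ _ _]]|c v w _ _ x].
      by apply: polyfM; [exact/pv/mem_unionr|exact/polyf_divv/zv/mem_unionr].
    by rewrite state_lincomb; ring.
  + apply: lin_bdry => // K a m KT Ka; have Kf := is_facet_mesh KT Ka.
    split=> [v [_ [_ _ pv _ _]]|c v w _ _ x].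
      by apply: polyfM; [exact: pv|exact: polyf_dot (zv _ (mem_unionr KT)) (polyv_cst _)].
    by rewrite state_lincomb; ring.
  + apply: lin_part => // K a m KT Ka FI; have Kf := is_facet_mesh KT Ka.
    split=> [v [_ [_ _ pv _ _]]|c v w _ _ x].
      apply: polyfM; first exact: pv.
      (* The trace \bar v is polynomial on facets of [Ts] only; [facetI] places the interface facets
         of [Td] among them. *)
      by apply: polyf_dot (polyv_cst _); apply: zb; exact: facetI.
    by rewrite state_lincomb; ring.
- apply: lin_elem => // K KT; split=> [v [_ [_ _ _ pv _]]|c v w _ _ x].
    by apply: polyfM; [exact: pv|exact/polyf_divv/zm].
  by rewrite state_lincomb; ring.
- apply: lin_bdry => // K a m KT Ka; have Kf := is_facet_mesh KT Ka.
  split=> [v [_ [_ _ _ _ pv]]|c v w _ _ x].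
    by apply: polyfM; [exact: pv|exact: polyf_dot (zm _ KT) (polyv_cst _)].
  by rewrite state_lincomb; ring.
Qed.

Lemma bh_lin_velocity z : poly_state z -> lin (fun w =>
  bh Ts Td GamI (prs_of z) (vel_of w)).
Proof.
move=> [_ [zp zs zd zm zb]].
apply: linD; first apply: linB; first apply: linD.
- apply: linB; first apply: linD; first apply: linN.
  + apply: lin_elem => // K KT.
    split=> [v [[pv _ _] _]|c v w [[pv _ _] _] [[pw _ _] _] x].
      by apply: polyfM; [exact/zp/mem_unionl|exact/polyf_divv/pv/mem_unionl].
    by rewrite state_lincomb divv_lincomb; [ring|exact/pv/mem_unionl|exact/pw/mem_unionl].
  + apply: lin_bdry => // K a m KT Ka; have Kf := is_facet_mesh KT Ka.
    split=> [v [[pv _ _] _]|c v w _ _ x].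
      by apply: polyfM; [exact: zs|exact: polyf_dot (pv _ (mem_unionl KT)) (polyv_cst _)].
    by rewrite state_lincomb dot_lincomb; ring.
  + apply: lin_part => // K a m KT Ka _; have Kf := is_facet_mesh KT Ka.
    split=> [v [[_ pb _] _]|c v w _ _ x].
      by apply: polyfM; [exact: zs|exact: polyf_dot (pb _ Kf) (polyv_cst _)].
    by rewrite state_lincomb dot_lincomb; ring.
- apply: linB; first apply: linD; first apply: linN.
  + apply: lin_elem => // K KT.
    split=> [v [[pv _ _] _]|c v w [[pv _ _] _] [[pw _ _] _] x].
      by apply: polyfM; [exact/zp/mem_unionr|exact/polyf_divv/pv/mem_unionr].
    by rewrite state_lincomb divv_lincomb; [ring|exact/pv/mem_unionr|exact/pw/mem_unionr].
  + apply: lin_bdry => // K a m KT Ka; have Kf := is_facet_mesh KT Ka.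
    split=> [v [[pv _ _] _]|c v w _ _ x].
      by apply: polyfM; [exact: zd|exact: polyf_dot (pv _ (mem_unionr KT)) (polyv_cst _)].
    by rewrite state_lincomb dot_lincomb; ring.
  + apply: lin_part => // K a m KT Ka FI; have Kf := is_facet_mesh KT Ka.
    split=> [v [[_ pb _] _]|c v w _ _ x].
      apply: polyfM; first exact: zd.
      by apply: polyf_dot (polyv_cst _); apply: pb; exact: facetI.
    by rewrite state_lincomb dot_lincomb; ring.
- apply: lin_elem => // K KT.
  split=> [v [[_ _ pv] _]|c v w [[_ _ pv] _] [[_ _ pw] _] x].
    by apply: polyfM; [exact: zm|exact/polyf_divv/pv].
  by rewrite state_lincomb divv_lincomb; [ring|exact: pv|exact: pw].
- apply: lin_bdry => // K a m KT Ka; have Kf := is_facet_mesh KT Ka.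
  split=> [v [[_ _ pv] _]|c v w _ _ x].
    by apply: polyfM; [exact: zb|exact: polyf_dot (pv _ KT) (polyv_cst _)].
  by rewrite state_lincomb dot_lincomb; ring.
Qed.

Lemma ch_lin z : poly_state z -> lin (fun w =>
  ch Td kappa_m sigma (prs_of w) (prs_of z)).
Proof.
move=> [_ [zp _ _ zm _]].
apply: lin_elem => // K KT; split=> [v [_ [pv _ _ pm _]]|c v w _ _ x].
  apply/polyfZ/polyfM; apply: polyfB;
    [exact: pm|exact/pv/mem_unionr|exact: zm|exact/zp/mem_unionr].
by rewrite !state_lincomb; ring.
Qed.

Definition hdg_form (w z : state) : R :=
  ah Ts Td GamI mu kappa_f kappa_m alpha beta (vel_of w) (vel_of z) +
  bh Ts Td GamI (prs_of w) (vel_of z) + bh Ts Td GamI (prs_of z) (vel_of w) -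
  ch Td kappa_m sigma (prs_of w) (prs_of z).

Lemma hdg_form_lin z : poly_state z -> lin (fun w => hdg_form w z).
Proof.
move=> Sz; apply: linB; last exact: ch_lin.
apply: linD; last exact: bh_lin_velocity.
by apply: linD; [exact: ah_lin|exact: bh_lin_pressure].
Qed.

Lemma eq_elem_int (T : mesh) (f g : simplex -> pt -> R) :
  (forall K x, f K x = g K x) -> elem_int T f = elem_int T g.
Proof.
by move=> fg; apply: eq_bigr => K _; apply: (f_equal (vol_int _)); apply/funext.
Qed.

Lemma eq_bdry_int (T : mesh) (f g : simplex -> simplex -> pt -> pt -> R) :
  (forall K F m x, f K F m x = g K F m x) -> bdry_int T f = bdry_int T g.
Proof.
move=> fg; apply: eq_bigr => K _; apply: eq_bigr => a _.
by apply: (f_equal (surf_int _)); apply/funext.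
Qed.

Lemma eq_part_int (Gam : set pt) (T : mesh) (f g : simplex -> pt -> pt -> R) :
  (forall F m x, f F m x = g F m x) -> part_int Gam T f = part_int Gam T g.
Proof.
move=> fg; apply: eq_bigr => K _; apply: eq_bigr => a _.
by apply: (f_equal (surf_int _)); apply/funext.
Qed.

Lemma ah_sym u v : ah Ts Td GamI mu kappa_f kappa_m alpha beta u v =
  ah Ts Td GamI mu kappa_f kappa_m alpha beta v u.
Proof.
refine (f_equal2 (@GRing.add R) (f_equal2 (@GRing.add R)
  (f_equal2 (@GRing.add R) _ _) _) _).
- rewrite /ah_s; refine (f_equal2 (@GRing.add R) _ _).
    rewrite [LHS]addrAC; refine (f_equal2 (@GRing.add R)
     (f_equal2 (@GRing.add R) _ (erefl _)) (erefl _)).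
    by apply: eq_elem_int => K x; rewrite ddotC.
  by apply: eq_bdry_int => K F m x; rewrite dotC.
- by apply: eq_elem_int => K x; rewrite dotC.
- by apply: eq_elem_int => K x; rewrite dotC.
- by apply: eq_part_int => F m x; rewrite dotC.
Qed.

Lemma hdg_form_sym w z : hdg_form w z = hdg_form z w.
Proof.
refine (f_equal2 (@GRing.add R) _ _).
  by rewrite [RHS]addrAC ah_sym; exact: erefl.
by apply: (f_equal (@GRing.opp R)); apply: eq_elem_int => K x; ring.
Qed.

End bilinear_forms.

(** * Uniqueness *)

Section energy.
Context {R : realType} {n : nat}.
Local Notation pt := 'rV[R]_n.+1.
Local Notation simplex := (@simplex R n.+1).
Local Notation mesh := (@mesh R n.+1).
Variables (Ts Td : mesh) (GamI GamS : set pt) (k : nat).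
Hypotheses (fTs : forall K, K \in Ts -> simplex_full K)
  (fTd : forall K, K \in Td -> simplex_full K).
Variables (mu kappa_f kappa_m alpha sigma beta theta C : R).
Hypotheses (mu0 : 0 < mu) (kf0 : 0 < kappa_f) (km0 : 0 < kappa_m)
  (al0 : 0 < alpha) (sg0 : 0 < sigma) (theta0 : 0 < theta) (C0 : 0 < C).
Hypothesis traceC : forall (K : simplex) a (w : pt -> R), simplex_full K ->
  a \in K -> Pk k w ->
  height K a * surf_int (K `\ a)%fset (fun x => w x * w x) <=
  C * vol_int (hull K) (fun x => w x * w x).
Hypothesis regTs : forall K, K \in Ts -> diameter K <= theta * indiameter K.
Local Notation beta1 := (@beta_threshold R n theta C).
Hypothesis beta_gt : beta1 < beta.

Lemma ddot_eq0 (A : 'M[R]_n.+1) : ddot A A = 0 -> A = 0.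
Proof.
move=> A0; apply/row_matrixP => i; rewrite row0; apply: dot_eq0.
have h j : j \in index_enum 'I_n.+1 -> 0 <= dot (row j A) (row j A).
  by move=> _; exact: dot_ge0.
apply: (psum_eq0 h) (mem_index_enum i); rewrite -[RHS]A0.
by apply: eq_bigr => j _; apply: eq_bigr => l _; rewrite !mxE.
Qed.

Lemma polyf_int_eq0 K (f : pt -> R) : simplex_full K -> polyf f ->
  (forall x, 0 <= f x) -> vol_int (hull K) f = 0 -> forall x, f x = 0.
Proof. by move=> fK [l Pf] f0 i0; apply: (hull_int_eq0 fK Pf) => // x _. Qed.

Lemma polyf_facet_eq0 K a (f : pt -> R) : simplex_full K -> a \in K -> polyf f ->
  (forall x, 0 <= f x) -> surf_int (K `\ a)%fset f = 0 ->
  forall x, hull (K `\ a)%fset x -> f x = 0.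
Proof. by move=> fK Ka [l Pf] f0 i0; apply: (surf_int_eq0 fK Ka Pf) => // x _. Qed.

(** The total is a sum of five nonnegative contributions, that of a_h^s by coercivity, so each
    vanishes, element by element and facet by facet. *)
Lemma energy_zero (u : velocity R n.+1) (p : pressure R n.+1) :
  Zh k Ts Td GamS u -> Ph k Ts Td p ->
  ah Ts Td GamI mu kappa_f kappa_m alpha beta u u + ch Td kappa_m sigma p p = 0 ->
  [/\ forall K, K \in Ts -> forall x, symgrad (vel u K) x = 0,
      forall K a, K \in Ts -> a \in K -> forall x, hull (K `\ a)%fset x ->
        vel u K x = vel_bar u (K `\ a)%fset x &
      forall K, K \in Td -> forall x, vel u K x = 0] /\
  [/\ forall K, K \in Td -> forall x, vel_m u K x = 0,
      forall K a, K \in Ts -> a \in K -> hull (K `\ a)%fset `<=` GamI ->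
        forall x, hull (K `\ a)%fset x ->
        tangential (normal K a) (vel_bar u (K `\ a)%fset x) = 0 &
      forall K, K \in Td -> forall x, prs_m p K x = prs p K x].
Proof.
move=> [Pv [Pb _] Pm] [[Pp _] _ _ [Ppm _] _].
have vs K : K \in Ts -> poly_vec k (vel u K) by move=> KT; apply: Pv; rewrite inE KT.
have vd K : K \in Td -> poly_vec k (vel u K).
  by move=> KT; apply: Pv; rewrite inE KT orbT.
have pd K : K \in Td -> Pk k.-1 (prs p K).
  by move=> KT; apply: Pp; rewrite inE KT orbT.
have vb K a : K \in Ts -> a \in K -> polyv (vel_bar u (K `\ a)%fset).
  by move=> KT Ka; apply: polyv_Pk; apply: Pb; exists K, a.
pose D K a x := vel u K x - vel_bar u (K `\ a)%fset x.
have PD K a : K \in Ts -> a \in K -> polyv (D K a).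
  by move=> KT Ka; apply: polyvB; [exact/polyv_Pk/vs|exact: vb].
(* [X] is the contribution of one element to a_h^s, and [Y] its lower bound from coercivity. *)
pose X K := vol_int (hull K) (fun x => 2 * mu *
    ddot (symgrad (vel u K) x) (symgrad (vel u K) x)) -
  \sum_(a <- K) surf_int (K `\ a)%fset (fun x => 2 * mu *
    dot (normal K a *m (symgrad (vel u K) x)^T) (D K a x)) -
  \sum_(a <- K) surf_int (K `\ a)%fset (fun x => 2 * mu *
    dot (normal K a *m (symgrad (vel u K) x)^T) (D K a x)) +
  \sum_(a <- K) surf_int (K `\ a)%fset (fun x => 2 * beta * mu / diameter K *
    dot (D K a x) (D K a x)).
pose Y K := mu * vol_int (hull K)
    (fun x => ddot (symgrad (vel u K) x) (symgrad (vel u K) x)) +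
  \sum_(a <- K) 2 * (beta - beta1) * mu / diameter K *
    surf_int (K `\ a)%fset (fun x => dot (D K a x) (D K a x)).
have asE : ah_s Ts mu beta u u = \sum_(K <- Ts) X K.
  by rewrite /ah_s /elem_int /bdry_int -!sumrB -big_split.
have YX K : K \in Ts -> Y K <= X K.
  move=> KT.
  apply: (element_coercive theta0 C0 traceC beta (fTs KT) (regTs KT) (vs K KT)) => //.
  by move=> a; exact: PD.
have cf K : K \in Ts -> 0 < 2 * (beta - beta1) * mu / diameter K.
  move=> KT; rewrite !mulr_gt0// ?subr_gt0//.
  by rewrite invr_gt0; exact: diameter_gt0 (fTs KT).
have V0 K : K \in Ts -> 0 <= vol_int (hull K)
    (fun x => ddot (symgrad (vel u K) x) (symgrad (vel u K) x)).
  by move=> _; apply: vol_int_ge0 => x _; exact: ddot_ge0.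
have S0 K a : K \in Ts -> a \in K ->
    0 <= surf_int (K `\ a)%fset (fun x => dot (D K a x) (D K a x)).
  by move=> KT Ka; apply: (facet_int_ge0 (fTs KT) Ka) => x _; exact: dot_ge0.
have Y2 K a : K \in Ts -> a \in K ->
    0 <= 2 * (beta - beta1) * mu / diameter K *
    surf_int (K `\ a)%fset (fun x => dot (D K a x) (D K a x)).
  by move=> KT Ka; apply: mulr_ge0; [exact/ltW/cf|exact: S0].
have Y2s K : K \in Ts -> 0 <= \sum_(a <- K)
    2 * (beta - beta1) * mu / diameter K *
    surf_int (K `\ a)%fset (fun x => dot (D K a x) (D K a x)).
  by move=> KT; rewrite big_seq; apply: sumr_ge0 => a; exact: Y2.
have Y1 K : K \in Ts -> 0 <= mu * vol_int (hull K)
    (fun x => ddot (symgrad (vel u K) x) (symgrad (vel u K) x)).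
  by move=> KT; apply: mulr_ge0; [exact: ltW|exact: V0].
have X0 K : K \in Ts -> 0 <= X K.
  by move=> KT; apply: le_trans (YX K KT); apply: addr_ge0; [exact: Y1|exact: Y2s].
have Xs : 0 <= \sum_(K <- Ts) X K by rewrite big_seq; apply: sumr_ge0.
pose A K := vol_int (hull K) (fun x => kappa_f^-1 * dot (vel u K x) (vel u K x)).
pose B K := vol_int (hull K) (fun x => kappa_m^-1 * dot (vel_m u K x) (vel_m u K x)).
pose E K := vol_int (hull K) (fun x => sigma * kappa_m *
  ((prs_m p K x - prs p K x) * (prs_m p K x - prs p K x))).
pose G K a := surf_int (K `\ a)%fset (fun x =>
  alpha * mu * (Num.sqrt kappa_f)^-1 *
  dot (tangential (normal K a) (vel_bar u (K `\ a)%fset x))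
      (tangential (normal K a) (vel_bar u (K `\ a)%fset x))).
have gc : 0 < alpha * mu * (Num.sqrt kappa_f)^-1.
  by rewrite !mulr_gt0// invr_gt0 sqrtr_gt0.
have fA K x : 0 <= kappa_f^-1 * dot (vel u K x) (vel u K x).
  by apply: mulr_ge0; [rewrite invr_ge0 ltW|exact: dot_ge0].
have fB K x : 0 <= kappa_m^-1 * dot (vel_m u K x) (vel_m u K x).
  by apply: mulr_ge0; [rewrite invr_ge0 ltW|exact: dot_ge0].
have fE K x : 0 <= sigma * kappa_m *
    ((prs_m p K x - prs p K x) * (prs_m p K x - prs p K x)).
  by apply: mulr_ge0; [exact/ltW/mulr_gt0|rewrite -expr2 sqr_ge0].
have fG K a x : 0 <= alpha * mu * (Num.sqrt kappa_f)^-1 *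
  dot (tangential (normal K a) (vel_bar u (K `\ a)%fset x))
      (tangential (normal K a) (vel_bar u (K `\ a)%fset x)).
  by apply: mulr_ge0; [exact: ltW|exact: dot_ge0].
have A0 K : 0 <= A K by apply: vol_int_ge0.
have B0 K : 0 <= B K by apply: vol_int_ge0.
have E0 K : 0 <= E K by apply: vol_int_ge0.
have G0 K a : K \in Ts -> a \in K -> 0 <= G K a.
  by move=> KT Ka; apply: (facet_int_ge0 (fTs KT) Ka).
pose H (K : simplex) := \sum_(a <- K | `[< hull (K `\ a)%fset `<=` GamI >]) G K a.
have H0 K : K \in Ts -> 0 <= H K.
  by move=> KT; rewrite /H big_seq_cond; apply: sumr_ge0 => a /andP[Ka _]; exact: G0.
have As : 0 <= \sum_(K <- Td) A K by apply: sumr_ge0.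
have Bs : 0 <= \sum_(K <- Td) B K by apply: sumr_ge0.
have Es : 0 <= \sum_(K <- Td) E K by apply: sumr_ge0.
have Hs : 0 <= \sum_(K <- Ts) H K by rewrite big_seq; apply: sumr_ge0.
have -> : ah Ts Td GamI mu kappa_f kappa_m alpha beta u u =
  \sum_(K <- Ts) X K + \sum_(K <- Td) A K + \sum_(K <- Td) B K + \sum_(K <- Ts) H K.
  by rewrite -asE.
have -> : ch Td kappa_m sigma p p = \sum_(K <- Td) E K by [].
move=> tot.
have Xz : \sum_(K <- Ts) X K = 0 by lra.
have Az : \sum_(K <- Td) A K = 0 by lra.
have Bz : \sum_(K <- Td) B K = 0 by lra.
have Ez : \sum_(K <- Td) E K = 0 by lra.
have Hz : \sum_(K <- Ts) H K = 0 by lra.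
have YK0 K : K \in Ts -> mu * vol_int (hull K)
      (fun x => ddot (symgrad (vel u K) x) (symgrad (vel u K) x)) = 0 /\
    \sum_(a <- K) 2 * (beta - beta1) * mu / diameter K *
    surf_int (K `\ a)%fset (fun x => dot (D K a x) (D K a x)) = 0.
  move=> KT; have XK := psum_eq0 X0 Xz KT; have := YX K KT; rewrite XK /Y.
  by have := Y1 K KT; have := Y2s K KT; move=> h1 h2 h3; split; lra.
split; split.
- move=> K KT x; apply: ddot_eq0.
  apply: (polyf_int_eq0 (f := fun x => ddot (symgrad (vel u K) x) (symgrad (vel u K) x)) (fTs KT)).
  + by apply: polyf_ddot; exact/polyv_Pk/vs.
  + by move=> y; exact: ddot_ge0.
  + have [/eqP + _] := YK0 K KT.
    by rewrite mulf_eq0 (gt_eqF mu0) => /eqP.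
- move=> K a KT Ka x Fx; apply/eqP; rewrite -subr_eq0; apply/eqP.
  apply: dot_eq0.
  apply: (polyf_facet_eq0 (f := fun x => dot (D K a x) (D K a x)) (fTs KT) Ka) => //.
  + by apply: polyf_dot; exact: PD.
  + by move=> y; exact: dot_ge0.
  + have [_ s0] := YK0 K KT; have /eqP := psum_eq0 (fun a => @Y2 K a KT) s0 Ka.
    by rewrite mulf_eq0 (gt_eqF (cf K KT)) => /eqP.
- move=> K KT x; apply: dot_eq0.
  have := polyf_int_eq0 (fTd KT) _ (fA K) (psum_eq0 (fun K _ => A0 K) Az KT) x.
  move=> /(_ (polyfZ _ (polyf_dot (polyv_Pk (vd K KT)) (polyv_Pk (vd K KT)))))/eqP.
  by rewrite mulf_eq0 invr_eq0 (gt_eqF kf0) => /eqP.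
- move=> K KT x; apply: dot_eq0.
  have := polyf_int_eq0 (fTd KT) _ (fB K) (psum_eq0 (fun K _ => B0 K) Bz KT) x.
  move=> /(_ (polyfZ _ (polyf_dot (polyv_Pk (Pm K KT)) (polyv_Pk (Pm K KT)))))/eqP.
  by rewrite mulf_eq0 invr_eq0 (gt_eqF km0) => /eqP.
- move=> K a KT Ka FI x Fx; apply: dot_eq0.
  have HK := psum_eq0 H0 Hz KT.
  have GK : G K a = 0.
    (* The condition on the facets becomes a filtered list, to which [psum_eq0] applies. *)
    have := @psum_eq0 R _ [seq a <- K | `[< hull (K `\ a)%fset `<=` GamI >]] (G K).
    rewrite big_filter => /(_ _ HK a); apply.
      by move=> b; rewrite mem_filter => /andP[_]; exact: G0.
    by rewrite mem_filter Ka andbT; apply/asboolP.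
  have Pt := polyv_tangential (normal K a) (vb K a KT Ka).
  have /eqP := polyf_facet_eq0 (fTs KT) Ka (polyfZ _ (polyf_dot Pt Pt)) (fG K a) GK Fx.
  by rewrite mulf_eq0 (gt_eqF gc) => /eqP.
- move=> K KT x.
  have Pe := polyfB (polyf_Pk (Ppm K KT)) (polyf_Pk (pd K KT)).
  have /eqP := polyf_int_eq0 (fTd KT) (polyfZ _ (polyfM Pe Pe)) (fE K)
    (psum_eq0 (fun K _ => E0 K) Ez KT) x.
  rewrite mulf_eq0 (gt_eqF (mulr_gt0 sg0 km0)) /= mulf_eq0 orbb subr_eq0.
  by move/eqP.
Qed.

End energy.

Section zero_integrals.
Context {R : realType} {n : nat}.
Local Notation pt := 'rV[R]_n.+1.
Local Notation simplex := (@simplex R n.+1).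
Local Notation mesh := (@mesh R n.+1).

Lemma hull_int0 (K : simplex) : simplex_full K -> vol_int (hull K) (fun=> 0) = 0.
Proof. by move=> fK; have := hull_intZ 0 fK (polyf_cst 0); rewrite !mul0r. Qed.

Lemma facet_int0 (K : simplex) a : simplex_full K -> a \in K ->
  surf_int (K `\ a)%fset (fun=> 0) = 0.
Proof. by move=> fK Ka; have [cF aF] := simplex_full_D1 fK Ka; exact: surf_int0. Qed.

Lemma hull_int_zero (K : simplex) (f : pt -> R) : simplex_full K ->
  (forall x, hull K x -> f x = 0) -> vol_int (hull K) f = 0.
Proof. by move=> fK f0; rewrite (eq_vol_int f0) hull_int0. Qed.

Lemma facet_int_zero (K : simplex) a (f : pt -> R) : simplex_full K -> a \in K ->
  (forall x, hull (K `\ a)%fset x -> f x = 0) -> surf_int (K `\ a)%fset f = 0.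
Proof. by move=> fK Ka f0; rewrite (facet_int_eq fK Ka f0) facet_int0. Qed.

Variable T : mesh.
Hypothesis fT : forall K, K \in T -> simplex_full K.

Lemma elem_int_zero (f : simplex -> pt -> R) :
  (forall K, K \in T -> forall x, hull K x -> f K x = 0) -> elem_int T f = 0.
Proof.
move=> f0; rewrite /elem_int big_seq big1// => K KT.
by apply: hull_int_zero; [exact: fT|exact: f0].
Qed.

Lemma bdry_int_zero (f : simplex -> simplex -> pt -> pt -> R) :
  (forall K a m, K \in T -> a \in K -> forall x, hull (K `\ a)%fset x ->
    f K (K `\ a)%fset m x = 0) -> bdry_int T f = 0.
Proof.
move=> f0; rewrite /bdry_int big_seq big1// => K KT; rewrite big_seq big1// => a Ka.
by apply: facet_int_zero => //; [exact: fT|exact: f0].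
Qed.

Lemma part_int_zero (Gam : set pt) (f : simplex -> pt -> pt -> R) :
  (forall K a m, K \in T -> a \in K -> hull (K `\ a)%fset `<=` Gam ->
    forall x, hull (K `\ a)%fset x -> f (K `\ a)%fset m x = 0) ->
  part_int Gam T f = 0.
Proof.
move=> f0; rewrite /part_int big_seq big1// => K KT.
rewrite big_seq_cond big1// => a /andP[Ka /asboolP KG].
by apply: facet_int_zero => //; [exact: fT|exact: f0].
Qed.

(** For test fields supported on one element. *)
Lemma elem_int_single K0 (f : simplex -> pt -> R) : K0 \in T ->
  (forall K, K \in T -> K != K0 -> forall x, f K x = 0) ->
  elem_int T f = vol_int (hull K0) (f K0).
Proof.
move=> K0T f0; rewrite /elem_int (big_fsetD1 K0)//= big_seq big1 ?addr0// => K.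
by rewrite !inE => /andP[KK0 KT]; apply: hull_int_zero => [|x _]; [exact: fT|exact: f0].
Qed.

Lemma bdry_int_single K0 (f : simplex -> simplex -> pt -> pt -> R) : K0 \in T ->
  (forall K F m, K \in T -> K != K0 -> forall x, f K F m x = 0) ->
  bdry_int T f =
  \sum_(a <- K0) surf_int (K0 `\ a)%fset (f K0 (K0 `\ a)%fset (normal K0 a)).
Proof.
move=> K0T f0; rewrite /bdry_int (big_fsetD1 K0)//= [X in _ + X]big_seq.
rewrite [X in _ + X]big1 ?addr0// => K; rewrite !inE => /andP[KK0 KT].
rewrite big_seq big1// => a Ka.
by apply: facet_int_zero => // [|x _]; [exact: fT|exact: f0].
Qed.

End zero_integrals.

Section zero_fields.
Context {R : realType} {d : nat}.
Local Notation pt := 'rV[R]_d.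

Lemma dot0 (x : pt) : dot x 0 = 0. Proof. by rewrite dotC dot0l. Qed.

Lemma gradv0 (v : pt -> pt) x : (forall y, v y = 0) -> gradv v x = 0.
Proof.
move=> v0; apply/matrixP => i j; rewrite !mxE.
rewrite (_ : (fun y => v y 0 i) = fun=> 0) ?derive_cst0//.
by apply/funext => y; rewrite v0 mxE.
Qed.

Lemma symgrad0 (v : pt -> pt) x : (forall y, v y = 0) -> symgrad v x = 0.
Proof. by move=> v0; rewrite /symgrad gradv0// trmx0 addr0 scaler0. Qed.

Lemma divv0 (v : pt -> pt) x : (forall y, v y = 0) -> divv v x = 0.
Proof. by move=> v0; rewrite /divv gradv0// mxtrace0. Qed.

Lemma ddot0l (A : 'M[R]_d) : ddot 0 A = 0.
Proof. by rewrite /ddot big1// => i _; rewrite big1// => j _; rewrite mxE mul0r. Qed.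

Lemma tangential0 (m : pt) : tangential m 0 = 0.
Proof. by rewrite /tangential dot0l scale0r subr0. Qed.

End zero_fields.

Section null_fields.
Context {R : realType} {n : nat}.
Local Notation pt := 'rV[R]_n.+1.
Local Notation simplex := (@simplex R n.+1).
Local Notation mesh := (@mesh R n.+1).
Variables (Ts Td : mesh).

Definition null_fields (u : velocity R n.+1) (p : pressure R n.+1) : Prop :=
  same_velocity Ts Td u (Velocity (fun _ _ => 0) (fun _ _ => 0) (fun _ _ => 0)) /\
  same_pressure Ts Td p (Pressure (fun _ _ => 0) (fun _ _ => 0) (fun _ _ => 0)
    (fun _ _ => 0) (fun _ _ => 0)).

Variable GamI : set pt.
Hypotheses (fTs : forall K, K \in Ts -> simplex_full K)
  (fTd : forall K, K \in Td -> simplex_full K)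
  (facetI : forall F, is_facet Td F -> hull F `<=` GamI -> is_facet Ts F).
Variables (mu kappa_f kappa_m alpha sigma beta : R).

(** Null fields are given to vanish on closed elements only. Being polynomial they vanish
    everywhere, and so do their derivatives at boundary points. *)
Lemma polyv_zero (K : simplex) (v : pt -> pt) : simplex_full K -> polyv v ->
  (forall x, hull K x -> v x = 0) -> forall x, v x = 0.
Proof.
move=> fK Pv v0 x; apply/rowP => i; rewrite mxE; have [k Pi] := Pv i.
by apply: (poly_zero_hull fK Pi) => y Ky; rewrite v0// mxE.
Qed.

Lemma ah_zero (u v : velocity R n.+1) :
  (forall K, K \in (Ts `|` Td)%fset -> forall x, vel u K x = 0) ->
  eq_on (is_facet Ts) (vel_bar u) (fun _ _ => 0) ->
  (forall K, K \in Td -> forall x, vel_m u K x = 0) ->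
  ah Ts Td GamI mu kappa_f kappa_m alpha beta u v = 0.
Proof.
move=> u0 b0 m0.
have us K : K \in Ts -> forall x, vel u K x = 0.
  by move=> KT; apply: u0; rewrite inE KT.
have ud K : K \in Td -> forall x, vel u K x = 0.
  by move=> KT; apply: u0; rewrite inE KT orbT.
have ub K a x : K \in Ts -> a \in K -> hull (K `\ a)%fset x ->
    vel_bar u (K `\ a)%fset x = 0.
  by move=> KT Ka Fx; apply: b0 => //; exists K, a.
rewrite /ah /ah_s.
rewrite [elem_int Ts _]elem_int_zero//; last first.
  by move=> K KT x _; rewrite symgrad0 ?ddot0l ?mulr0//; exact: us.
rewrite [X in 0 - X]bdry_int_zero//; last first.
  move=> K a m KT Ka x _; rewrite symgrad0; last exact: us.
  by rewrite trmx0 mulmx0 dot0l mulr0.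
rewrite [X in 0 - 0 - X]bdry_int_zero//; last first.
  by move=> K a m KT Ka x Fx; rewrite us// ub// subrr dot0 mulr0.
rewrite [X in 0 - 0 - 0 + X]bdry_int_zero//; last first.
  by move=> K a m KT Ka x Fx; rewrite us// ub// subrr dot0l mulr0.
rewrite [X in 0 - 0 - 0 + 0 + X]elem_int_zero//; last first.
  by move=> K KT x _; rewrite ud// dot0l mulr0.
rewrite [X in 0 - 0 - 0 + 0 + 0 + X]elem_int_zero//; last first.
  by move=> K KT x _; rewrite m0// dot0l mulr0.
rewrite part_int_zero//; last first.
  by move=> K a m KT Ka _ x Fx; rewrite ub// tangential0 dot0l mulr0.
by rewrite !subr0 !addr0.
Qed.

End null_fields.

Section null_coupling.
Context {R : realType} {n : nat}.
Local Notation pt := 'rV[R]_n.+1.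
Local Notation simplex := (@simplex R n.+1).
Local Notation mesh := (@mesh R n.+1).
Variables (Ts Td : mesh) (GamI : set pt).
Hypotheses (fTs : forall K, K \in Ts -> simplex_full K)
  (fTd : forall K, K \in Td -> simplex_full K)
  (facetI : forall F, is_facet Td F -> hull F `<=` GamI -> is_facet Ts F).

Lemma bh_zero_pressure p (v : velocity R n.+1) :
  same_pressure Ts Td p (Pressure (fun _ _ => 0) (fun _ _ => 0) (fun _ _ => 0)
    (fun _ _ => 0) (fun _ _ => 0)) -> bh Ts Td GamI p v = 0.
Proof.
move=> [p0 s0 d0 m0 b0].
have fs K a : K \in Ts -> a \in K -> is_facet Ts (K `\ a)%fset by exists K, a.
have fd K a : K \in Td -> a \in K -> is_facet Td (K `\ a)%fset by exists K, a.
have ps K x : K \in Ts -> hull K x -> prs p K x = 0.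
  by move=> KT; apply: p0; rewrite /= inE KT.
have pd K x : K \in Td -> hull K x -> prs p K x = 0.
  by move=> KT; apply: p0; rewrite /= inE KT orbT.
rewrite /bh /bh_sub !(elem_int_zero fTs, elem_int_zero fTd, bdry_int_zero fTs,
  bdry_int_zero fTd, part_int_zero fTs, part_int_zero fTd).
- by rewrite !oppr0 !addr0.
- by move=> K a m KT Ka x Fx; rewrite b0 ?mul0r//; exact: fd.
- by move=> K KT x Kx; rewrite m0 ?mul0r.
- by move=> K a m KT Ka _ x Fx; rewrite d0 ?mul0r//; exact: fd.
- by move=> K a m KT Ka x Fx; rewrite d0 ?mul0r//; exact: fd.
- by move=> K KT x Kx; rewrite pd ?mul0r.
- by move=> K a m KT Ka _ x Fx; rewrite s0 ?mul0r//; exact: fs.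
- by move=> K a m KT Ka x Fx; rewrite s0 ?mul0r//; exact: fs.
- by move=> K KT x Kx; rewrite ps ?mul0r.
Qed.

Lemma bh_zero_velocity p (u : velocity R n.+1) :
  (forall K, K \in (Ts `|` Td)%fset -> forall x, vel u K x = 0) ->
  eq_on (is_facet Ts) (vel_bar u) (fun _ _ => 0) ->
  (forall K, K \in Td -> forall x, vel_m u K x = 0) -> bh Ts Td GamI p u = 0.
Proof.
move=> u0 b0 m0.
have fd K a : K \in Td -> a \in K -> is_facet Td (K `\ a)%fset by exists K, a.
have us K : K \in Ts -> forall x, vel u K x = 0.
  by move=> KT; apply: u0; rewrite inE KT.
have ud K : K \in Td -> forall x, vel u K x = 0.
  by move=> KT; apply: u0; rewrite inE KT orbT.
rewrite /bh /bh_sub !(elem_int_zero fTs, elem_int_zero fTd, bdry_int_zero fTs,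
  bdry_int_zero fTd, part_int_zero fTs, part_int_zero fTd).
- by rewrite !oppr0 !addr0.
- by move=> K a m KT Ka x Fx; rewrite m0// dot0l mulr0.
- by move=> K KT x Kx; rewrite (divv0 _ (m0 K KT)) mulr0.
- move=> K a m KT Ka FI x Fx; rewrite b0 ?dot0l ?mulr0//.
  by apply: facetI => //; exact: fd.
- by move=> K a m KT Ka x Fx; rewrite ud// dot0l mulr0.
- by move=> K KT x Kx; rewrite (divv0 _ (ud K KT)) mulr0.
- by move=> K a m KT Ka _ x Fx; rewrite b0 ?dot0l ?mulr0//; exists K, a.
- by move=> K a m KT Ka x Fx; rewrite us// dot0l mulr0.
- by move=> K KT x Kx; rewrite (divv0 _ (us K KT)) mulr0.
Qed.

End null_coupling.

Section mean_zero.
Context {R : realType} {n : nat}.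
Local Notation simplex := (@simplex R n.+1).
Local Notation mesh := (@mesh R n.+1).

(** After multiplication by s all terms s c_K |K| are nonnegative, so a zero total makes each
    vanish. *)
Lemma mean_zero_const (T : mesh) (c : simplex -> R) (s : R)
    (p : simplex -> 'rV[R]_n.+1 -> R) :
  (forall K, K \in T -> simplex_full K) ->
  (forall K, K \in T -> p K = fun=> c K) ->
  (forall K, K \in T -> c K = 0 \/ c K = s) -> elem_int T p = 0 ->
  forall K, K \in T -> c K = 0.
Proof.
move=> fT pc cs p0 K KT; case: (cs K KT) => // cK; rewrite cK.
have volK L : L \in T -> vol_int (hull L) (p L) = c L * vol_int (hull L) (fun=> 1).
  move=> LT; rewrite (pc L LT) -hull_intZ//; [|exact: fT|exact: polyf_cst].
  by apply: eq_vol_int => x _; rewrite mulr1.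
have s0 : \sum_(L <- T) s * c L * vol_int (hull L) (fun=> 1) = 0.
  rewrite -[RHS](mulr0 s) -[X in _ = s * X]p0 /elem_int mulr_sumr big_seq [RHS]big_seq.
  by apply: eq_bigr => L LT; rewrite volK// mulrA.
have h L : L \in T -> 0 <= s * c L * vol_int (hull L) (fun=> 1).
  move=> LT; have v0 := hull_volume_gt0 (fT L LT).
  apply: mulr_ge0; last exact: ltW.
  by case: (cs L LT) => ->; rewrite ?mulr0// -expr2 sqr_ge0.
have /eqP := psum_eq0 h s0 KT; rewrite cK mulf_eq0.
by rewrite (gt_eqF (hull_volume_gt0 (fT K KT))) orbF mulf_eq0 orbb => /eqP.
Qed.

End mean_zero.

Section homogeneous.
Context {R : realType} {n : nat}.
Local Notation pt := 'rV[R]_n.+1.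
Local Notation simplex := (@simplex R n.+1).
Local Notation mesh := (@mesh R n.+1).
Variables (Om Os Od : set pt) (Ts Td : mesh) (k : nat).
Hypotheses (hdom : coupled_domain Om Os Od) (hTs : triangulation Os Ts)
  (hTd : triangulation Od Td) (conf : conforming Ts Td) (k1 : (1 <= k)%N).

Let fTs K : K \in Ts -> simplex_full K := triangulation_full hTs (K := K).
Let fTd K : K \in Td -> simplex_full K := triangulation_full hTd (K := K).
Local Notation GamI := (interface Os Od).
Local Notation GamS := (outer_boundary Os Om).

(** [interface_facet] with the roles of the subdomains exchanged; it makes \bar v available on the
    interface facets of [Td]. *)
Lemma interface_sub F : is_facet Td F -> hull F `<=` GamI -> is_facet Ts F.
Proof.
move=> [K [a [KT Ka ->]]]; rewrite /interface setIC => FI.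
have hdom' : coupled_domain Om Od Os.
  have [bO [l1 l2 l3] dj cE] := hdom.
  by split; [exact: bO|split|rewrite setIC|rewrite setUC].
have conf' : conforming Td Ts.
  by move=> K1 L1 K1T L1T; rewrite setIC conf// fsetIC.
have [L [b [LT Lb E _]]] := interface_facet hdom' hTd hTs conf' KT Ka FI.
by exists L, b.
Qed.

Lemma bounded_subdomain : bounded_set Os.
Proof.
have [bO _ _ cE] := hdom; have [M [_ hM]] := bO.
have cM : closure Om `<=` [set x | `|x| <= M + 1].
  have cl : closed [set x : pt | `|x| <= M + 1].
    apply: (closed_comp (f := fun x : pt => `|x|) (D := [set y | y <= M + 1])).
      by move=> x _; exact: norm_continuous.
    exact: closed_le.
  rewrite [X in _ `<=` X](closure_id _).1//; apply: closureS => x Ox.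
  by apply: (hM (M + 1)) => //; rewrite ltrDl.
exists (M + 1); split; first exact: num_real.
move=> y My x Ox; apply: le_trans (ltW My); apply: cM.
by rewrite cE; left; exact: subset_closure.
Qed.

Lemma mesh_inhabited O T : O !=set0 -> triangulation O T -> exists K : simplex, K \in T.
Proof.
move=> [x Ox] [_ _ cO]; have : closure O x by exact: subset_closure.
by rewrite cO => -[K KT _]; exists K.
Qed.

End homogeneous.

Section homogeneous.
Context {R : realType} {n : nat}.
Local Notation pt := 'rV[R]_n.+1.
Local Notation simplex := (@simplex R n.+1).
Local Notation mesh := (@mesh R n.+1).
Variables (Om Os Od : set pt) (Ts Td : mesh) (k : nat).
Hypotheses (hdom : coupled_domain Om Os Od) (hTs : triangulation Os Ts)
  (hTd : triangulation Od Td) (conf : conforming Ts Td) (k1 : (1 <= k)%N).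

Let fTs K : K \in Ts -> simplex_full K := triangulation_full hTs (K := K).
Let fTd K : K \in Td -> simplex_full K := triangulation_full hTd (K := K).
Local Notation GamI := (interface Os Od).
Local Notation GamS := (outer_boundary Os Om).

(** Otherwise the functional x -> n_L . (x - y) would vanish on the facet and at y + n_K, a point
    off its plane, and the unit normal n_L would be 0. *)
Lemma normal_transversal (K L : simplex) a b : simplex_full K -> a \in K ->
  simplex_full L -> b \in L -> (L `\ b)%fset = (K `\ a)%fset ->
  dot (normal L b) (normal K a) != 0.
Proof.
move=> fK Ka fL Lb E; apply/eqP => d0.
have [l1 lF _] := is_normal_normal fL Lb.
have yF := base_in fK Ka; move: yF; set y := (enum_fset _)`_0 => yF.
have l0 : normal L b = 0.
  apply: (affine_functional_zero (y0 := y) (z := y + normal K a) fK Ka).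
  - by move=> c cF; apply: lF; rewrite E.
  - rewrite baryD; move: (yF); rewrite !inE => /andP[ya Ky].
    by rewrite (bary_other fK Ka Ky ya) add0r slope_normal_neq0.
  - by rewrite addrAC subrr add0r.
by move: l1; rewrite l0 dot0l => /eqP; rewrite eq_sym oner_eq0.
Qed.

(* On a facet of the interface the element of Td adjacent to it is unique, so
   the multiplier \bar q^d controls the flux of \bar u across this facet. *)
Lemma interface_flux (u : velocity R n.+1) (c : pressure R n.+1 -> R) :
  Zh k Ts Td GamS u ->
  (forall K, K \in Td -> forall x, vel u K x = 0) ->
  (forall q, Ph k Ts Td q -> bh Ts Td GamI q u = c q) ->
  (forall q, (forall K x, prs q K x = 0) -> (forall K x, prs_m q K x = 0) -> c q = 0) ->
  forall K a L b, K \in Ts -> a \in K -> hull (K `\ a)%fset `<=` GamI ->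
  L \in Td -> b \in L -> (L `\ b)%fset = (K `\ a)%fset ->
  (forall L' b', L' \in Td -> b' \in L' -> (L' `\ b')%fset = (K `\ a)%fset ->
    L' = L /\ b' = b) ->
  forall x, hull (K `\ a)%fset x ->
  dot (vel_bar u (K `\ a)%fset x) (normal L b) = 0.
Proof.
move=> [_ [Pb _] _] ud flux c0 K a L b KT Ka FI LT Lb FE uniq x Fx.
have [g gE] : exists g, g = fun y => dot (vel_bar u (K `\ a)%fset y) (normal L b).
  by eexists.
have Pg : Pk k g.
  rewrite gE; apply: Pk_sum => i _; under eq_fun do rewrite mulrC; apply: PkZ.
  by apply: Pb; exists K, a.
(* Concentrated on one facet, with the flux g as multiplier. Its element pressures are 0, so the
   mean conditions hold and [c q] vanishes. *)
pose q : pressure R n.+1 := Pressure (fun _ _ => 0) (fun _ _ => 0)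
  (fun F => if F == (K `\ a)%fset then g else fun=> 0) (fun _ _ => 0) (fun _ _ => 0).
have union_full M : M \in (Ts `|` Td)%fset -> simplex_full M.
  by rewrite inE => /orP[/fTs|/fTd].
have Pq : Ph k Ts Td q.
  have z l : Pk l (fun=> 0 : R) := @Pk_cst R n.+1 l 0.
  split=> //=.
  - by split=> //; rewrite elem_int_zero.
  - by move=> F _; case: ifP => _ //; exact: z.
  - by split=> //; rewrite elem_int_zero.
have := flux q Pq; rewrite c0//.
rewrite /bh /bh_sub !(elem_int_zero fTs, elem_int_zero fTd, bdry_int_zero fTs,
  bdry_int_zero fTd, part_int_zero fTs)/=; last 7 first.
all: try by move=> *; rewrite mul0r.
  by move=> M m l MT Mm y _; rewrite ud// dot0l mulr0.
have e (s : R) : (- 0 + 0 - 0) + (- 0 + 0 - s) - 0 + 0 = - s by ring.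
rewrite e => /eqP; rewrite oppr_eq0 => /eqP; rewrite /part_int => tot.
have FgE y : (if (K `\ a)%fset == (K `\ a)%fset then g else fun=> 0) y = g y.
  by rewrite eqxx.
have term0 M m : M \in Td -> m \in M ->
    0 <= surf_int (M `\ m)%fset (fun y =>
      (if (M `\ m)%fset == (K `\ a)%fset then g else fun=> 0) y *
      dot (vel_bar u (M `\ m)%fset y) (normal M m)).
  move=> MT Mm; apply: (facet_int_ge0 (fTd MT) Mm) => y _.
  case: eqP => E; last by rewrite mul0r.
  by have [-> ->] := uniq M m MT Mm E; rewrite FE gE -expr2 sqr_ge0.
have inner0 M : M \in Td -> 0 <= \sum_(m <- M | `[< hull (M `\ m)%fset `<=` GamI >])
    surf_int (M `\ m)%fset (fun y =>
      (if (M `\ m)%fset == (K `\ a)%fset then g else fun=> 0) y *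
      dot (vel_bar u (M `\ m)%fset y) (normal M m)).
  move=> MT; rewrite big_seq_cond; apply: sumr_ge0 => m /andP[Mm _].
  exact: term0.
have := psum_eq0 inner0 tot LT; rewrite -big_filter => tot2.
have LbI : b \in [seq m <- L | `[< hull (L `\ m)%fset `<=` GamI >]].
  by rewrite mem_filter Lb andbT; apply/asboolP; rewrite FE.
have inner1 m : m \in [seq m <- L | `[< hull (L `\ m)%fset `<=` GamI >]] ->
    0 <= surf_int (L `\ m)%fset (fun y =>
      (if (L `\ m)%fset == (K `\ a)%fset then g else fun=> 0) y *
      dot (vel_bar u (L `\ m)%fset y) (normal L m)).
  by rewrite mem_filter => /andP[_ Lm]; exact: term0.
have := psum_eq0 inner1 tot2 LbI; rewrite FE eqxx => s0.
have /eqP : g x * g x = 0.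
  apply: (surf_int_eq0 (fTs KT) Ka (PkM Pg Pg) _ _ Fx).
    by move=> y _; rewrite -expr2 sqr_ge0.
  by rewrite -[RHS]s0 gE.
by rewrite mulf_eq0 orbb gE => /eqP.
Qed.

End homogeneous.

Section homogeneous_solution.
Context {R : realType} {n : nat}.
Local Notation pt := 'rV[R]_n.+1.
Local Notation simplex := (@simplex R n.+1).
Local Notation mesh := (@mesh R n.+1).
Variables (Om Os Od : set pt) (Ts Td : mesh) (k : nat).
Hypotheses (hdom : coupled_domain Om Os Od) (hTs : triangulation Os Ts)
  (hTd : triangulation Od Td) (conf : conforming Ts Td) (k1 : (1 <= k)%N).

Let fTs K : K \in Ts -> simplex_full K := triangulation_full hTs (K := K).
Let fTd K : K \in Td -> simplex_full K := triangulation_full hTd (K := K).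
Local Notation GamI := (interface Os Od).
Local Notation GamS := (outer_boundary Os Om).

(** Here w is the trace of the velocity, free of tangential part along the normal m, and l is the
    normal seen from the other subdomain. *)
Lemma collinear_zero (w m l : pt) :
  w = dot w m *: m -> dot w l = 0 -> dot l m != 0 -> w = 0.
Proof.
move=> wE; rewrite {1}wE dotZl (dotC m l) => /eqP + nz.
by rewrite mulf_eq0 (negPf nz) orbF => /eqP s0; rewrite wE s0 scale0r.
Qed.

Lemma velocity_zero (u : velocity R n.+1) :
  Zh k Ts Td GamS u ->
  (forall K, K \in Ts -> forall x, symgrad (vel u K) x = 0) ->
  (forall K a, K \in Ts -> a \in K -> forall x, hull (K `\ a)%fset x ->
     vel u K x = vel_bar u (K `\ a)%fset x) ->
  (forall K a, K \in Ts -> a \in K -> hull (K `\ a)%fset `<=` GamI ->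
    forall x, hull (K `\ a)%fset x ->
    tangential (normal K a) (vel_bar u (K `\ a)%fset x) = 0) ->
  (forall K a L b, K \in Ts -> a \in K -> hull (K `\ a)%fset `<=` GamI ->
    L \in Td -> b \in L -> (L `\ b)%fset = (K `\ a)%fset ->
    (forall L' b', L' \in Td -> b' \in L' -> (L' `\ b')%fset = (K `\ a)%fset ->
      L' = L /\ b' = b) ->
    forall x, hull (K `\ a)%fset x ->
    dot (vel_bar u (K `\ a)%fset x) (normal L b) = 0) ->
  forall K, K \in Ts -> forall x, vel u K x = 0.
Proof.
move=> [Pv [_ bS] _] e0 ub tan flux.
have [_ [_ [oO cO nO _] _] _ _] := hdom.
have vs K : K \in Ts -> poly_vec k (vel u K) by move=> KT; apply: Pv; rewrite inE KT.
have [K [a bK]] := exists_boundary_facet (bounded_subdomain hdom) hTs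
  (mesh_inhabited nO hTs).
have [KT Ka _] := bK.
have bar0 x : hull (K `\ a)%fset x -> vel_bar u (K `\ a)%fset x = 0.
  move=> Fx; have [FI|FS] := boundary_facet_dichotomy hdom hTs hTd conf bK; last first.
    by apply: bS => //; exists K, a.
  have [L [b [LT Lb E uniq]]] := interface_facet hdom hTs hTd conf KT Ka FI.
  have t0 := tan K a KT Ka FI x Fx; have f0 := flux K a L b KT Ka FI LT Lb E uniq x Fx.
  move/eqP: t0; rewrite /tangential subr_eq0 => /eqP wE.
  exact: (collinear_zero wE f0 (normal_transversal (fTs KT) Ka (fTd LT) Lb E)).
have vK : forall x, vel u K x = 0.
  apply: (rigid_zero (fTs KT) Ka (vs K KT) (e0 K KT)) => x Fx.
  by rewrite (ub K a KT Ka x Fx) bar0.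
apply: (facet_connected (S := fun K => forall x, vel u K x = 0) oO cO hTs).
  by exists K.
move=> K1 L1 K1T L1T v0 [c [b [Kc Lb E]]].
apply: (rigid_zero (fTs L1T) Lb (vs L1 L1T) (e0 L1 L1T)) => x Fx.
by rewrite (ub L1 b L1T Lb x Fx) -E -(ub K1 c K1T Kc) ?v0// E.
Qed.

Variables (mu kappa_f kappa_m alpha sigma beta theta C : R).
Hypotheses (mu0 : 0 < mu) (kf0 : 0 < kappa_f) (km0 : 0 < kappa_m)
  (al0 : 0 < alpha) (sg0 : 0 < sigma) (theta0 : 0 < theta) (C0 : 0 < C).
Hypothesis traceC : forall (K : simplex) a (w : pt -> R), simplex_full K ->
  a \in K -> Pk k w ->
  height K a * surf_int (K `\ a)%fset (fun x => w x * w x) <=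
  C * vol_int (hull K) (fun x => w x * w x).
Hypothesis regTs : forall K, K \in Ts -> diameter K <= theta * indiameter K.
Hypothesis beta_gt : @beta_threshold R n theta C < beta.

Lemma pressure_zero (p : pressure R n.+1) : Ph k Ts Td p ->
  (forall K, K \in Td -> forall x, prs_m p K x = prs p K x) ->
  (forall v, Zh k Ts Td GamS v -> bh Ts Td GamI p v = 0) ->
  same_pressure Ts Td p (Pressure (fun _ _ => 0) (fun _ _ => 0) (fun _ _ => 0)
    (fun _ _ => 0) (fun _ _ => 0)).
Proof.
move=> [[Pp mp] Ps Pd [Pm mm] Pb] pm orth.
have [_ [_ [oOs cOs nOs _] [oOd cOd nOd _]] _ _] := hdom.
have dis := mesh_disjoint hdom hTs hTd.
have z0 : poly_vec k (fun _ : pt => 0).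
  by move=> i; under eq_fun do rewrite mxE; exact: Pk_cst.
have zb (F : simplex) : is_facet Ts F -> poly_vec k (fun _ : pt => 0) by [].
(* The element spaces are discontinuous, so a field supported on a single element is admissible and
   isolates the equation of that element. *)
pose one (K : simplex) (w : pt -> pt) : simplex -> pt -> pt :=
  fun L => if L == K then w else fun=> 0.
have oneV T K w : poly_vec k w -> Vh k T (one K w).
  by move=> Pw L _; rewrite /one; case: ifP.
have oneE K w : one K w K = w by rewrite /one eqxx.
have oneN K w L x : L != K -> one K w L x = 0 by rewrite /one => /negPf ->.
have oneN' K w L : L != K -> one K w L = fun=> 0 by rewrite /one => /negPf ->.
have tests (w : vfield) (wm : vfield) : Vh k (Ts `|` Td)%fset w -> Vh k Td wm ->
    bh Ts Td GamI p (Velocity w (fun _ _ => 0) wm) = 0.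
  by move=> Vw Vm; apply: orth; split=> //; split=> // F _ _.
have d0 (x : pt) : divv (fun=> 0 : pt) x = 0 by exact: divv0.
have [cs [csP csF]] : exists c, (forall K x, K \in Ts -> prs p K x = c) /\
    forall F x, is_facet Ts F -> hull F x -> prs_bars p F x = c.
  apply: (mesh_pressure_const k1 oOs cOs hTs (mesh_inhabited nOs hTs)) => //.
    by move=> K KT; apply: Pp; rewrite inE KT.
  move=> K KT w Pw.
  have := tests (one K w) (fun _ _ => 0) (oneV _ _ _ Pw) (fun _ _ => z0).
  (* The two meshes have no common element, so the terms of the other subdomain vanish. *)
  have KL L : L \in Td -> L != K by move=> LT; apply/eqP => E; apply: (dis K KT); rewrite -E.
  rewrite /bh /bh_sub /=.
  rewrite (elem_int_single fTs KT); last first.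
    by move=> L LT LK x; rewrite oneN'// d0 mulr0.
  rewrite (bdry_int_single fTs KT); last first.
    by move=> L F m LT LK x; rewrite oneN// dot0l mulr0.
  rewrite !(elem_int_zero fTd, bdry_int_zero fTd, part_int_zero fTd,
    part_int_zero fTs)/=.
  - by rewrite oneE => H; rewrite -[RHS]H; ring.
  - by move=> M m l MT Mm y _; rewrite dot0l mulr0.
  - by move=> M MT y _; rewrite d0 mulr0.
  - by move=> M m l MT Mm _ y _; rewrite dot0l mulr0.
  - by move=> M m l MT Mm y _; rewrite oneN ?dot0l ?mulr0// KL.
  - by move=> M MT y _; rewrite oneN' ?d0 ?mulr0// KL.
  - by move=> M m l MT Mm _ y _; rewrite dot0l mulr0.
have [cd [cdP cdF]] : exists c, (forall K x, K \in Td -> prs p K x = c) /\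
    forall F x, is_facet Td F -> hull F x -> prs_bard p F x = c.
  apply: (mesh_pressure_const k1 oOd cOd hTd (mesh_inhabited nOd hTd)) => //.
    by move=> K KT; apply: Pp; rewrite inE KT orbT.
  move=> K KT w Pw.
  have := tests (one K w) (fun _ _ => 0) (oneV _ _ _ Pw) (fun _ _ => z0).
  have KL L : L \in Ts -> L != K by move=> LT; apply/eqP => E; apply: (dis L LT); rewrite E.
  rewrite /bh /bh_sub /=.
  rewrite (elem_int_single (T := Td)
    (f := fun L x => prs p L x * divv (one K w L) x) fTd KT); last first.
    by move=> L LT LK x; rewrite oneN'// d0 mulr0.
  rewrite (bdry_int_single (T := Td)
    (f := fun L F m x => prs_bard p F x * dot (one K w L x) m) fTd KT); last first.
    by move=> L F m LT LK x; rewrite oneN// dot0l mulr0.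
  rewrite !(elem_int_zero fTs, elem_int_zero fTd, bdry_int_zero fTs,
    bdry_int_zero fTd, part_int_zero fTd, part_int_zero fTs)/=.
  - by rewrite oneE => H; rewrite -[RHS]H; ring.
  - by move=> M m l MT Mm y _; rewrite dot0l mulr0.
  - by move=> M MT y _; rewrite d0 mulr0.
  - by move=> M m l MT Mm _ y _; rewrite dot0l mulr0.
  - by move=> M m l MT Mm _ y _; rewrite dot0l mulr0.
  - by move=> M m l MT Mm y _; rewrite oneN ?dot0l ?mulr0// KL.
  - by move=> M MT y _; rewrite oneN' ?d0 ?mulr0// KL.
have [cm [cmP cmF]] : exists c, (forall K x, K \in Td -> prs_m p K x = c) /\
    forall F x, is_facet Td F -> hull F x -> prs_barm p F x = c.
  apply: (mesh_pressure_const k1 oOd cOd hTd (mesh_inhabited nOd hTd)) => //.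
  move=> K KT w Pw.
  have := tests (fun _ _ => 0) (one K w) (fun _ _ => z0) (oneV _ _ _ Pw).
  rewrite /bh /bh_sub /=.
  rewrite (elem_int_single (T := Td)
    (f := fun L x => prs_m p L x * divv (one K w L) x) fTd KT); last first.
    by move=> L LT LK x; rewrite oneN'// d0 mulr0.
  rewrite (bdry_int_single (T := Td)
    (f := fun L F m x => prs_barm p F x * dot (one K w L x) m) fTd KT); last first.
    by move=> L F m LT LK x; rewrite oneN// dot0l mulr0.
  rewrite !(elem_int_zero fTs, elem_int_zero fTd, bdry_int_zero fTs,
    bdry_int_zero fTd, part_int_zero fTd, part_int_zero fTs)/=.
  - by rewrite oneE => H; rewrite -[RHS]H; ring.
  all: try by [move=> M m l MT Mm y _; rewrite dot0l mulr0
    |move=> M MT y _; rewrite d0 mulr0|move=> M m l MT Mm _ y _; rewrite dot0l mulr0].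
have [Kd KdT] := mesh_inhabited nOd hTd; have [Ks KsT] := mesh_inhabited nOs hTs.
have cm0 : cm = 0.
  apply: (mean_zero_const (c := fun=> cm) (s := cm) fTd _ _ mm KdT).
    by move=> K KT; apply/funext => x; exact: cmP.
  by right.
(* p and p^m agree on [Td], so the mean condition on p^m also fixes p there. *)
have cd0 : cd = 0 by rewrite -(cdP Kd 0 KdT) -pm// cmP.
have fT K : K \in (Ts `|` Td)%fset -> simplex_full K.
  by rewrite inE => /orP[/fTs|/fTd].
(* p is now 0 on [Td] and constant on [Ts], with mean zero over the union. *)
have cs0 : cs = 0.
  have := mean_zero_const (c := fun K => if K \in Ts then cs else 0) (s := cs) fT _ _ mp.
  move=> /(_ _ _ Ks); rewrite KsT inE KsT; apply=> //.
    move=> K; rewrite inE; case KT : (K \in Ts) => /= KU; apply/funext => x.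
      exact: csP.
    by rewrite cdP.
  by move=> K _; case: ifP => _; [right|left].
split=> /=.
- move=> K /=; rewrite inE => /orP[KT|KT] x _; first by rewrite csP.
  by rewrite cdP.
- by move=> F FT x Fx; rewrite csF.
- by move=> F FT x Fx; rewrite cdF.
- by move=> K /= KT x _; rewrite cmP.
- by move=> F FT x Fx; rewrite cmF.
Qed.

Lemma homogeneous_zero (u : velocity R n.+1) (p : pressure R n.+1) :
  Zh k Ts Td GamS u -> Ph k Ts Td p ->
  (forall v, Zh k Ts Td GamS v ->
    ah Ts Td GamI mu kappa_f kappa_m alpha beta u v + bh Ts Td GamI p v = 0) ->
  (forall q, Ph k Ts Td q -> bh Ts Td GamI q u - ch Td kappa_m sigma p q = 0) ->
  null_fields Ts Td u p.
Proof.
move=> Zu Pp eq1 eq2.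
(* The first equation with v = u, minus the second with q = p. *)
have energy : ah Ts Td GamI mu kappa_f kappa_m alpha beta u u +
    ch Td kappa_m sigma p p = 0.
  by have := eq1 u Zu; have := eq2 p Pp; lra.
have [[e1 e2 e3] [e4 e5 e6]] := energy_zero fTs fTd mu0 kf0 km0 al0 sg0 theta0 C0
  traceC regTs beta_gt Zu Pp energy.
have flux := interface_flux hTs hTd (c := ch Td kappa_m sigma p) Zu e3.
have us := velocity_zero Zu e1 e2 e5.
have {us} us K : K \in Ts -> forall x, vel u K x = 0.
  apply: us => //; apply: flux => //.
    by move=> q Pq; apply/eqP; rewrite -subr_eq0 eq2.
  move=> q q0 qm0; apply: elem_int_zero => // K' _ x _.
  by rewrite q0 qm0 subrr !mulr0.
have u0 K : K \in (Ts `|` Td)%fset -> forall x, vel u K x = 0.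
  by rewrite inE => /orP[/us|/e3].
have b0 : eq_on (is_facet Ts) (vel_bar u) (fun _ _ => 0).
  by move=> F [K [a [KT Ka ->]]] x Fx; rewrite -e2// us.
split.
  split=> //=; first by move=> K KT x _; exact: u0.
  by move=> K KT x _; exact: e4.
(* For a null velocity the first equation reduces to b(p, v) = 0. *)
apply: pressure_zero => // v Zv.
by rewrite -(eq1 v Zv) (ah_zero _ fTs fTd _ _ _ _ _ _ u0 b0 e4) add0r.
Qed.

End homogeneous_solution.

(** * Existence *)

Section data_integrals.
Context {R : realType} {d : nat}.
Local Notation pt := 'rV[R]_d.

(** An open set is a countable union of boxes with rational center and radius 1 / (m + 1). *)
Lemma rv_measurable_open (U : set pt) : open U -> rv_measurable U.
Proof.
move=> oU.
pose B (i : 'rV[rat]_d * nat) : set pt := box (map_mx ratr i.1) (i.2.+1%:R)^-1.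
pose F i := if `[< B i `<=` U >] then rv_of_tuple @^-1` B i else set0.
rewrite /rv_measurable (_ : _ @^-1` U = \bigcup_i F i); last first.
  apply/seteqP; split=> t /=; last first.
    by move=> [i _]; rewrite /F; case: asboolP => // BU Bt; exact: BU.
  move=> Ut; set x := rv_of_tuple t.
  have /nbhs_ballP[e /= e0 eU] := open_nbhs_nbhs (conj oU Ut).
  have [m mE] : exists m, (m.+1%:R)^-1 < e / 2 :> R.
    have e2 : 0 < (e / 2)^-1 by rewrite invr_gt0 divr_gt0.
    exists (Num.bound (e / 2)^-1).
    rewrite invf_plt ?posrE ?divr_gt0//.
    by apply: lt_trans (archi_boundP (ltW e2)) _; rewrite ltr_nat.
  set r : R := (m.+1%:R)^-1 in mE.
  have r0 : 0 < r by rewrite invr_gt0.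
  have [q qE] : exists q : 'I_d -> rat, forall i, `|x 0 i - ratr (q i)| <= r.
    suff H i : exists q, `|x 0 i - ratr q| <= r.
      by have [q qE] := boolp.choice H; exists q.
    have [|q] := @rat_in_itvoo R (x 0 i - r) (x 0 i + r).
      by rewrite ltrBlDr -addrA ltrDl addr_gt0.
    rewrite in_itv/= => /andP[q1 q2]; exists q.
    by rewrite ler_norml; apply/andP; split; lra.
  exists (\row_i q i, m) => //; rewrite /F; case: asboolP => [_ /= i|[]].
    by rewrite !mxE; have := qE i; rewrite mxE.
  move=> y /= yB; apply: eU; split=> // i j; rewrite ord1.
  have := yB j; have := qE j; rewrite /= !mxE -/r.
  move: (tnth t j) (y 0 j) (ratr (q j)) => a b c h1 h2.
  rewrite -ball_normE /=; apply: le_lt_trans (ler_distD c _ _) _.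
  by rewrite (distrC c); lra.
apply: countable_bigcupT_measurable => // i.
by rewrite /F; case: asboolP => // _; exact: rv_measurable_box.
Qed.

Definition rv_integrable (A : set pt) (f : pt -> R) :=
  (lebesgue_tuple R d).-integrable (rv_of_tuple @^-1` A)
    (EFin \o (f \o rv_of_tuple)).

Lemma rv_integrableD A f g : rv_measurable A -> rv_integrable A f ->
  rv_integrable A g -> rv_integrable A (fun x => f x + g x).
Proof. by move=> mA fi gi; exact: (integrableD mA fi gi). Qed.

Lemma rv_integrable_sum A I (r : seq I) (F : I -> pt -> R) : rv_measurable A ->
  (forall i, rv_integrable A (F i)) ->
  rv_integrable A (fun x => \sum_(i <- r) F i x).
Proof.
move=> mA Fi; elim: r => [|i r IH].
  by under eq_fun do rewrite big_nil; exact: integrable0.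
by under eq_fun do rewrite big_cons; exact: rv_integrableD.
Qed.

Lemma vol_int_lincomb A c f g : rv_measurable A -> rv_integrable A f ->
  rv_integrable A g ->
  vol_int A (fun x => c * f x + g x) = c * vol_int A f + vol_int A g.
Proof.
move=> mA fi gi; have cfi : rv_integrable A (fun x => c * f x).
  exact: (integrableZl mA c fi).
rewrite /vol_int (RintegralD mA cfi gi); congr (_ + _).
by apply: RintegralZl; [exact: mA|exact: fi].
Qed.

(** From |h p| <= h^2 + p^2, where p^2 is integrable on the bounded set [B]. *)
Lemma L2_Pk_integrable k (O B : set pt) (h p : pt -> R) : rv_measurable O ->
  mbounded B -> L2 O h -> Pk k p -> rv_integrable (O `&` B) (fun x => h x * p x).
Proof.
move=> mO bB [mh hoo] Pp.
have mOB : rv_measurable (O `&` B) by exact: measurableI mO bB.1.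
have h2 : rv_integrable (O `&` B) (fun x => h x ^+ 2).
  apply: (integrableS mO) => //; first by move=> t [].
  apply/integrableP; split.
    by apply/measurable_EFinP; exact: measurable_funX.
  rewrite (eq_integral (fun t => (h (rv_of_tuple t) ^+ 2)%:E))// => t _ /=.
  by rewrite ger0_norm// sqr_ge0.
have p2 : rv_integrable (O `&` B) (fun x => p x * p x).
  by apply: (integrableS bB.1) => //; [move=> t []|exact: Pk_integrable bB (PkM Pp Pp)].
apply: (le_integrable mOB _ _ (rv_integrableD mOB h2 p2)).
  apply/measurable_EFinP; apply: measurable_funM.
    by apply: measurable_funS mh => // t [].
  by apply: measurable_funS (Pk_mrv Pp) => //; exact: measurableT.
move=> t _ /=; rewrite lee_fin; move: (h _) (p _) => a b.
rewrite (ger0_norm (x := _ + _)); last by rewrite -expr2 addr_ge0// sqr_ge0.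
rewrite ler_norml; apply/andP; split.
  by have := sqr_ge0 (a + b); have := sqr_ge0 a; have := sqr_ge0 b; nra.
by have := sqr_ge0 (a - b); have := sqr_ge0 a; have := sqr_ge0 b; nra.
Qed.

End data_integrals.

Section discrete_space.
Context {R : realType} {n : nat}.
Local Notation pt := 'rV[R]_n.+1.
Local Notation simplex := (@simplex R n.+1).
Local Notation mesh := (@mesh R n.+1).
Local Notation state := (@state R n).
Variables (Ts Td : mesh) (k : nat) (GamS : set pt).
Hypotheses (fTs : forall K, K \in Ts -> simplex_full K)
  (fTd : forall K, K \in Td -> simplex_full K).

Definition hdg_space (w : state) : Prop :=
  Zh k Ts Td GamS (vel_of w) /\ Ph k Ts Td (prs_of w).

Definition null_state (w : state) : Prop :=
  null_fields Ts Td (vel_of w) (prs_of w).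

Definition zero_velocity : velocity R n.+1 :=
  Velocity (fun _ _ => 0) (fun _ _ => 0) (fun _ _ => 0).

Definition zero_pressure : pressure R n.+1 :=
  Pressure (fun _ _ => 0) (fun _ _ => 0) (fun _ _ => 0) (fun _ _ => 0) (fun _ _ => 0).

Lemma hdg_space_poly w : hdg_space w -> poly_state Ts Td w.
Proof.
move=> [[Pv [Pb _] Pm] [[Pp _] Ps Pd [Ppm _] Pbm]].
split; split.
- by move=> K KT; exact/polyv_Pk/Pv.
- by move=> F FT; exact/polyv_Pk/Pb.
- by move=> K KT; exact/polyv_Pk/Pm.
- by move=> K KT; exact/polyf_Pk/Pp.
- by move=> F FT; exact/polyf_Pk/Ps.
- by move=> F FT; exact/polyf_Pk/Pd.
- by move=> K KT; exact/polyf_Pk/Ppm.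
- by move=> F FT; exact/polyf_Pk/Pbm.
Qed.

Lemma zero_velocity_space : Zh k Ts Td GamS zero_velocity.
Proof.
have z0 : poly_vec k (fun _ : pt => 0).
  by move=> i; under eq_fun do rewrite mxE; exact: Pk_cst.
have hV (T : mesh) : Vh k T (fun _ _ => 0) by move=> K _; exact: z0.
have hB : Vbarh k Ts GamS (fun _ _ => 0).
  split; first by move=> F _; exact: z0.
  by move=> F _ _ x _.
split; [exact: hV|exact: hB|exact: hV].
Qed.

Lemma union_full K : K \in (Ts `|` Td)%fset -> simplex_full K.
Proof. by rewrite inE => /orP[/fTs|/fTd]. Qed.

Lemma zero_pressure_space : Ph k Ts Td zero_pressure.
Proof.
have z l : Pk l (fun=> 0 : R) := @Pk_cst R n.+1 l 0.
have hQ (T : mesh) : (forall K, K \in T -> simplex_full K) -> Qh k T (fun _ _ => 0).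
  move=> fT; split; first by move=> K _; exact: z.
  by rewrite (elem_int_zero fT).
have hB (T : mesh) : Qbarh k T (fun _ _ => 0) by move=> F _; exact: z.
split; [exact: (hQ _ union_full)|exact: hB|exact: hB|exact: (hQ _ fTd)|exact: hB].
Qed.

Lemma poly_vec_lincomb c (v w : pt -> pt) : poly_vec k v -> poly_vec k w ->
  poly_vec k (fun x => c *: v x + w x).
Proof.
move=> Pv Pw i.
rewrite (_ : (fun x => _) = fun x => c * v x 0 i + w x 0 i).
  by apply: PkD; [exact/PkZ/Pv|exact: Pw].
by apply/funext => x; rewrite mxE [in LHS]mxE.
Qed.

Lemma hdg_space_lincomb c v w : hdg_space v -> hdg_space w -> hdg_space (c *: v + w).
Proof.
move=> hv hw; have [pv pw] := (hdg_space_poly hv, hdg_space_poly hw).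
have [[vv [vb v0] vm] [[vp vq] vs vd [vpm vqm] vbm]] := hv.
have [[wv [wb w0] wm] [[wp wq] ws wd [wpm wqm] wbm]] := hw.
have Pl l (f g : pt -> R) : Pk l f -> Pk l g -> Pk l (fun x => c * f x + g x).
  by move=> Pf Pg; apply: PkD => //; exact: PkZ.
have mp : elem_int (Ts `|` Td)%fset (prs (prs_of (c *: v + w))) = 0.
  have lf K : K \in (Ts `|` Td)%fset ->
      lin_family (poly_state Ts Td) (fun s => prs (prs_of s) K).
    move=> KT; split=> [s [_ [ps _ _ _ _]]|c' s t _ _ x]; first exact: ps.
    by rewrite state_lincomb.
  by rewrite (@lin_elem _ _ Ts Td _ (fun K s => prs (prs_of s) K) union_full lf
    c v w pv pw) vq wq mulr0 addr0.
have mm : elem_int Td (prs_m (prs_of (c *: v + w))) = 0.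
  have lf K : K \in Td -> lin_family (poly_state Ts Td) (fun s => prs_m (prs_of s) K).
    move=> KT; split=> [s [_ [_ _ _ ps _]]|c' s t _ _ x]; first exact: ps.
    by rewrite state_lincomb.
  by rewrite (@lin_elem _ _ Ts Td _ (fun K s => prs_m (prs_of s) K) fTd lf c v w pv pw)
    vqm wqm mulr0 addr0.
split; split.
- by move=> K KT; rewrite state_lincomb; apply: poly_vec_lincomb; [exact: vv|exact: wv].
- split=> F FT.
    by rewrite state_lincomb; apply: poly_vec_lincomb; [exact: vb|exact: wb].
  by move=> FS x Fx; rewrite state_lincomb v0// w0// scaler0 addr0.
- by move=> K KT; rewrite state_lincomb; apply: poly_vec_lincomb; [exact: vm|exact: wm].
- split; last exact: mp.
  by move=> K KT; rewrite state_lincomb; apply: Pl; [exact: vp|exact: wp].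
- by move=> F FT; rewrite state_lincomb; apply: Pl; [exact: vs|exact: ws].
- by move=> F FT; rewrite state_lincomb; apply: Pl; [exact: vd|exact: wd].
- split; last exact: mm.
  by move=> K KT; rewrite state_lincomb; apply: Pl; [exact: vpm|exact: wpm].
- by move=> F FT; rewrite state_lincomb; apply: Pl; [exact: vbm|exact: wbm].
Qed.

Definition facets (T : mesh) : seq simplex :=
  flatten [seq [seq (K `\ a)%fset | a <- K] | K <- T].

Lemma mem_facets T F : is_facet T F <-> F \in facets T.
Proof.
split=> [[K [a [KT Ka ->]]]|].
  by apply/flattenP; exists [seq (K `\ a)%fset | a <- K]; apply/mapP; [exists K|exists a].
by move=> /flattenP[_ /mapP[K KT ->] /mapP[a Ka ->]]; exists K, a.
Qed.

(** The functionals are the values at unisolvent points of each hull. *)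
Lemma separated_scalar l (s : seq simplex) (f : state -> simplex -> pt -> R) :
  (forall c v w K x, f (c *: v + w) K x = c * f v K x + f w K x) ->
  (forall w K, hdg_space w -> K \in s -> Pk l (f w K)) ->
  finitely_separated hdg_space (fun w => forall K, K \in s -> forall x, hull K x -> f w K x = 0).
Proof.
move=> lf Pf; apply: separated_all => K Ks.
have [N [x [_ uni]]] := @Pk_unisolvent R n.+1 l (hull K).
exists 'I_N, (fun i w => f w K (x i)); split=> [i c v w|w Sw w0]; first exact: lf.
by apply: uni => //; exact: Pf.
Qed.

Lemma separated_vector (s : seq simplex) (f : state -> simplex -> pt -> pt) :
  (forall c v w K x, f (c *: v + w) K x = c *: f v K x + f w K x) ->
  (forall w K, hdg_space w -> K \in s -> poly_vec k (f w K)) ->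
  finitely_separated hdg_space (fun w => forall K, K \in s -> forall x, hull K x -> f w K x = 0).
Proof.
move=> lf Pf.
have si i : i \in index_enum 'I_n.+1 -> finitely_separated hdg_space
    (fun w => forall K, K \in s -> forall x, hull K x -> f w K x 0 i = 0).
  move=> _; apply: (@separated_scalar k s (fun w K x => f w K x 0 i)) => [c v w K x|w K Sw Ks].
    by rewrite lf mxE [in LHS]mxE.
  exact: Pf.
have [I [phi [phil phiZ]]] := separated_all si.
exists I, phi; split=> // w Sw w0 K Ks x Kx; apply/rowP => i; rewrite [RHS]mxE.
exact: (phiZ w Sw w0 i (mem_index_enum i) K Ks x Kx).
Qed.

Lemma hdg_space_separated : finitely_separated hdg_space null_state.
Proof.
have s1 : finitely_separated hdg_space (fun w => forall K, K \in enum_fset (Ts `|` Td)%fset ->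
    forall x, hull K x -> vel (vel_of w) K x = 0).
  apply: separated_vector => [c v w K x|w K [[h _ _] _]]; last exact: h.
  by rewrite state_lincomb.
have s2 : finitely_separated hdg_space (fun w => forall K, K \in facets Ts ->
    forall x, hull K x -> vel_bar (vel_of w) K x = 0).
  apply: separated_vector => [c v w K x|w K [[_ [h _] _] _] /mem_facets KT]; last exact: h.
  by rewrite state_lincomb.
have s3 : finitely_separated hdg_space (fun w => forall K, K \in enum_fset Td ->
    forall x, hull K x -> vel_m (vel_of w) K x = 0).
  apply: separated_vector => [c v w K x|w K [[_ _ h] _]]; last exact: h.
  by rewrite state_lincomb.
have s4 : finitely_separated hdg_space (fun w => forall K, K \in enum_fset (Ts `|` Td)%fset ->
    forall x, hull K x -> prs (prs_of w) K x = 0).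
  apply: (separated_scalar (l := k.-1)) => [c v w K x|w K [_ [[h _] _ _ _ _]]];
    last exact: h.
  by rewrite state_lincomb.
have s5 : finitely_separated hdg_space (fun w => forall K, K \in facets Ts ->
    forall x, hull K x -> prs_bars (prs_of w) K x = 0).
  apply: (separated_scalar (l := k)) => [c v w K x|w K [_ [_ h _ _ _]] /mem_facets KT];
    last exact: h.
  by rewrite state_lincomb.
have s6 : finitely_separated hdg_space (fun w => forall K, K \in facets Td ->
    forall x, hull K x -> prs_bard (prs_of w) K x = 0).
  apply: (separated_scalar (l := k)) => [c v w K x|w K [_ [_ _ h _ _]] /mem_facets KT];
    last exact: h.
  by rewrite state_lincomb.
have s7 : finitely_separated hdg_space (fun w => forall K, K \in enum_fset Td ->
    forall x, hull K x -> prs_m (prs_of w) K x = 0).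
  apply: (separated_scalar (l := k.-1)) => [c v w K x|w K [_ [_ _ _ [h _] _]]];
    last exact: h.
  by rewrite state_lincomb.
have s8 : finitely_separated hdg_space (fun w => forall K, K \in facets Td ->
    forall x, hull K x -> prs_barm (prs_of w) K x = 0).
  apply: (separated_scalar (l := k)) => [c v w K x|w K [_ [_ _ _ _ h]] /mem_facets KT];
    last exact: h.
  by rewrite state_lincomb.
have [I [phi [phil phiZ]]] := separated_and (separated_and (separated_and s1 s2) s3)
  (separated_and (separated_and (separated_and s4 s5) s6) (separated_and s7 s8)).
exists I, phi; split=> // w Sw w0.
have [[[h1 h2] h3] [[[h4 h5] h6] [h7 h8]]] := phiZ w Sw w0.
split; split=> K.
- exact: h1.
- by move=> /mem_facets; exact: h2.
- exact: h3.
- exact: h4.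
- by move=> /mem_facets; exact: h5.
- by move=> /mem_facets; exact: h6.
- exact: h7.
- by move=> /mem_facets; exact: h8.
Qed.

End discrete_space.

Section well_posedness.
Context {R : realType} {n : nat}.
Local Notation pt := 'rV[R]_n.+1.
Local Notation simplex := (@simplex R n.+1).
Local Notation mesh := (@mesh R n.+1).
Local Notation state := (@state R n).
Variables (Om Os Od : set pt) (Ts Td : mesh) (k : nat).
Hypotheses (hdom : coupled_domain Om Os Od) (hTs : triangulation Os Ts)
  (hTd : triangulation Od Td) (conf : conforming Ts Td) (k1 : (1 <= k)%N).

Let fTs K : K \in Ts -> simplex_full K := triangulation_full hTs (K := K).
Let fTd K : K \in Td -> simplex_full K := triangulation_full hTd (K := K).
Let facetI F : is_facet Td F -> hull F `<=` interface Os Od -> is_facet Ts F :=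
  interface_sub hdom hTs hTd conf (F := F).
Local Notation GamI := (interface Os Od).
Local Notation GamS := (outer_boundary Os Om).
Local Notation space := (hdg_space Ts Td k GamS).

Variables (f : pt -> pt) (g : pt -> R).
Hypotheses (L2f : forall i, L2 Os (fun x => f x 0 i)) (L2g : L2 Od g).

(** Right-hand side of the sum of the two equations; the minus sign is that of -(g, q). *)
Definition load (w : state) : R :=
  \sum_(K <- Ts) vol_int (Os `&` hull K) (fun x => dot (f x) (vel (vel_of w) K x)) -
  \sum_(K <- Td) vol_int (Od `&` hull K) (fun x => g x * prs (prs_of w) K x).

Let oOs : open Os. Proof. by have [_ [_ [] ]] := hdom. Qed.
Let oOd : open Od. Proof. by have [_ [_ _ [] ]] := hdom. Qed.

Let mOs K : K \in Ts -> rv_measurable (Os `&` hull K).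
Proof.
by move=> KT; apply: measurableI; [exact: rv_measurable_open|exact: (hull_mbounded (fTs KT)).1].
Qed.

Let mOd K : K \in Td -> rv_measurable (Od `&` hull K).
Proof.
by move=> KT; apply: measurableI; [exact: rv_measurable_open|exact: (hull_mbounded (fTd KT)).1].
Qed.

Lemma load_lincomb c v w : space v -> space w ->
  load (c *: v + w) = c * load v + load w.
Proof.
move=> [[Pv _ _] [[Pp _] _ _ _ _]] [[Qv _ _] [[Qp _] _ _ _ _]].
have fi (u : simplex -> pt -> pt) K : K \in Ts -> poly_vec k (u K) ->
    rv_integrable (Os `&` hull K) (fun x => dot (f x) (u K x)).
  move=> KT Pu; apply: rv_integrable_sum; first exact: mOs.
  move=> i; apply: (L2_Pk_integrable (rv_measurable_open oOs) (hull_mbounded (fTs KT)) (L2f i)).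
  exact: Pu.
have gi (u : simplex -> pt -> R) K : K \in Td -> Pk k.-1 (u K) ->
    rv_integrable (Od `&` hull K) (fun x => g x * u K x).
  move=> KT Pu.
  exact: (L2_Pk_integrable (rv_measurable_open oOd) (hull_mbounded (fTd KT)) L2g Pu).
have s1 : \sum_(K <- Ts) vol_int (Os `&` hull K)
      (fun x => dot (f x) (vel (vel_of (c *: v + w)) K x)) =
    c * \sum_(K <- Ts) vol_int (Os `&` hull K) (fun x => dot (f x) (vel (vel_of v) K x)) +
    \sum_(K <- Ts) vol_int (Os `&` hull K) (fun x => dot (f x) (vel (vel_of w) K x)).
  rewrite mulr_sumr -big_split big_seq [RHS]big_seq; apply: eq_bigr => K KT.
  have KU : K \in (Ts `|` Td)%fset by rewrite inE KT.
  rewrite -[RHS](vol_int_lincomb _ (mOs KT) (fi _ K KT (Pv K KU)) (fi _ K KT (Qv K KU))).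
  by apply: eq_vol_int => x _; rewrite state_lincomb dotDr dotZr.
have s2 : \sum_(K <- Td) vol_int (Od `&` hull K)
      (fun x => g x * prs (prs_of (c *: v + w)) K x) =
    c * \sum_(K <- Td) vol_int (Od `&` hull K) (fun x => g x * prs (prs_of v) K x) +
    \sum_(K <- Td) vol_int (Od `&` hull K) (fun x => g x * prs (prs_of w) K x).
  rewrite mulr_sumr -big_split big_seq [RHS]big_seq; apply: eq_bigr => K KT.
  have KU : K \in (Ts `|` Td)%fset by rewrite inE KT orbT.
  rewrite -[RHS](vol_int_lincomb _ (mOd KT) (gi _ K KT (Pp K KU)) (gi _ K KT (Qp K KU))).
  by apply: eq_vol_int => x _; rewrite state_lincomb mulrDr mulrCA.
by rewrite /load s1 s2; ring.
Qed.

Lemma vol_int0 (A : set pt) : vol_int A (fun=> 0) = 0.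
Proof. by rewrite /vol_int /Rintegral integral0. Qed.

Lemma velocity_load0 (v : velocity R n.+1) :
  (forall K x, K \in Ts -> hull K x -> vel v K x = 0) ->
  \sum_(K <- Ts) vol_int (Os `&` hull K) (fun x => dot (f x) (vel v K x)) = 0.
Proof.
move=> v0; rewrite big_seq big1// => K KT; rewrite -[RHS](vol_int0 (Os `&` hull K)).
by apply: eq_vol_int => x [_ Kx]; rewrite v0// dot0.
Qed.

Lemma pressure_load0 (q : pressure R n.+1) :
  (forall K x, K \in Td -> hull K x -> prs q K x = 0) ->
  \sum_(K <- Td) vol_int (Od `&` hull K) (fun x => g x * prs q K x) = 0.
Proof.
move=> q0; rewrite big_seq big1// => K KT; rewrite -[RHS](vol_int0 (Od `&` hull K)).
by apply: eq_vol_int => x [_ Kx]; rewrite q0// mulr0.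
Qed.

Lemma load_null w : null_state Ts Td w -> load w = 0.
Proof.
move=> [[v0 _ _] [p0 _ _ _ _]]; rewrite /load velocity_load0.
  rewrite pressure_load0 ?subr0// => K x KT Kx.
  by apply: p0 => //; rewrite /= inE KT orbT.
by move=> K x KT Kx; apply: v0 => //; rewrite /= inE KT.
Qed.

Variables (mu kappa_f kappa_m alpha sigma beta theta C : R).
Hypotheses (mu0 : 0 < mu) (kf0 : 0 < kappa_f) (km0 : 0 < kappa_m)
  (al0 : 0 < alpha) (sg0 : 0 < sigma) (theta0 : 0 < theta) (C0 : 0 < C).
Hypothesis traceC : forall (K : simplex) a (w : pt -> R), simplex_full K ->
  a \in K -> Pk k w ->
  height K a * surf_int (K `\ a)%fset (fun x => w x * w x) <=
  C * vol_int (hull K) (fun x => w x * w x).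
Hypothesis regTs : forall K, K \in Ts -> diameter K <= theta * indiameter K.
Hypothesis beta_gt : @beta_threshold R n theta C < beta.

Local Notation form := (hdg_form Ts Td GamI mu kappa_f kappa_m alpha sigma beta).
Local Notation ah := (ah Ts Td GamI mu kappa_f kappa_m alpha beta).
Local Notation bh := (bh Ts Td GamI).
Local Notation ch := (ch Td kappa_m sigma).
Local Notation solution := (hdg_solution k Om Os Od Ts Td mu kappa_f kappa_m alpha
  sigma beta f g).

Let fU K : K \in (Ts `|` Td)%fset -> simplex_full K := union_full fTs fTd (K := K).

(** The element fields vanish off the mesh too, by polynomiality, whereas \bar v enters the forms
    undifferentiated, through its values on facets. *)
Lemma null_velocity w : space w -> null_state Ts Td w ->
  [/\ forall K, K \in (Ts `|` Td)%fset -> forall x, vel (vel_of w) K x = 0,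
      eq_on (is_facet Ts) (vel_bar (vel_of w)) (fun _ _ => 0) &
      forall K, K \in Td -> forall x, vel_m (vel_of w) K x = 0].
Proof.
move=> Sw [[v0 b0 m0] _]; have [[pv _ pm] _] := hdg_space_poly Sw; split=> //.
- by move=> K KU; apply: (polyv_zero (fU KU) (pv K KU)); exact: v0.
- by move=> K KT; apply: (polyv_zero (fTd KT) (pm K KT)); exact: m0.
Qed.

Lemma ch_zero p q : (forall K, K \in Td -> forall x, hull K x -> prs q K x = 0) ->
  (forall K, K \in Td -> forall x, hull K x -> prs_m q K x = 0) -> ch q p = 0 /\ ch p q = 0.
Proof.
move=> q0 qm0; split; apply: (elem_int_zero fTd) => K KT x Kx.
  by rewrite q0// qm0// subrr mul0r mulr0.
by rewrite q0// qm0// subrr !mulr0.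
Qed.

Lemma hdg_form_null v z : space v -> space z -> null_state Ts Td z -> form z v = 0.
Proof.
move=> Sv Sz Nz; have [u0 b0 m0] := null_velocity Sz Nz; have [_ Np] := Nz.
have [p0 _ _ pm0 _] := Np.
rewrite /hdg_form (ah_zero _ fTs fTd _ _ _ _ _ _ u0 b0 m0).
rewrite (bh_zero_pressure _ fTs fTd _ Np) (bh_zero_velocity fTs fTd facetI _ u0 b0 m0).
have pd0 K : K \in Td -> forall x, hull K x -> prs (prs_of z) K x = 0.
  by move=> KT; apply: p0; rewrite /= inE KT orbT.
by rewrite (ch_zero _ pd0 pm0).1 !addr0 subr0.
Qed.

Local Notation zv := (@zero_velocity R n).
Local Notation zp := (@zero_pressure R n).

Lemma null_zero_velocity : 
  [/\ forall K, K \in (Ts `|` Td)%fset -> forall x, vel zv K x = 0,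
      eq_on (is_facet Ts) (vel_bar zv) (fun _ _ => 0) &
      forall K, K \in Td -> forall x, vel_m zv K x = 0].
Proof. by split. Qed.

(** A state with zero pressure tests the first equation alone. *)
Lemma form_velocity_test v z :
  form v (state_of z zp) = ah (vel_of v) z + bh (prs_of v) z.
Proof.
rewrite /hdg_form vel_ofK prs_ofK (bh_zero_pressure (p := zp) _ fTs fTd); last by split.
by rewrite (ch_zero _ _ _).2// addr0 subr0.
Qed.

(** A state with zero velocity tests the second equation alone; symmetry of a_h moves the zero field
    to the first argument. *)
Lemma form_pressure_test v q :
  form v (state_of zv q) = bh q (vel_of v) - ch (prs_of v) q.
Proof.
have [u0 b0 m0] := null_zero_velocity.
rewrite /hdg_form vel_ofK prs_ofK ah_sym (ah_zero _ fTs fTd _ _ _ _ _ _ u0 b0 m0).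
by rewrite (bh_zero_velocity fTs fTd facetI _ u0 b0 m0) !add0r.
Qed.

Lemma space_velocity z : Zh k Ts Td GamS z -> space (state_of z zp).
Proof.
move=> Zz; split; first by rewrite vel_ofK.
by rewrite prs_ofK; exact: zero_pressure_space fTs fTd.
Qed.

Lemma space_pressure q : Ph k Ts Td q -> space (state_of zv q).
Proof.
move=> Pq; split; last by rewrite prs_ofK.
by rewrite vel_ofK; exact: zero_velocity_space.
Qed.

Lemma hdg_form_injective v : space v -> (forall w, space w -> form v w = 0) ->
  null_state Ts Td v.
Proof.
move=> Sv h; apply: (homogeneous_zero hdom hTs hTd conf k1 mu0 kf0 km0 al0 sg0
  theta0 C0 traceC regTs beta_gt Sv.1 Sv.2).
  by move=> z Zz; rewrite -form_velocity_test; apply: h; exact: space_velocity.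
by move=> q Pq; rewrite -form_pressure_test; apply: h; exact: space_pressure.
Qed.

Lemma hdg_solution_exists : exists u p, solution u p.
Proof.
have lin c v w z : space v -> space w -> space z ->
    form (c *: v + w) z = c * form v z + form w z.
  move=> Sv Sw Sz.
  exact: (hdg_form_lin fTs fTd facetI _ _ _ _ _ _ (hdg_space_poly Sz)
    c (hdg_space_poly Sv) (hdg_space_poly Sw)).
have S0 : space 0.
  rewrite (_ : 0 = state_of zv zp)//; apply: space_velocity.
  exact: zero_velocity_space.
have [w Sw hw] := symmetric_existence (@hdg_space_lincomb _ _ _ _ _ _ fTs fTd) S0
  (@hdg_space_separated _ _ Ts Td k GamS)
  (hdg_form_sym Ts Td GamI mu kappa_f kappa_m alpha sigma beta)
  lin hdg_form_null load_lincomb (fun z _ => @load_null z) hdg_form_injective.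
exists (vel_of w), (prs_of w); split; [exact: Sw.1|exact: Sw.2| |].
  move=> v Zv; rewrite -form_velocity_test hw; last exact: space_velocity.
  by rewrite /load vel_ofK prs_ofK pressure_load0 ?subr0.
move=> q Pq; rewrite -form_pressure_test hw; last exact: space_pressure.
by rewrite /load vel_ofK prs_ofK velocity_load0 ?sub0r.
Qed.

Lemma hdg_solution_unique u p u' p' : solution u p -> solution u' p' ->
  same_velocity Ts Td u' u /\ same_pressure Ts Td p' p.
Proof.
move=> [Zu Pp e1 e2] [Zu' Pp' e1' e2'].
have S1 : space (state_of u p) by split; rewrite ?vel_ofK ?prs_ofK.
have S2 : space (state_of u' p') by split; rewrite ?vel_ofK ?prs_ofK.
have [L1 L2] := (hdg_space_poly S1, hdg_space_poly S2).
(* The difference of two solutions solves the homogeneous problem. *)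
pose w : state := -1 *: state_of u p + state_of u' p'.
have Sw : space w by exact: hdg_space_lincomb.
have ext s (h : space s) : forall z, space z ->
    form w z = -1 * form (state_of u p) z + form (state_of u' p') z.
  move=> z Sz.
  exact: (hdg_form_lin fTs fTd facetI _ _ _ _ _ _ (hdg_space_poly Sz) (-1) L1 L2).
have Nw : null_state Ts Td w.
  apply: (homogeneous_zero hdom hTs hTd conf k1 mu0 kf0 km0 al0 sg0
    theta0 C0 traceC regTs beta_gt Sw.1 Sw.2).
    move=> z Zz; rewrite -form_velocity_test (ext _ Sw); last exact: space_velocity.
    by rewrite !form_velocity_test !vel_ofK !prs_ofK e1// e1'//; ring.
  move=> q Pq; rewrite -form_pressure_test (ext _ Sw); last exact: space_pressure.
  by rewrite !form_pressure_test !vel_ofK !prs_ofK e2// e2'//; ring.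
have sub (V : lmodType R) (a b : V) : -1 *: a + b = 0 -> b = a.
  by rewrite scaleN1r addrC => /eqP; rewrite subr_eq0 => /eqP.
have subR (a b : R) : -1 * a + b = 0 -> b = a by lra.
have [[n1 n2 n3] [n4 n5 n6 n7 n8]] := Nw.
split; split=> K SK x Kx.
- by apply: sub; have := n1 K SK x Kx; rewrite state_lincomb !vel_ofK.
- by apply: sub; have := n2 K SK x Kx; rewrite state_lincomb !vel_ofK.
- by apply: sub; have := n3 K SK x Kx; rewrite state_lincomb !vel_ofK.
- by apply: subR; have := n4 K SK x Kx; rewrite state_lincomb !prs_ofK.
- by apply: subR; have := n5 K SK x Kx; rewrite state_lincomb !prs_ofK.
- by apply: subR; have := n6 K SK x Kx; rewrite state_lincomb !prs_ofK.
- by apply: subR; have := n7 K SK x Kx; rewrite state_lincomb !prs_ofK.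
- by apply: subR; have := n8 K SK x Kx; rewrite state_lincomb !prs_ofK.
Qed.

End well_posedness.

Theorem theorem3 (R : realType) (d k : nat)
  (hd : d = 2%N \/ d = 3%N) (hk : (1 <= k)%N)
  (Om Os Od : set 'rV[R]_d) (hdom : coupled_domain Om Os Od)
  (M : set (@mesh R d * @mesh R d)) (hM : shape_regular_family Os Od M)
  (alpha sigma_star : R) (halpha : 0 < alpha) (hsigma_star : 0 < sigma_star) :
  exists2 beta0 : R, 0 < beta0 &
    forall (Ts Td : @mesh R d), M (Ts, Td) ->
    forall mu kappa_f kappa_m sigma beta : R,
      0 < mu -> 0 < kappa_f -> 0 < kappa_m ->
      0 < sigma -> sigma <= sigma_star -> beta0 < beta ->
    forall (f : 'rV[R]_d -> 'rV[R]_d) (g : 'rV[R]_d -> R),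
      (forall i : 'I_d, L2 Os (fun x => f x 0 i)) -> L2 Od g ->
    exists (u : velocity R d) (p : pressure R d),
      hdg_solution k Om Os Od Ts Td mu kappa_f kappa_m alpha sigma beta f g u p /\
      forall (u' : velocity R d) (p' : pressure R d),
        hdg_solution k Om Os Od Ts Td mu kappa_f kappa_m alpha sigma beta f g
          u' p' ->
        same_velocity Ts Td u' u /\ same_pressure Ts Td p' p.

Proof.
(* Writing d = n + 1 makes n the dimension of the facets. *)
have [n dE] : exists n, d = n.+1 by case: hd => ->; eexists.
subst d; have [hmesh [theta theta0 reg]] := hM.
(* [C] depends on n and k, and [theta] on the mesh family; both are fixed before the mesh and the
   physical parameters. *)
have [C C0 traceC] := @trace_inequality R n k.
exists (@beta_threshold R n theta C); first exact: beta_threshold_gt0.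
move=> Ts Td MT mu kf km sigma beta mu0 kf0 km0 sg0 _ beta_gt f g L2f L2g.
have [hTs hTd conf] := hmesh Ts Td MT.
have regTs K : K \in Ts -> diameter K <= theta * indiameter K.
  by move=> KT; apply: (reg Ts Td MT); rewrite inE KT.
have [u [p up]] := hdg_solution_exists hdom hTs hTd conf hk L2f L2g mu0 kf0 km0
  halpha sg0 theta0 C0 traceC regTs beta_gt.
exists u, p; split=> // u' p'.
exact: (hdg_solution_unique hdom hTs hTd conf hk mu0 kf0 km0 halpha sg0 theta0 C0
  traceC regTs beta_gt up).
Qed.
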